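(* Let $(X_0,X_1)$ be a compatible couple and $1<q\le\infty$. Let $a\in SV(0,\infty)$ satisfy $$\int_0^\infty t^{-1}a^{-q'}(t)\,dt<\infty .$$ Let $\alpha\in SV(0,\infty)$ be such that $$\int_0^x t^{-1}\alpha^{-q'}(t)\,dt<\infty\ \text{ for all } x>0,\qquad \int_0^\infty t^{-1}\alpha^{-q'}(t)\,dt=\infty,$$ and let $A\in SV(0,\infty)$ be given by $$A(x):=a(x)\ \text{ if } x\in(0,1],\qquad A(x)\approx\alpha(x)\ \text{ if } x\in(1,\infty).$$ Put $$B(x):=A^{-q'/q}(x)\left(\int_0^x t^{-1}A^{-q'}(t)\,dt\right)^{-1}\quad\text{for all } x>0$$ (so $B(x)=\left(\int_0^x t^{-1}A^{-1}(t)\,dt\right)^{-1}$ if $q=\infty$). Then $$(X_0,X_1)_{0,q,a;J}=(X_0,X_0\cap X_1)_{0,q,A;J}=(X_0,X_0\cap X_1)_{0,q,B;K}.$$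
   Context: A pair $(X_0,X_1)$ of Banach spaces is a compatible couple if there is a Hausdorff topological vector space in which both $X_0$ and $X_1$ are continuously embedded. $X_0\cap X_1$ carries the norm $\max\{\|f\|_{X_0},\|f\|_{X_1}\}$ and $X_0+X_1$ the norm $\inf\{\|f_0\|_{X_0}+\|f_1\|_{X_1}: f=f_0+f_1\}$. For $t>0$, $$K(f,t;X_0,X_1):=\inf\{\|f_0\|_{X_0}+t\|f_1\|_{X_1}: f=f_0+f_1,\ f_0\in X_0,\ f_1\in X_1\}\quad (f\in X_0+X_1),$$ $$J(f,t;X_0,X_1):=\max\{\|f\|_{X_0},t\|f\|_{X_1}\}\quad (f\in X_0\cap X_1).$$ For $1\le q\le\infty$, $\|\cdot\|_{q,(c,d)}$ is the $L_q$-norm on $(c,d)$, $1/q+1/q'=1$, and $1/\infty=0$. For a weight $v$ on $(0,\infty)$ (non-negative, measurable, finite a.e.): - $(X_0,X_1)_{0,q,v;K}$ is the set of $f\in X_0+X_1$ with $\|f\|_{0,q,v;K}:=\|t^{-1/q}v(t)K(f,t;X_0,X_1)\|_{q,(0,\infty)}<\infty$. - $(X_0,X_1)_{0,q,v;J}$ is the set of $f\in X_0+X_1$ for which there is a strongly measurable $u:(0,\infty)\to X_0\cap X_1$ with $f=\int_0^\infty u(s)\,\frac{ds}{s}$ (convergence in $X_0+X_1$) and for which $\|f\|_{0,q,v;J}:=\inf\|t^{-1/q}v(t)J(u(t),t;X_0,X_1)\|_{q,(0,\infty)}$ is finite, the infimum being over all such representations of $f$. The same definitions are used for the compatible couple $(X_0,X_0\cap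 X_1)$. Equality of two spaces means that they are equal as sets and their norms are equivalent. For non-negative expressions, $\mathcal A\approx\mathcal B$ means that each is bounded by a positive constant multiple of the other, the constants being independent of the significant quantities (here, of $x$). $SV(0,\infty)$ is the set of slowly varying functions: positive, finite, Lebesgue-measurable functions $b$ on $(0,\infty)$ such that for each $\varepsilon>0$, $t^{\varepsilon}b(t)$ is equivalent ($\approx$) to a non-decreasing function on $(0,\infty)$ and $t^{-\varepsilon}b(t)$ is equivalent to a non-increasing function on $(0,\infty)$. *)

(* Defs.v *)
From HB Require Import structures.
From mathcomp Require Import all_boot all_order all_algebra.
From mathcomp Require Import all_classical all_reals all_analysis.

Set Implicit Arguments.
Unset Strict Implicit.
Unset Printing Implicit Defensive.

Import Order.TTheory GRing.Theory Num.Theory.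
Import numFieldNormedType.Exports.

Local Open Scope classical_set_scope.
Local Open Scope ring_scope.

(* Both spaces are given as Banach spaces with continuous linear injections
   into the Hausdorff topological vector space [Z]. Local convexity of [Z] is
   not required, hence [topologicalLmodType] and not [tvsType]. *)
Record compatible_couple (R : realType) (Z : topologicalLmodType R) :=
  CompatibleCouple {
    cc_hausdorff : hausdorff_space Z ;
    space0 : completeNormedModType R ;
    space1 : completeNormedModType R ;
    emb0 : {linear space0 -> Z} ;
    emb1 : {linear space1 -> Z} ;
    emb0_inj : injective emb0 ;
    emb1_inj : injective emb1 ;
    emb0_continuous : continuous emb0 ;
    emb1_continuous : continuous emb1 }.

Section intersection.
Context {R : realType} {Z : topologicalLmodType R} (C : compatible_couple Z).

Definition cap_pred : {pred space0 C * space1 C} :=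
  fun p => emb0 C p.1 == emb1 C p.2.

Lemma cap_pred_submod : submod_closed cap_pred.
Proof.
split=> [|a u v]; rewrite !unfold_in/= ?linear0// => /eqP uE /eqP vE.
by rewrite !linearP uE vE.
Qed.

HB.instance Definition _ :=
  GRing.isSubmodClosed.Build R (space0 C * space1 C)%type cap_pred
    (GRing.submod_closed_semi cap_pred_submod).

(* X0 /\ X1: an element is the pair of its copies in X0 and in X1. *)
Record cap := Cap { cap_val : (space0 C * space1 C)%type ;
                    cap_valP : cap_val \in cap_pred }.

HB.instance Definition _ := [isSub for cap_val].
HB.instance Definition _ := [Choice of cap by <:].
HB.instance Definition _ := [SubChoice_isSubLmodule of cap by <:].

Definition cap0 (f : cap) : space0 C := (cap_val f).1.
Definition cap1 (f : cap) : space1 C := (cap_val f).2.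

Definition cap_norm (f : cap) : R := Num.max `|cap0 f| `|cap1 f|.

Lemma cap_normE f : cap_norm f = `|cap_val f|.
Proof. by rewrite prod_normE. Qed.

Let cap_normD f g : cap_norm (f + g) <= cap_norm f + cap_norm g.
Proof. by rewrite !cap_normE; exact: ler_normD. Qed.

Let cap_normZ (l : R) f : cap_norm (l *: f) = `|l| * cap_norm f.
Proof. by rewrite !cap_normE; exact: normrZ. Qed.

Let cap_norm0 f : cap_norm f = 0 -> f = 0.
Proof. by rewrite cap_normE => /normr0_eq0 f0; apply: val_inj. Qed.

HB.instance Definition _ :=
  Lmodule_isNormed.Build R cap cap_normD cap_normZ cap_norm0.

Lemma cap0_linear : linear cap0.
Proof. by []. Qed.
HB.instance Definition _ :=
  GRing.isLinear.Build R cap (space0 C) *:%R cap0 cap0_linear.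

Lemma cap1_linear : linear cap1.
Proof. by []. Qed.
HB.instance Definition _ :=
  GRing.isLinear.Build R cap (space1 C) *:%R cap1 cap1_linear.

Lemma norm_capE (f : cap) : `|f| = Num.max `|cap0 f| `|cap1 f|.
Proof. by []. Qed.

Lemma emb_cap (f : cap) : emb0 C (cap0 f) = emb1 C (cap1 f).
Proof. exact/eqP/(cap_valP f). Qed.

Lemma cap0_continuous : continuous cap0.
Proof.
move=> f; apply/(@cvgrPdist_lt _ _ _ _ (nbhs_filter f)) => e e0.
apply/(@nbhs_ballP R cap); exists e => //= g; rewrite -ball_normE /=.
by apply: le_lt_trans; rewrite -linearB norm_capE le_max lexx.
Qed.

Lemma cap1_continuous : continuous cap1.
Proof.
move=> f; apply/(@cvgrPdist_lt _ _ _ _ (nbhs_filter f)) => e e0.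
apply/(@nbhs_ballP R cap); exists e => //= g; rewrite -ball_normE /=.
by apply: le_lt_trans; rewrite -linearB norm_capE le_max lexx orbT.
Qed.

Lemma cap_complete (F : set_system cap) :
  ProperFilter F -> cauchy F -> cvg F.
Proof.
move=> FF /cauchy_ballP cF.
have ball_cap (f g : cap) (e : R) :
    ball f e g = (ball (cap0 f) e (cap0 g) /\ ball (cap1 f) e (cap1 g)).
  rewrite -!ball_normE /= -!linearB norm_capE gt_max.
  by apply/propext; split=> [/andP//|[-> ->]].
have /cauchy_cvg/cvg_ex[/= x0 Fx0] : cauchy (cap0 @ F).
  apply/cauchy_ballP => e /cF [[P Q] [/= FP FQ]] PQ.
  exists (cap0 @` P, cap0 @` Q) => /=.
    by split; [apply: filterS FP|apply: filterS FQ] => f Pf; exists f.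
  move=> [_ _] [/= [f Pf <-] [g Qg <-]].
  by have := PQ (f, g) (conj Pf Qg); rewrite /= ball_cap => -[].
have /cauchy_cvg/cvg_ex[/= x1 Fx1] : cauchy (cap1 @ F).
  apply/cauchy_ballP => e /cF [[P Q] [/= FP FQ]] PQ.
  exists (cap1 @` P, cap1 @` Q) => /=.
    by split; [apply: filterS FP|apply: filterS FQ] => f Pf; exists f.
  move=> [_ _] [/= [f Pf <-] [g Qg <-]].
  by have := PQ (f, g) (conj Pf Qg); rewrite /= ball_cap => -[].
have x01 : (x0, x1) \in cap_pred.
  have e0 : (emb0 C \o cap0) @ F --> emb0 C x0.
    exact: (cvg_comp _ _ Fx0 (@emb0_continuous _ _ C x0)).
  have e1 : (emb1 C \o cap1) @ F --> emb1 C x1.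
    exact: (cvg_comp _ _ Fx1 (@emb1_continuous _ _ C x1)).
  have eE : emb1 C \o cap1 = emb0 C \o cap0.
    by apply/funext => f /=; rewrite emb_cap.
  rewrite eE in e1.
  by apply/eqP; exact: (cvg_unique (cc_hausdorff C) e0 e1).
apply/cvg_ex; exists (Cap x01); apply/cvg_ballP => e e0.
near=> f; rewrite ball_cap; split; near: f.
- by move/cvg_ballP : Fx0; exact.
- by move/cvg_ballP : Fx1; exact.
Unshelve. all: by end_near. Qed.

HB.instance Definition _ := Uniform_isComplete.Build cap cap_complete.

Lemma cap0_inj : injective cap0.
Proof.
move=> f g fg; apply: val_inj; rewrite [LHS]surjective_pairing.
rewrite [RHS]surjective_pairing; congr pair; first exact: fg.
by apply: (@emb1_inj _ _ C); rewrite -!emb_cap fg.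
Qed.

(* The couple (X0, X0 /\ X1). *)
Definition cap_couple : compatible_couple Z := @CompatibleCouple R Z
  (cc_hausdorff C) (space0 C) cap (emb0 C) (emb0 C \o cap0)
  (@emb0_inj _ _ C) (inj_comp (@emb0_inj _ _ C) cap0_inj)
  (@emb0_continuous _ _ C)
  (fun f => continuous_comp (@cap0_continuous f) (@emb0_continuous _ _ C _)).

End intersection.

Section sum.
Context {R : realType} {Z : topologicalLmodType R} (C : compatible_couple Z).

Definition decomp (f : Z) : set (space0 C * space1 C) :=
  [set p | f = emb0 C p.1 + emb1 C p.2].

Definition sum_pred : {pred Z} := fun f => `[< exists p, decomp f p >].

Lemma sum_predP (f : Z) : reflect (exists p, decomp f p) (f \in sum_pred).
Proof. exact: asboolP. Qed.

Lemma sum_pred_submod : submod_closed sum_pred.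
Proof.
split=> [|a u v].
  by apply/sum_predP; exists 0; rewrite /decomp /= !linear0 addr0.
move=> /sum_predP[p /= ->] /sum_predP[q /= ->]; apply/sum_predP.
by exists (a *: p + q); rewrite /decomp /= !linearP scalerDr addrACA.
Qed.

HB.instance Definition _ := GRing.isSubmodClosed.Build R Z sum_pred
  (GRing.submod_closed_semi sum_pred_submod).

(* X0 + X1, as a subspace of the ambient space. *)
Record sum_space := SumSpace { sum_val : Z ; sum_valP : sum_val \in sum_pred }.

HB.instance Definition _ := [isSub for sum_val].
HB.instance Definition _ := [Choice of sum_space by <:].
HB.instance Definition _ := [SubChoice_isSubLmodule of sum_space by <:].

Definition sum_norm (f : sum_space) : R :=
  inf [set `|p.1| + `|p.2| | p in decomp (sum_val f)].

Let sums (f : sum_space) : set R :=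
  [set `|p.1| + `|p.2| | p in decomp (sum_val f)].

Let sums_lb f : lbound (sums f) 0.
Proof. by move=> _ [p _ <-]; rewrite addr_ge0. Qed.

Let sums_inf f : has_inf (sums f).
Proof.
split; last by exists 0; exact: sums_lb.
by have /sum_predP[p pf] := sum_valP f; exists (`|p.1| + `|p.2|), p.
Qed.

Let sum_norm_ge0 f : 0 <= sum_norm f.
Proof. by apply: lb_le_inf; [case: (sums_inf f)|exact: sums_lb]. Qed.

Let sum_norm_le f p : decomp (sum_val f) p -> sum_norm f <= `|p.1| + `|p.2|.
Proof. by move=> pf; apply: ge_inf; [case: (sums_inf f)|exists p]. Qed.

Let sum_norm_adh f (e : R) : 0 < e ->
  exists2 p, decomp (sum_val f) p & `|p.1| + `|p.2| < sum_norm f + e.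
Proof.
by move=> /(inf_adherent)/(_ (sums_inf f))[_ [p pf <-] pe]; exists p.
Qed.

Let sum_normD f g : sum_norm (f + g) <= sum_norm f + sum_norm g.
Proof.
apply/ler_addgt0Pr => e e0; have e20 : 0 < e / 2 by rewrite divr_gt0.
have [p pf pe] := sum_norm_adh f e20; have [q qg qe] := sum_norm_adh g e20.
have fg : decomp (sum_val (f + g)) (p + q).
  by rewrite /decomp /= linearD pf qg !linearD addrACA.
apply: (le_trans (sum_norm_le fg)) => /=.
rewrite (splitr e) addrACA.
apply: le_trans (lerD (ltW pe) (ltW qe)).
by rewrite addrACA lerD// ler_normD.
Qed.

Let sum_normZ_le (l : R) f : sum_norm (l *: f) <= `|l| * sum_norm f.
Proof.
apply/ler_addgt0Pr => e e0.
have e1 : 0 < e / (`|l| + 1) by rewrite divr_gt0// ltr_pwDr.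
have [p pf pe] := sum_norm_adh f e1.
have lf : decomp (sum_val (l *: f)) (l *: p).
  by rewrite /decomp /= linearZ pf /= !linearZ scalerDr.
apply: (le_trans (sum_norm_le lf)) => /=.
rewrite !normrZ -mulrDr; apply: le_trans (ler_wpM2l _ (ltW pe)) _ => //.
rewrite mulrDr lerD2l mulrCA ler_piMr ?(ltW e0)//.
by rewrite ler_pdivrMr ?ltr_pwDr// mul1r lerDl.
Qed.

Let sum_normZ (l : R) f : sum_norm (l *: f) = `|l| * sum_norm f.
Proof.
apply/eqP; rewrite eq_le sum_normZ_le /=.
have [->|l0] := eqVneq l 0; first by rewrite normr0 mul0r.
rewrite -ler_pdivlMl ?normr_gt0// -normfV.
by apply: le_trans (sum_normZ_le _ _); rewrite scalerA mulVf// scale1r.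
Qed.

Let sum_norm0 f : sum_norm f = 0 -> f = 0.
Proof.
move=> f0; apply: val_inj => /=.
have /choice[p pP] (n : nat) : exists p, decomp (sum_val f) p /\
    `|p.1| + `|p.2| < n.+1%:R^-1.
  have [|p pf] := @sum_norm_adh f n.+1%:R^-1; first by rewrite invr_gt0.
  by rewrite f0 add0r => pn; exists p.
have pn (n : nat) : `|(p n).1| < n.+1%:R^-1 /\ `|(p n).2| < n.+1%:R^-1.
  have [_ h] := pP n.
  by split; apply: le_lt_trans h; rewrite ?lerDl ?lerDr.
have cvg_inv : (fun n : nat => n.+1%:R^-1 : R) @ \oo --> (0 : R).
  exact: cvg_harmonic.
have p1 : (fun n => (p n).1) @ \oo --> (0 : space0 C).
  apply/cvgr0Pnorm_lt => e e0; near=> n.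
  apply: lt_trans (proj1 (pn n)) _.
  by near: n; exact: (cvgr_lt (0 : R)).
have p2 : (fun n => (p n).2) @ \oo --> (0 : space1 C).
  apply/cvgr0Pnorm_lt => e e0; near=> n.
  apply: lt_trans (proj2 (pn n)) _.
  by near: n; exact: (cvgr_lt (0 : R)).
have c0 : (emb0 C \o (fun n => (p n).1)) @ \oo --> emb0 C 0.
  exact: (cvg_comp _ _ p1 (@emb0_continuous _ _ C 0)).
have c1 : (emb1 C \o (fun n => (p n).2)) @ \oo --> emb1 C 0.
  exact: (cvg_comp _ _ p2 (@emb1_continuous _ _ C 0)).
rewrite !linear0 in c0 c1.
have c01 : (fun n => (emb0 C (p n).1, emb1 C (p n).2)) @ \oo -->
    ((0, 0) : Z * Z) by exact: cvg_pair.
have := cvg_comp _ _ c01 (@add_continuous Z (0, 0)).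
rewrite /= addr0 => cf.
have : (fun=> sum_val f) @ \oo --> (0 : Z).
  rewrite (_ : (fun=> _) = (fun x : Z * Z => x.1 + x.2) \o
      (fun n => (emb0 C (p n).1, emb1 C (p n).2)))//.
  by apply/funext => n /=; have [] := pP n.
by move/(cvg_unique (cc_hausdorff C) (cvg_cst (sum_val f))).
Unshelve. all: by end_near. Qed.

HB.instance Definition _ :=
  Lmodule_isNormed.Build R sum_space sum_normD sum_normZ sum_norm0.

Lemma cap_in_sum (f : cap C) : emb0 C (cap0 f) \in sum_pred.
Proof.
by apply/sum_predP; exists (cap0 f, 0); rewrite /decomp /= linear0 addr0.
Qed.

Definition cap_to_sum (f : cap C) : sum_space := SumSpace (cap_in_sum f).

End sum.
Arguments decomp {R Z} C f.
Arguments sum_pred {R Z} C.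

(* Lebesgue measure on the sigma-algebra of all Lebesgue-measurable sets, not
   only the Borel ones. [Leb R] is convertible to [R]. *)
Notation Leb R := (caratheodory_type ((@wlength R idfun)^*)%mu).
Notation leb R := (@completed_lebesgue_measure R).

Section bochner.
Context d (T : measurableType d) {R : realType}.
Variables (mu : {measure set T -> \bar R}) (D : set T).
Context {V : normedModType R}.

Definition simple_measurable (s : T -> V) :=
  finite_set (range s) /\ forall y, measurable (D `&` s @^-1` [set y]).

Definition strongly_measurable (u : T -> V) := exists s : nat -> T -> V,
  (forall n, simple_measurable (s n)) /\
  {ae mu, forall x, D x -> s n x @[n --> \oo] --> u x}.

Definition simple_integrable (s : T -> V) := simple_measurable s /\
  forall y, y != 0 -> (mu (D `&` s @^-1` [set y]) < +oo)%E.

Definition simple_integral (s : T -> V) : V :=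
  \sum_(y \in range s) fine (mu (D `&` s @^-1` [set y])) *: y.

Definition is_bochner_integral (u : T -> V) (l : V) :=
  strongly_measurable u /\
  exists s : nat -> T -> V,
    [/\ forall n, simple_integrable (s n),
        (\int[mu]_(x in D) (`|u x - s n x|%:E))%E @[n --> \oo] --> 0%E &
        simple_integral (s n) @[n --> \oo] --> l].

End bochner.

Section slowly_varying.
Context {R : realType}.

Definition approx_on (D : set R) (f g : R -> R) := exists c C : R,
  [/\ 0 < c, 0 < C & forall x, D x -> f x <= C * g x /\ g x <= c * f x].

Definition slowly_varying (b : R -> R) :=
  [/\ forall t, 0 < t -> 0 < b t,
      measurable_fun (`]0, +oo[ : set (Leb R)) (b : Leb R -> R) &
      forall e, 0 < e ->
        (exists2 g : R -> R, {in `]0, +oo[ &, {homo g : x y / x <= y}} &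
           approx_on `]0, +oo[ (fun t => t `^ e * b t) g) /\
        (exists2 g : R -> R, {in `]0, +oo[ &, {homo g : x y / x <= y >-> y <= x}} &
           approx_on `]0, +oo[ (fun t => t `^ (- e) * b t) g)].

End slowly_varying.

Section interpolation.
Context {R : realType} {Z : topologicalLmodType R}.

Record normed_subspace := NormedSubspace {
  carrier : set Z ;
  subnorm : Z -> \bar R }.

Definition same_space (E F : normed_subspace) :=
  carrier E = carrier F /\
  exists c C : R, [/\ 0 < c, 0 < C & forall f, carrier E f ->
    (c%:E * subnorm E f <= subnorm F f)%E /\
    (subnorm F f <= C%:E * subnorm E f)%E].

Variable C : compatible_couple Z.

Definition K_functional (f : Z) (t : R) : R :=
  inf [set `|p.1| + t * `|p.2| | p in decomp C f].

Definition J_functional (f : cap C) (t : R) : R :=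
  Num.max `|cap0 f| (t * `|cap1 f|).

(* The L_q-norm over ]0, +oo[ of t^(-1/q) v(t) phi(t). *)
Definition weighted_norm (q : \bar R) (v phi : R -> R) : \bar R :=
  ('N[leb R]_q [((fun t : Leb R => (t `^ (- fine q^-1) * v t * phi t)%:E)
     \_ `]0%R, +oo[)])%E.

Definition K_norm (q : \bar R) (v : R -> R) (f : Z) : \bar R :=
  weighted_norm q v (K_functional f).

Definition K_space (q : \bar R) (v : R -> R) : normed_subspace :=
  NormedSubspace
    [set f | f \in sum_pred C /\ (K_norm q v f < +oo)%E] (K_norm q v).

(* [f] is the integral of [u] against [ds/s]: [u] is strongly measurable with
   values in X0 /\ X1, the integral is a Bochner integral in X0 + X1. *)
Definition J_represents (u : R -> cap C) (f : Z) :=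
  strongly_measurable (leb R) `]0, +oo[ u /\
  exists2 F : sum_space C, sum_val F = f &
    is_bochner_integral (leb R) `]0, +oo[
      (fun s : Leb R => (s^-1 : R) *: cap_to_sum (u s)) F.

Definition J_norm (q : \bar R) (v : R -> R) (f : Z) : \bar R :=
  ereal_inf [set weighted_norm q v (fun t => J_functional (u t) t) |
             u in [set u | J_represents u f]].

Definition J_space (q : \bar R) (v : R -> R) : normed_subspace :=
  NormedSubspace
    [set f | (exists u, J_represents u f) /\ (J_norm q v f < +oo)%E]
    (J_norm q v).

End interpolation.

(* Main.v *)
Require Import Defs.
From HB Require Import structures.
From mathcomp Require Import all_boot all_order all_algebra.
From mathcomp Require Import all_classical all_reals all_analysis.
From mathcomp Require Import measurable_realfun ess_sup_inf lra ring.

Set Implicit Arguments.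
Unset Strict Implicit.
Unset Printing Implicit Defensive.

Import Order.TTheory GRing.Theory Num.Theory.
Import numFieldNormedType.Exports.

Local Open Scope classical_set_scope.
Local Open Scope ring_scope.

(** Let [w = A^(-q')], let [W x] be the integral of [w(t)/t] over [(0, x)], so
    that [B = A^(-q'/q) / W], and write Y for the couple (X0, X0 /\ X1).  [W] is
    finite because [A] is [a] near 0 and slow variation bounds [A] on compact
    intervals; it increases from 0 to infinity because [A] is comparable to
    [alpha] near infinity.

    The first equality.  Over [1, oo) the integral of a representation [u] of
    [f] converges in X0 /\ X1: the weight and Hoelder's inequality bound the
    integral of [|u(s)|/s] there.  Let [g] be that partial integral.  Since
    [s g] has integral [g] over (0, 1) against [ds/s], [f] is also represented
    by [u(s) + s g] on (0, 1) and 0 beyond 1 ([fold_representation]).  The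
    folded representation only meets the weights on (0, 1), where [a = A] and
    where the two J-functionals are controlled by the same bounds, so it serves
    in both spaces ([fold_transfer]).  For X the Hoelder step uses the
    integrability of [a^(-q')/t] over the whole half-line.  For Y it uses that
    [J(v, s) >= s |v|], which supplies a factor [1/s] for [s >= 1].

    J-space into K-space.  Cutting the integral of [u] at [t] decomposes [f] and
    gives [K(f, t) <= int min(1, t/s) J(u(s), s) ds/s]
    ([K_functional_le_kernel]).  A Hardy-type inequality for this kernel turns
    the weight [A] into the weight [B] ([hardy_kernel]).  It is proved as
    Schur's test: Hoelder's inequality with an auxiliary power of [W], then
    Tonelli.  Slow variation enters through the two kernel estimates
    [kernel_head] and [kernel_tail].

    K-space into J-space.  Choose points [s_n] with [W(s_n) = 2^(-n)] and, for
    [n > 0], nearly optimal decompositions [f = p_n + r_n] for [K(f, s_n)]; start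
    from [p_0 = f], [r_0 = 0].  The differences [g_n = r_(n+1) - r_n] lie in
    X0 /\ X1 and telescope to [f - p_N], with [p_N] tending to 0 in X0 because
    [K(f, s_n)] is at most a multiple of [W(s_n)^(1/q')].  Spread [g_n] over
    [[s_(n+2), s_(n+1))] with density [w(t)/t]: there the J-functional of [g_n] is
    at most a multiple of [K(f, s_n)].  The resulting norm is compared, block by
    block, with the K-norm over [[s_n, s_(n-1))], where [K(f, t) >= K(f, s_n)] and
    [W] is of size [2^(-n)] ([weighted_bound_step]).  The crude first
    decomposition costs only a constant, as [K(f, t) >= min(1, t) |f|] for the
    couple Y.

    The integrals of vector-valued functions are Bochner integrals, whose basic
    theory comes first. *)

(** * Finitely valued functions and integrals of simple functions *)

Section finite_valued.
Context d (T : measurableType d) (D : set T).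

(** Stated for all preimages and an arbitrary codomain, so that it is stable
    under pairing and composition, also through types without a norm. *)
Definition finite_valued (U : Type) (c : T -> U) :=
  finite_set (range c) /\ forall P : set U, measurable (D `&` c @^-1` P).

Lemma simple_measurableP (R : realType) (V : normedModType R) (s : T -> V) :
  simple_measurable D s <-> finite_valued s.
Proof.
split=> -[fs ms]; split=> // P.
rewrite [X in measurable X](_ : _ =
    \bigcup_(y in range s `&` P) (D `&` s @^-1` [set y])).
  by apply: fin_bigcup_measurable => //; exact: finite_setIl.
apply/seteqP; split=> [x [Dx Px]|x [y [_ Py] [Dx /= sxy]]] //=.
  by exists (s x) => //; split => //; exists x.
by rewrite sxy.
Qed.

Lemma finite_valued_comp (U V : Type) (c : T -> U) (g : U -> V) :
  finite_valued c -> finite_valued (g \o c).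
Proof.
move=> [fc mc]; split=> [|P]; last by rewrite comp_preimage; exact: mc.
by rewrite -(image_comp c g); exact: finite_image.
Qed.

Lemma finite_valued_pair (U V : Type) (c : T -> U) (e : T -> V) :
  finite_valued c -> finite_valued e -> finite_valued (fun x => (c x, e x)).
Proof.
move=> [fc mc] [fe me].
have fce : finite_set (range (fun x => (c x, e x))).
  apply: sub_finite_set (finite_setX fc fe) => _ [x _ <-] /=.
  by split; exists x.
split=> // P.
rewrite [X in measurable X](_ : _ =
    \bigcup_(z in range (fun x => (c x, e x)) `&` P)
      ((D `&` c @^-1` [set z.1]) `&` (D `&` e @^-1` [set z.2]))).
  apply: fin_bigcup_measurable; first exact: finite_setIl.
  by move=> z _; apply: measurableI; [exact: mc|exact: me].
apply/seteqP; split=> [x [Dx Px]|x [[a b] [_ Py] [[Dx /= ca] [_ /= eb]]]] /=.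
  by exists (c x, e x) => //; split => //; exists x.
by rewrite ca eb.
Qed.

Lemma finite_valued_mem (U : Type) (c : T -> U) (P : set T) (u : U) :
    measurable D -> measurable P -> finite_valued c ->
  finite_valued (fun x => if x \in P then c x else u).
Proof.
move=> mD mP [fc mc]; split=> [|Q].
  apply: (@sub_finite_set _ _ (range c `|` [set u])).
    by move=> _ [x _ <-]; case: ifP => _; [left; exists x|right].
  by rewrite finite_setU.
rewrite [X in measurable X](_ : _ = (P `&` (D `&` c @^-1` Q)) `|`
    (~` P `&` (D `&` [set _ | Q u]))).
  apply: measurableU; first exact: measurableI.
  apply: measurableI; first exact: measurableC.
  have [Qu|Qu] := pselect (Q u).
    by rewrite (_ : [set _ | _] = setT) ?setIT//; apply/seteqP; split.
  by rewrite (_ : [set _ | _] = set0) ?setI0//; apply/seteqP; split.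
apply/seteqP; split=> [x [Dx /=]|x [[Px [Dx Qx]]|[Px [Dx Qx]]]] /=.
- have [xP|xP] := boolP (x \in P) => Qx.
    by left; split => //; exact: set_mem.
  by right; split => // /mem_set; rewrite (negbTE xP).
- by rewrite mem_set.
- by rewrite memNset.
Qed.

Lemma finite_valued_cst (U : Type) (u : U) :
  measurable D -> finite_valued (fun _ : T => u).
Proof.
move=> mD; split=> [|P].
  by apply: (@sub_finite_set _ _ [set u]) => // _ [x _ <-].
have [Pu|Pu] := pselect (P u).
  by rewrite (_ : _ @^-1` _ = setT) ?setIT//; apply/seteqP; split.
by rewrite (_ : _ @^-1` _ = set0) ?setI0//; apply/seteqP; split.
Qed.

Lemma finite_valued_measurable d' (U : measurableType d') (c : T -> U) :
  finite_valued c -> measurable_fun D c.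
Proof. by move=> [_ mc] _ Y _; exact: mc. Qed.

End finite_valued.

Section simple_integral.
Context d (T : measurableType d) {R : realType}.
Variables (mu : {measure set T -> \bar R}) (D : set T).
Hypothesis mD : measurable D.

(** Computes the integral of a simple function on a partition finer than the
    one by its values.  Choosing a partition that refines two simple functions
    at once makes the integral additive. *)
Lemma simple_integral_factor (V : normedModType R) (U : choiceType)
    (c : T -> U) (g : U -> V) :
    finite_valued D c ->
    (forall z, g z != 0 -> (mu (D `&` c @^-1` [set z]) < +oo)%E) ->
  simple_integral mu D (g \o c) =
  \sum_(z \in range c) fine (mu (D `&` c @^-1` [set z])) *: g z.
Proof.
move=> [fc mc] fin; rewrite /simple_integral.
have fgc : finite_set (range (g \o c)) by rewrite -(image_comp c g); exact: finite_image.
transitivity (\sum_(y \in range (g \o c)) \sum_(z \in range c)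
    (if g z == y then fine (mu (D `&` c @^-1` [set z])) *: g z else 0)).
  apply: eq_fsbigr => y /set_mem [x _ /= gy].
  have [->|y0] := eqVneq y 0.
    rewrite scaler0 fsbig1// => z _; case: eqP => // ->.
    by rewrite scaler0.
  transitivity (\sum_(z \in range c `&` g @^-1` [set y])
      fine (mu (D `&` c @^-1` [set z])) *: y); last first.
    rewrite fsbig_mkcondr; apply: eq_fsbigr => z _.
    have [<-|gz] := eqVneq (g z) y; first by rewrite mem_set.
    by rewrite memNset//; exact/eqP.
  rewrite [X in mu X](_ : _ = \bigcup_(z in range c `&` g @^-1` [set y])
     (D `&` c @^-1` [set z])); last first.
    apply/seteqP; split=> [z /= [Dz zy]|z [w /= [_ gw] [Dz /= zw]]]; last first.
      by split=> //=; rewrite zw.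
    by exists (c z) => //; split => //; exists z.
  have fA : finite_set (range c `&` g @^-1` [set y]) by exact: finite_setIl.
  rewrite measure_fin_bigcup//; last first.
    by move=> i j _ _ [z [[_ ci] [_ cj]]]; rewrite -ci -cj.
  rewrite !fsbig_finite//= [X in fine X]big_seq -sum_fine.
    by rewrite -big_seq scaler_suml.
  move=> z; rewrite in_fset_set// inE => -[_ /= gz].
  by rewrite ge0_fin_numE//; apply: fin; rewrite gz.
rewrite exchange_fsbig//; apply: eq_fsbigr => z /set_mem [x _ cz].
rewrite (fsbigD1 (g z))//=; last by exists x => //; rewrite cz.
rewrite eqxx fsbig1 ?addr0// => y /= [_ /eqP]; rewrite eq_sym.
by move=> /negbTE ->.
Qed.

(** The support of [F(s1, s2)] lies in the union of the supports of [s1] and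
    [s2], which have finite measure. *)
Lemma simple_integrable_map2 (V1 V2 V : normedModType R) (F : V1 -> V2 -> V)
    (s1 : T -> V1) (s2 : T -> V2) : F 0 0 = 0 ->
    simple_integrable mu D s1 -> simple_integrable mu D s2 ->
  simple_integrable mu D (fun x => F (s1 x) (s2 x)).
Proof.
move=> F0 [/simple_measurableP m1 i1] [/simple_measurableP m2 i2].
have m12 := finite_valued_pair m1 m2.
have mF : finite_valued D (fun x => F (s1 x) (s2 x)).
  exact: (finite_valued_comp (fun z => F z.1 z.2) m12).
split=> [|y y0]; first exact/simple_measurableP.
have fin (V' : normedModType R) (s : T -> V') : simple_integrable mu D s ->
    (mu (D `&` s @^-1` (~` [set 0%R])) < +oo)%E.
  move=> [/simple_measurableP[fs ms] is_].
  rewrite [X in mu X](_ : _ = \bigcup_(z in range s `\ 0)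
     (D `&` s @^-1` [set z])); last first.
    apply/seteqP; split=> [z /= [Dz zy]|z [w /= [_ w0] [Dz /= zw]]]; last first.
      by split=> //=; rewrite zw.
    by exists (s z) => //; split => //; exists z.
  have f0 : finite_set (range s `\ 0) by exact: finite_setIl.
  rewrite measure_fin_bigcup//; last first.
    by move=> i j _ _ [z [[_ ci] [_ cj]]]; rewrite -ci -cj.
  rewrite fsbig_finite//= big_seq.
  apply: (@big_ind _ (fun x => x < +oo)%E) => //.
    by move=> a b; exact: lte_add_pinfty.
  move=> z; rewrite in_fset_set// inE => -[_ /= z0].
  by apply: is_; exact/eqP.
have := lte_add_pinfty (fin _ _ (conj (iffRL (simple_measurableP _ _) m1) i1))
  (fin _ _ (conj (iffRL (simple_measurableP _ _) m2) i2)).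
apply: le_lt_trans; apply: le_trans (measureU2 _ _ _).
- apply: le_measure; rewrite ?inE; first exact: (mF.2 [set y]).
    by apply: measurableU; [exact: m1.2|exact: m2.2].
  move=> x [Dx /= Fxy]; have [s1x|s1x] := eqVneq (s1 x) 0.
    right; split=> //= s2x; move: y0; rewrite -Fxy s1x s2x F0 => /eqP.
    by [].
  by left; split=> //=; exact/eqP.
- exact: m1.2.
- exact: m2.2.
Qed.

Lemma simple_integralD (V : normedModType R) (s1 s2 : T -> V) :
    simple_integrable mu D s1 -> simple_integrable mu D s2 ->
  simple_integral mu D (s1 \+ s2) =
  simple_integral mu D s1 + simple_integral mu D s2.
Proof.
move=> [/simple_measurableP m1 i1] [/simple_measurableP m2 i2].
have m12 := finite_valued_pair m1 m2.
pose c x := (s1 x, s2 x).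
have sub1 z : D `&` c @^-1` [set z] `<=` D `&` s1 @^-1` [set z.1].
  by move=> x [Dx /= <-].
have sub2 z : D `&` c @^-1` [set z] `<=` D `&` s2 @^-1` [set z.2].
  by move=> x [Dx /= <-].
have fin1 z : z.1 != 0 -> (mu (D `&` c @^-1` [set z]) < +oo)%E.
  move=> z0; apply: le_lt_trans (i1 _ z0); apply: le_measure => //.
  - by rewrite inE; exact: m12.2.
  - by rewrite inE; exact: (m1.2 [set z.1]).
have fin2 z : z.2 != 0 -> (mu (D `&` c @^-1` [set z]) < +oo)%E.
  move=> z0; apply: le_lt_trans (i2 _ z0); apply: le_measure => //.
  - by rewrite inE; exact: m12.2.
  - by rewrite inE; exact: (m2.2 [set z.2]).
have -> : s1 \+ s2 = (fun z => z.1 + z.2) \o c by [].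
rewrite -[in RHS](_ : fst \o c = s1)// -[in RHS](_ : snd \o c = s2)//.
rewrite !simple_integral_factor//; last first.
  move=> z; have [z1 z2|z1 _] := eqVneq z.1 0; last exact: fin1.
  by apply: fin2; move: z2; rewrite z1 add0r.
rewrite -fsbig_split/=; last exact: m12.1.
by apply: eq_fsbigr => z _; rewrite scalerDr.
Qed.

Lemma simple_integral_linear (V W : normedModType R) (L : {linear V -> W})
    (s : T -> V) : simple_integrable mu D s ->
  simple_integral mu D (L \o s) = L (simple_integral mu D s).
Proof.
move=> [/simple_measurableP ms is_]; rewrite simple_integral_factor//.
  rewrite /simple_integral !fsbig_finite//=; try exact: ms.1.
  by rewrite linear_sum; apply: eq_bigr => z _; rewrite linearZ.
by move=> z z0; apply: is_; apply: contraNneq z0 => ->; rewrite linear0.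
Qed.

Lemma integral_norm_simple (V : normedModType R) (s : T -> V) :
    simple_integrable mu D s ->
  (\int[mu]_(x in D) `|s x|%:E =
   (\sum_(y \in range s) fine (mu (D `&` s @^-1` [set y])) * `|y|)%:E)%E.
Proof.
move=> [/simple_measurableP ms is_].
pose r := finmap.enum_fset (fset_set (range s)).
have rP y : y \in r = (y \in range s) by rewrite in_fset_set//; exact: ms.1.
pose h (y : V) (x : T) : \bar R := ((`|y| : R) * \1_(D `&` s @^-1` [set y]) x)%:E.
transitivity (\int[mu]_(x in D) (\sum_(y <- r) h y x))%E.
  apply: eq_integral => x /set_mem Dx; rewrite (bigD1_seq (s x))//=; last 2 first.
  - by rewrite rP mem_set//; exists x.
  - exact: finmap.fset_uniq.
  rewrite /h indicE mem_set// mulr1 big1 ?adde0// => y yx.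
  by rewrite indicE memNset ?mulr0// => -[_ /=] /esym; exact/eqP.
have mh y : measurable_fun D (h y).
  apply/measurable_EFinP; apply: measurable_funM => //.
  by apply: measurable_indic; exact: ms.2.
rewrite ge0_integral_sum//; last by move=> n x Dx; rewrite lee_fin mulr_ge0.
rewrite fsbig_finite//=; last exact: ms.1.
rewrite -sumEFin; apply: eq_bigr => y _.
rewrite /h; under eq_integral do rewrite EFinM.
rewrite ge0_integralZl//; last first.
  by apply/measurable_EFinP; apply: measurable_indic; exact: ms.2.
rewrite integral_indic//; last exact: ms.2.
rewrite setIAC setIid muleC; have [->|y0] := eqVneq y 0.
  by rewrite normr0 mule0 mulr0.
by rewrite EFinM fineK// ge0_fin_numE// is_.
Qed.

Lemma ler_norm_simple_integral (V : normedModType R) (s : T -> V) :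
    simple_integrable mu D s ->
  (`|simple_integral mu D s|%:E <= \int[mu]_(x in D) `|s x|%:E)%E.
Proof.
move=> is_; rewrite integral_norm_simple// lee_fin /simple_integral.
have fs := is_.1.1; rewrite !fsbig_finite//=.
apply: le_trans (ler_norm_sum _ _ _) _; apply: ler_sum => y _.
by rewrite normrZ ger0_norm// fine_ge0.
Qed.

End simple_integral.

(** * Strongly measurable functions *)

Section strongly_measurable.
Context d (T : measurableType d) {R : realType}.
Variables (mu : {measure set T -> \bar R}) (D : set T).
Hypothesis mD : measurable D.

Lemma strongly_measurable_finite (V : normedModType R) (s : T -> V) :
  finite_valued D s -> strongly_measurable mu D s.
Proof.
move=> fs; exists (fun=> s); split=> [n|]; first exact/simple_measurableP.
by apply: aeW => x _; exact: cvg_cst.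
Qed.

(** Apply [F] to approximating sequences of both arguments.  Sums, scalar
    multiples and continuous images are instances. *)
Lemma strongly_measurable_map2 (V1 V2 V : normedModType R)
    (F : V1 -> V2 -> V) (u1 : T -> V1) (u2 : T -> V2) :
    (forall z : V1 * V2, {for z, continuous (fun z => F z.1 z.2)}) ->
    strongly_measurable mu D u1 -> strongly_measurable mu D u2 ->
  strongly_measurable mu D (fun x => F (u1 x) (u2 x)).
Proof.
move=> cF [s1 [ms1 c1]] [s2 [ms2 c2]].
exists (fun n x => F (s1 n x) (s2 n x)); split=> [n|].
  apply/simple_measurableP.
  apply: (finite_valued_comp (fun z => F z.1 z.2) (c := fun x => (s1 n x, s2 n x))).
  by apply: finite_valued_pair; apply/simple_measurableP.
apply: filterS2 c1 c2 => x c1 c2 Dx.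
apply: (cvg_comp (fun n => (s1 n x, s2 n x)) (fun z => F z.1 z.2)
  _ (cF (u1 x, u2 x))).
by apply: cvg_pair; [exact: c1|exact: c2].
Qed.

Lemma strongly_measurable_comp (V W : normedModType R) (F : V -> W)
    (u : T -> V) : continuous F ->
  strongly_measurable mu D u -> strongly_measurable mu D (F \o u).
Proof.
move=> cF su.
apply: (@strongly_measurable_map2 V V W (fun a _ => F a) u u) => // z.
by apply: (@continuous_comp _ _ _ fst F); [exact: cvg_fst|exact: cF].
Qed.

Lemma strongly_measurableD (V : normedModType R) (u v : T -> V) :
    strongly_measurable mu D u -> strongly_measurable mu D v ->
  strongly_measurable mu D (u \+ v).
Proof.
by apply: strongly_measurable_map2 => z; exact: add_continuous.
Qed.

Lemma strongly_measurableB (V : normedModType R) (u v : T -> V) :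
    strongly_measurable mu D u -> strongly_measurable mu D v ->
  strongly_measurable mu D (u \- v).
Proof.
apply: (@strongly_measurable_map2 V V V (fun a b => a - b)) => z.
exact: sub_continuous.
Qed.

Lemma strongly_measurable_mem (V : normedModType R) (P : set T) (u : T -> V) :
    measurable P -> strongly_measurable mu D u ->
  strongly_measurable mu D (fun x => if x \in P then u x else 0).
Proof.
move=> mP [s [ms cs]]; exists (fun n x => if x \in P then s n x else 0).
split=> [n|].
  apply/simple_measurableP; apply: finite_valued_mem => //.
  exact/simple_measurableP.
apply: filterS cs => x cs Dx; case: ifP => _; first exact: cs.
exact: cvg_cst.
Qed.

Import HBSimple.

Lemma strongly_measurable_real (f : T -> R) :
  measurable_fun D f -> strongly_measurable mu D f.
Proof.
move=> mf; have mEf : measurable_fun D (EFin \o f) by exact/measurable_EFinP.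
have [g gf] := approximation_sfun mD mEf.
exists (fun n => g n : T -> R); split=> [n|]; last first.
  apply: aeW => x Dx; have := gf x Dx; by move/fine_cvgP => [_].
split=> [|y]; first exact: fimfunP.
by apply: measurableI => //; rewrite -[X in measurable X]setTI; exact: measurable_funP.
Qed.

Lemma strongly_measurableZ (V : normedModType R) (f : T -> R) (u : T -> V) :
    measurable_fun D f -> strongly_measurable mu D u ->
  strongly_measurable mu D (fun x => f x *: u x).
Proof.
move=> /strongly_measurable_real sf su.
by apply: (@strongly_measurable_map2 R V V (fun a b => a *: b)) sf su => z;
  exact: scale_continuous.
Qed.

Hypothesis cmu : measure_is_complete mu.

(** The norm is almost everywhere a limit of norms of simple functions;
    completeness of the measure absorbs the exceptional set. *)
Lemma strongly_measurable_norm (V : normedModType R) (u : T -> V) :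
  strongly_measurable mu D u -> measurable_fun D (fun x => `|u x| : R).
Proof.
move=> [s [ms cs]]; apply/measurable_EFinP.
have mns n : measurable_fun D (fun x => (`|s n x| : R)%:E).
  apply/measurable_EFinP; apply: finite_valued_measurable.
  apply: (finite_valued_comp (fun v => `|v| : R)).
  exact/simple_measurableP.
apply: (ae_measurable_fun cmu _ (measurable_fun_limn_esup mns)).
apply: filterS cs => x cs Dx; rewrite limn_esup_lim; apply: cvg_lim => //.
apply: cvg_esups; apply: cvg_EFin; first exact: nearW.
by apply: cvg_norm; exact: cs.
Qed.

End strongly_measurable.

(** * The Bochner integral *)

Section bochner_theory.
Context d (T : measurableType d) {R : realType}.
Variables (mu : {measure set T -> \bar R}) (D : set T).
Hypotheses (mD : measurable D) (cmu : measure_is_complete mu).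

Lemma le_integral_norm2 (V V1 V2 : normedModType R) (f : T -> V)
    (g : T -> V1) (h : T -> V2) :
    strongly_measurable mu D f -> strongly_measurable mu D g ->
    strongly_measurable mu D h ->
    (forall x, D x -> `|f x| <= `|g x| + `|h x|) ->
  (\int[mu]_(x in D) `|f x|%:E <=
   \int[mu]_(x in D) `|g x|%:E + \int[mu]_(x in D) `|h x|%:E)%E.
Proof.
move=> /(strongly_measurable_norm cmu) /measurable_EFinP mf.
move=> /(strongly_measurable_norm cmu) /measurable_EFinP mg.
move=> /(strongly_measurable_norm cmu) /measurable_EFinP mh fgh.
rewrite -ge0_integralD//; apply: ge0_le_integral => //.
exact: emeasurable_funD.
Qed.

Lemma simple_strongly_measurable (V : normedModType R) (s : T -> V) :
  simple_integrable mu D s -> strongly_measurable mu D s.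
Proof. by move=> [/simple_measurableP fs _]; exact: strongly_measurable_finite. Qed.

(** The estimate behind both uniqueness and existence: integrals of two simple
    functions close to [u] in L1 are close to each other. *)
Lemma ler_dist_simple_integral (V : normedModType R) (u s t : T -> V) :
    strongly_measurable mu D u ->
    simple_integrable mu D s -> simple_integrable mu D t ->
  (`|simple_integral mu D s - simple_integral mu D t|%:E <=
   \int[mu]_(x in D) `|u x - s x|%:E + \int[mu]_(x in D) `|u x - t x|%:E)%E.
Proof.
move=> su is_ it; have ist : simple_integrable mu D (s \- t).
  by apply: (simple_integrable_map2 (F := fun a b => a - b) _ is_ it); rewrite subr0.
have -> : simple_integral mu D s - simple_integral mu D t =
    simple_integral mu D (s \- t).
  apply/eqP; rewrite subr_eq -simple_integralD//; apply/eqP; congr simple_integral.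
  by apply/funext => x /=; rewrite subrK.
apply: le_trans (ler_norm_simple_integral mD ist) _.
have ss := simple_strongly_measurable is_.
have st := simple_strongly_measurable it.
apply: le_integral_norm2; try exact: strongly_measurableB.
by move=> x _ /=; rewrite (distrC (u x) (s x)); exact: ler_distD.
Qed.

Lemma cvg_norm_le0 (V : normedModType R) (v : nat -> V) (I : nat -> \bar R) :
    (forall n, `|v n|%:E <= I n)%E -> I n @[n --> \oo] --> 0%E ->
  v n @[n --> \oo] --> (0 : V).
Proof.
move=> vI I0; apply: norm_cvg0.
have : `|v n|%:E @[n --> \oo] --> (0%R%:E : \bar R).
  apply: (squeeze_cvge _ (@cvg_cst _ _ _ _ _) I0).
  by apply: nearW => n; rewrite lee_fin normr_ge0 vI.
by move/fine_cvg.
Qed.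

Lemma bochner_integral_unique (V : normedModType R) (u : T -> V) (l m : V) :
    is_bochner_integral mu D u l -> is_bochner_integral mu D u m -> l = m.
Proof.
move=> [su [s [is_ us sl]]] [_ [t [it ut tm]]].
apply/eqP; rewrite -subr_eq0; apply/eqP.
have h : simple_integral mu D (s n) - simple_integral mu D (t n)
    @[n --> \oo] --> l - m by exact: cvgB.
have h0 : simple_integral mu D (s n) - simple_integral mu D (t n)
    @[n --> \oo] --> (0 : V).
  apply: (cvg_norm_le0 (fun n => ler_dist_simple_integral su (is_ n) (it n))).
  by rewrite -[X in _ --> X]adde0; apply: cvgeD.
exact: (cvg_unique (@norm_hausdorff _ V) h h0).
Qed.

Lemma bochner_integralD (V : normedModType R) (u v : T -> V) (l m : V) :
    is_bochner_integral mu D u l -> is_bochner_integral mu D v m ->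
  is_bochner_integral mu D (u \+ v) (l + m).
Proof.
move=> [su [s [is_ us sl]]] [sv [t [it ut tm]]].
split; first exact: strongly_measurableD.
exists (fun n => s n \+ t n); split.
- move=> n.
  by apply: (simple_integrable_map2 (F := fun a b => a + b) _ (is_ n) (it n)); rewrite addr0.
- apply: (squeeze_cvge (f := fun=> 0%E) (h := fun n =>
    (\int[mu]_(x in D) `|u x - s n x|%:E + \int[mu]_(x in D) `|v x - t n x|%:E)%E)).
  + apply: nearW => n; rewrite integral_ge0//=.
    have ss := simple_strongly_measurable (is_ n).
    have st := simple_strongly_measurable (it n).
    apply: le_integral_norm2; do ?[exact: strongly_measurableB |
      by apply: strongly_measurableB; exact: strongly_measurableD].
    by move=> x _ /=; rewrite opprD addrACA ler_normD.
  + exact: cvg_cst.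
  + by rewrite -[X in _ --> X]adde0; apply: cvgeD.
- under eq_cvg do rewrite simple_integralD//.
  exact: cvgD.
Qed.

Lemma bochner_integral_norm_le (V : normedModType R) (u : T -> V) (l : V) :
    is_bochner_integral mu D u l ->
  (`|l|%:E <= \int[mu]_(x in D) `|u x|%:E)%E.
Proof.
move=> [su [s [is_ us sl]]].
have [->|uoo] := eqVneq (\int[mu]_(x in D) `|u x|%:E)%E +oo%E; first exact: leey.
have ufin : (\int[mu]_(x in D) `|u x|%:E)%E \is a fin_num.
  by rewrite ge0_fin_numE ?ltey// integral_ge0.
apply: (@lee_cvg_to _ (\oo : set_system nat) _ _
  (fun n => `|simple_integral mu D (s n)|%:E)
  (fun n => \int[mu]_(x in D) `|u x|%:E + \int[mu]_(x in D) `|u x - s n x|%:E)%E).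
- apply: cvg_EFin; first exact: nearW.
  exact: cvg_norm.
- rewrite -[X in _ --> X]adde0; apply: cvgeD => //.
    exact: fin_num_adde_defr.
  exact: cvg_cst.
- apply: nearW => n; apply: le_trans (ler_norm_simple_integral mD (is_ n)) _.
  have ss := simple_strongly_measurable (is_ n).
  apply: le_integral_norm2 => //; first exact: strongly_measurableB.
  move=> x _ /=; have := ler_distD (u x) (s n x) 0.
  by rewrite !subr0 addrC (distrC (s n x)).
Qed.

(** A bounded operator maps approximating simple functions to approximating
    simple functions. *)
Lemma bochner_integral_linear (V W : normedModType R) (L : {linear V -> W})
    (c : R) (u : T -> V) (l : V) :
    (forall v, `|L v| <= c * `|v|) -> is_bochner_integral mu D u l ->
  is_bochner_integral mu D (L \o u) (L l).
Proof.
move=> Lc [su [s [is_ us sl]]].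
have c0 : (0 <= `|c|%:E)%E by rewrite lee_fin.
have {}Lc v : `|L v| <= `|c| * `|v|.
  by apply: le_trans (Lc v) _; rewrite ler_wpM2r// ler_norm.
have cL : continuous L.
  apply/linear_bounded_continuous/linear_boundedP.
  apply: (@filterS _ _ _ (fun r => `|c| <= r)).
    by move=> r cr v; apply: le_trans (Lc v) _; rewrite ler_wpM2r.
  by apply: nbhs_pinfty_ge; exact: num_real.
split; first exact: strongly_measurable_comp.
exists (fun n => L \o s n); split.
- move=> n; have := simple_integrable_map2 (F := fun a _ => L a) _ (is_ n) (is_ n).
  by apply; rewrite ?linear0.
- apply: (squeeze_cvge (f := fun=> 0%E) (h := fun n =>
    (`|c|%:E * \int[mu]_(x in D) `|u x - s n x|%:E)%E)).
  + apply: nearW => n; rewrite integral_ge0//=.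
    have ss := simple_strongly_measurable (is_ n).
    have sus := strongly_measurableB su ss.
    have /measurable_EFinP mus := strongly_measurable_norm cmu sus.
    rewrite -ge0_integralZl//; apply: ge0_le_integral => //.
    * apply/measurable_EFinP; apply: (strongly_measurable_norm cmu).
      by apply: strongly_measurableB; exact: strongly_measurable_comp.
    * exact: measurable_funeM.
    * by move=> x _; rewrite -EFinM lee_fin -linearB.
  + exact: cvg_cst.
  + by rewrite -[X in _ --> X](mule0 `|c|%:E); apply: cvgeZl.
- under eq_cvg do rewrite simple_integral_linear//.
  exact: (cvg_comp _ _ sl (cL l)).
Qed.

End bochner_theory.

Section bochner_existence.
Context d (T : measurableType d) {R : realType}.
Variables (mu : {measure set T -> \bar R}) (D : set T).
Hypotheses (mD : measurable D) (cmu : measure_is_complete mu).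

Lemma cvge0_near_lt (I : nat -> \bar R) (e : R) :
  I n @[n --> \oo] --> 0%E -> 0 < e -> \forall n \near \oo, (I n < e%:E)%E.
Proof.
by move=> I0 e0; apply: (I0 [set x | (x < e%:E)%E]);
  exact: (@nbhs_open_ereal_lt _ 0 (fun=> e)).
Qed.

Lemma simple_integrable_le (V W : normedModType R) (s : T -> V) (u : T -> W) :
    finite_valued D s -> strongly_measurable mu D u ->
    (forall x, D x -> `|s x| <= 2 * `|u x|) ->
    (\int[mu]_(x in D) `|u x|%:E < +oo)%E ->
  simple_integrable mu D s.
Proof.
move=> fs su sleu iu; split=> [|y y0]; first exact/simple_measurableP.
have mP : measurable (D `&` s @^-1` [set y]) by exact: fs.2.
have ny0 : 0 < `|y| by rewrite normr_gt0.
have /measurable_EFinP mu_ := strongly_measurable_norm cmu su.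
have h : (`|y|%:E * mu (D `&` s @^-1` [set y]) <=
    2%:E * \int[mu]_(x in D) `|u x|%:E)%E.
  rewrite -integral_cst// -ge0_integralZl//.
  apply: (@le_trans _ _ (\int[mu]_(x in D `&` s @^-1` [set y]) (2%:E * `|u x|%:E))%E).
    apply: ge0_le_integral => //.
    - by move=> x _; rewrite lee_fin.
    - by apply: (measurable_funS mD) (measurable_funeM _ mu_) => // x [].
    - by move=> x [Dx /= <-]; rewrite -EFinM lee_fin sleu.
  by apply: ge0_subset_integral => //; exact: measurable_funeM.
have : (`|y|%:E * mu (D `&` s @^-1` [set y]) < +oo)%E.
  by apply: le_lt_trans h _; rewrite lte_mul_pinfty.
have [->|//] := eqVneq (mu (D `&` s @^-1` [set y])) +oo%E.
  by rewrite gt0_muley// lte_fin.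
by rewrite -ltey.
Qed.

(** Truncate the approximating functions where they exceed [2 |u|].  The
    truncations still converge to [u] almost everywhere and are dominated by
    [2 |u|], hence converge in L1, and their integrals form a Cauchy sequence. *)
Lemma bochner_integral_exists (V : completeNormedModType R) (u : T -> V) :
    strongly_measurable mu D u -> (\int[mu]_(x in D) `|u x|%:E < +oo)%E ->
  exists l, is_bochner_integral mu D u l.
Proof.
move=> su iu; have [s [ms cs]] := su.
have mu_ := strongly_measurable_norm cmu su.
pose P n := D `&` [set x | `|s n x| <= 2 * `|u x|].
have mP n : measurable (P n).
  apply: measurable_fun_le => //; last exact: measurable_funM.
  apply: finite_valued_measurable.
  by apply: (finite_valued_comp (fun v => `|v| : R)); exact/simple_measurableP.
pose t n x := if x \in P n then s n x else 0.
have ft n : finite_valued D (t n).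
  by apply: finite_valued_mem => //; exact/simple_measurableP.
have tu n x : `|t n x| <= 2 * `|u x|.
  rewrite /t; case: ifPn => [/set_mem[_]//|_].
  by rewrite normr0 mulr_ge0.
have it n : simple_integrable mu D (t n).
  by apply: (simple_integrable_le (ft n) su) => // x _; exact: tu.
have st n := strongly_measurable_finite mu (ft n).
have tcvg : {ae mu, forall x, D x -> (`|u x - t n x|%:E) @[n --> \oo] --> (0%:E : \bar R)}.
  apply: filterS cs => x cs Dx; apply: cvg_EFin; first exact: nearW.
  rewrite -(@normr0 _ V); apply: cvg_norm; rewrite -(subrr (u x)).
  apply: cvgB; first exact: cvg_cst.
  have [u0|u0] := eqVneq (u x) 0.
    rewrite u0 (_ : (fun n => t n x) = fun=> 0); first exact: cvg_cst.
    apply/funext => n; apply/eqP; rewrite -normr_le0.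
    by apply: le_trans (tu n x) _; rewrite u0 normr0 mulr0.
  apply: cvg_trans (cs Dx); apply: near_eq_cvg; near=> n.
  rewrite /t mem_set//; split=> //=.
  rewrite ltW//; near: n; apply: (cvgr_lt `|u x|).
    by apply: cvg_norm; exact: cs.
  by rewrite mulr_natl mulr2n ltrDl normr_gt0.
have mt n : measurable_fun D (fun x => (`|u x - t n x| : R)%:E).
  apply/measurable_EFinP; apply: (strongly_measurable_norm cmu).
  exact: strongly_measurableB.
have iu3 : mu.-integrable D (fun x => (3 * `|u x|)%:E).
  apply/integrableP; split; first by apply/measurable_EFinP; exact: measurable_funM.
  under eq_integral do rewrite /= ger0_norm ?mulr_ge0// EFinM.
  rewrite ge0_integralZl//; last exact/measurable_EFinP.
  by rewrite lte_mul_pinfty.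
have ut3 : {ae mu, forall x n, D x -> (`|(`|u x - t n x| : R)%:E| <= (3 * `|u x|)%:E)%E}.
  apply: aeW => x n Dx; rewrite /= lee_fin normr_id.
  rewrite (le_trans (ler_normB _ _))// (natrD _ 1 2) mulrDl mul1r lerD2l.
  exact: tu.
have [_ _] := dominated_convergence mD mt (@measurable_cst _ _ _ _ D _) tcvg iu3 ut3.
rewrite integral0 => tI.
have /cauchy_cvg /cvg_ex[l tl] : cauchy (simple_integral mu D (t n) @[n --> \oo]).
  apply: cauchy_exP => e e0; near \oo => N.
  exists (simple_integral mu D (t N)).
  suff : \forall n \near \oo,
    ball (simple_integral mu D (t N)) e (simple_integral mu D (t n)) by [].
  near=> n; rewrite -ball_normE /=.
  have := ler_dist_simple_integral mD cmu su (it N) (it n).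
  rewrite -lte_fin => /le_lt_trans; apply.
  rewrite (splitr e) EFinD; apply: lteD.
    by near: N; apply: (cvge0_near_lt tI); rewrite divr_gt0.
  by near: n; apply: (cvge0_near_lt tI); rewrite divr_gt0.
by exists l; split => //; exists t; split.
Unshelve. all: by end_near. Qed.

Import HBNNSimple.

Lemma bochner_integral_real (f : T -> R) :
    measurable_fun D f -> (forall x, D x -> 0 <= f x) ->
    (\int[mu]_(x in D) (f x)%:E < +oo)%E ->
  is_bochner_integral mu D f (\int[mu]_(x in D) f x).
Proof.
move=> mf f0 fi; have mEf : measurable_fun D (EFin \o f) by exact/measurable_EFinP.
split; first exact: strongly_measurable_real.
have iaf : (\int[mu]_(x in D) `|f x|%:E < +oo)%E.
  rewrite (eq_integral (fun x => (f x)%:E))// => x /set_mem Dx.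
  by rewrite ger0_norm// f0.
pose h n : T -> R := nnsfun_approx mD mEf n.
have Ef0 x : D x -> (0 <= (EFin \o f) x)%E by move=> Dx; rewrite lee_fin f0.
have hf n x : D x -> h n x <= f x.
  by move=> Dx; rewrite -lee_fin /h nnsfun_approxE le_approx.
have h0 n x : 0 <= h n x by exact: fun_ge0.
have fh n : finite_valued D (h n).
  apply/simple_measurableP; split=> [|y]; first exact: fimfunP.
  by apply: measurableI => //; rewrite -[X in measurable X]setTI; exact: measurable_funP.
have ih n : simple_integrable mu D (h n).
  apply: (simple_integrable_le (fh n) (strongly_measurable_real mu mD mf)).
    move=> x Dx; rewrite !ger0_norm ?f0//; apply: le_trans (hf n x Dx) _.
    by rewrite mulr_natl mulr2n lerDl f0.
  exact: iaf.
have sf := strongly_measurable_real mu mD mf.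
have hcvg : {ae mu, forall x, D x -> (h n x)%:E @[n --> \oo] --> ((f x)%:E : \bar R)}.
  by apply: aeW => x Dx; exact: cvg_nnsfun_approx.
have if_ : mu.-integrable D (EFin \o f).
  by apply/integrableP; split.
have mh n : measurable_fun D (EFin \o h n).
  by apply/measurable_EFinP; exact: finite_valued_measurable (fh n).
have hle : {ae mu, forall x n, D x -> (`|(EFin \o h n) x| <= (EFin \o f) x)%E}.
  by apply: aeW => x n Dx; rewrite /= lee_fin ger0_norm ?hf.
have [_ hd hI] := dominated_convergence mD mh mEf hcvg if_ hle.
exists h; split => //.
- move: hd; apply: cvg_trans; apply: near_eq_cvg; apply: nearW => n /=.
  by apply: eq_integral => x _; rewrite /= distrC.
- have sh n : simple_integral mu D (h n) = fine (\int[mu]_(x in D) (h n x)%:E)%E.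
    transitivity (fine (\int[mu]_(x in D) `|h n x|%:E)%E); last first.
      by under eq_integral do rewrite ger0_norm//.
    rewrite integral_norm_simple// /simple_integral /=.
    rewrite !fsbig_finite ?(fh n).1//=; apply: eq_big_seq => y.
    rewrite in_fset_set ?(fh n).1// => /set_mem[x _ <-].
    by rewrite ger0_norm.
  under eq_cvg do rewrite sh.
  apply: fine_cvg; rewrite fineK; first exact: hI.
  by rewrite ge0_fin_numE// integral_ge0// => x Dx; rewrite lee_fin f0.
Qed.

(** The image of a scalar Lebesgue integral under the bounded operator
    [r |-> r v]. *)
Lemma bochner_integralZ (V : normedModType R) (f : T -> R) (v : V) :
    measurable_fun D f -> (forall x, D x -> 0 <= f x) ->
    (\int[mu]_(x in D) (f x)%:E < +oo)%E ->
  is_bochner_integral mu D (fun x => f x *: v) ((\int[mu]_(x in D) f x) *: v).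
Proof.
move=> mf f0 fi; have bf := bochner_integral_real mf f0 fi.
pose L (r : R^o) : V := r *: v.
have L_linear : linear L by move=> a r s; rewrite /L scalerDl -scalerA.
pose L' := GRing.isLinear.Build R R^o V *:%R L L_linear.
pose LL : {linear R^o -> V} := HB.pack L L'.
apply: (@bochner_integral_linear _ _ _ mu D mD cmu R V LL `|v|) bf => r.
by rewrite /= /L normrZ mulrC.
Qed.

End bochner_existence.

(** * The half-line and primitives of a density *)

Section cover.
Context d (T : measurableType d) {R : realType} (mu : {measure set T -> \bar R}).

(** Disjointify the cover and use countable additivity. *)
Lemma le_integral_cover (D E : set T) (F : nat -> set T)
    (f : T -> \bar R) :
    measurable D -> measurable E -> (forall k, measurable (F k)) ->
    (forall k, F k `<=` D) -> E `<=` \bigcup_k F k ->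
    measurable_fun D f -> (forall x, D x -> 0 <= f x)%E ->
  (\int[mu]_(x in E) f x <= \sum_(0 <= k <oo) \int[mu]_(x in F k) f x)%E.
Proof.
move=> mD mE mF FD EF mf f0.
have UD : \bigcup_k seqDU F k `<=` D.
  by rewrite -seqDU_bigcup_eq => x [k _]; exact: FD.
have mU : measurable (\bigcup_k seqDU F k).
  by apply: bigcupT_measurable => k; exact: seqDU_measurable.
have mfU : measurable_fun (\bigcup_k seqDU F k) f by exact: measurable_funS mf.
apply: (@le_trans _ _ (\int[mu]_(x in \bigcup_k seqDU F k) f x)%E).
  apply: ge0_subset_integral => //; first by move=> x /UD/f0.
  by rewrite -seqDU_bigcup_eq.
rewrite (@ge0_integral_bigcup _ _ _ _ (seqDU F) f (seqDU_measurable mF) mfU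
  (fun x h => f0 x (UD x h)) (trivIset_seqDU F)).
apply: lee_nneseries => k _.
  by move=> _; apply: integral_ge0 => x h; apply: f0; apply: FD; exact: subset_seqDU h.
apply: ge0_subset_integral => //.
- exact: seqDU_measurable.
- exact: measurable_funS mf.
- by move=> x h; apply: f0; exact: FD h.
- exact: subset_seqDU.
Qed.

End cover.

Section halfline.
Context {R : realType}.

Lemma measurable_leb (E : set R) :
  measurable (E : set (measurableTypeR R)) -> measurable (E : set (Leb R)).
Proof. by move=> mE; apply: sub_caratheodory; exact: mE. Qed.

Lemma measurable_fun_leb d (U : measurableType d) (E : set R) (f : R -> U) :
    measurable (E : set (measurableTypeR R)) ->
    measurable_fun (E : set (measurableTypeR R)) (f : measurableTypeR R -> U) ->
  measurable_fun (E : set (Leb R)) (f : Leb R -> U).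
Proof. by move=> mE mf _ Y mY; apply: measurable_leb; exact: mf. Qed.

Lemma measurable_leb_itv (i : interval R) : measurable ([set` i] : set (Leb R)).
Proof. by apply: measurable_leb; exact: measurable_itv. Qed.

Lemma leb_itvE (i : interval R) : leb R ([set` i] : set (Leb R)) =
  (if (i.1 < i.2)%E then ((i.2 : \bar R) - i.1)%E else 0%E).
Proof. exact: (lebesgue_measure_itv i). Qed.

Lemma measurable_inv_pos : measurable_fun (`]0, +oo[ : set (Leb R))
  ((fun t => t^-1) : Leb R -> R).
Proof.
apply: measurable_fun_leb => //.
apply: open_continuous_measurable_fun; first exact: interval_open.
move=> x; rewrite inE /= in_itv /= andbT => x0.
by apply: continuousV => //; rewrite gt_eqF.
Qed.

Lemma nneseries_geometric (a r : R) : 0 <= a -> 0 <= r < 1 ->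
  (\sum_(0 <= k <oo) (a * r ^+ k)%:E = (a / (1 - r))%:E)%E.
Proof.
move=> a0 /andP[r0 r1]; apply/cvg_lim => //.
rewrite (_ : (fun n => _) = EFin \o series (geometric a r)).
  apply: cvg_EFin; first exact: nearW.
  by apply: cvg_geometric_series; rewrite ger0_norm.
by apply/funext => n /=; rewrite sumEFin.
Qed.

End halfline.

Section primitive.
Context {R : realType}.
Local Notation D0 := (`]0, +oo[%classic : set (Leb R)).
Variables (w W : R -> R).
Hypothesis mw : measurable_fun D0 (w : Leb R -> R).
Hypothesis w0 : forall t : R, 0 < t -> 0 < w t.
Hypothesis W0 : forall x : R, 0 < x -> 0 < W x.
Hypothesis WE : forall x : R, 0 < x ->
  (\int[leb R]_(t in `]0%R, x[) (t^-1 * w t)%:E = (W x)%:E)%E.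

Let D0P t : D0 t -> 0 < t.
Proof. by rewrite /= in_itv /= andbT. Qed.

Lemma measurable_density :
  measurable_fun D0 ((fun t => t^-1 * w t) : Leb R -> R).
Proof. by apply: measurable_funM mw; exact: measurable_inv_pos. Qed.

Lemma density_ge0 t : D0 t -> 0 <= t^-1 * w t.
Proof. by move=> /D0P t0; rewrite mulr_ge0 ?invr_ge0 1?ltW// w0. Qed.

Lemma primitive_split x y : 0 < x -> x <= y ->
  ((W y)%:E = (W x)%:E + \int[leb R]_(t in `[x, y[) (t^-1 * w t)%:E)%E.
Proof.
move=> x0 xy; rewrite -!WE//; last exact: lt_le_trans xy.
have E : `]0, y[%classic = `]0, x[%classic `|` `[x, y[%classic :> set R.
  apply/seteqP; split=> t /=; rewrite !in_itv /=.
    by move=> /andP[t0 ty]; case: (ltP t x) => tx; [left|right]; rewrite ?t0 ?tx.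
  move=> [/andP[-> tx]|/andP[xt ->]]; first by rewrite (lt_le_trans tx).
  by rewrite (lt_le_trans x0).
have [m1 m2] : measurable (`]0, x[ : set (Leb R)) /\ measurable (`[x, y[ : set (Leb R)).
  by split; exact: measurable_leb_itv.
rewrite [in LHS]E (ge0_integral_setU _ m1 m2).
- by [].
- apply/measurable_EFinP; apply: (measurable_funS (measurable_leb_itv _) _ measurable_density).
  rewrite -E => t /=; rewrite !in_itv /= andbT => /andP[->] //.
- rewrite -E => t /=; rewrite in_itv /= => /andP[t0 _]; rewrite lee_fin density_ge0//.
  by rewrite /= in_itv /= t0.
- apply/disj_setPS => t /=; rewrite !in_itv /= => -[/andP[_ tx] /andP[xt _]].
  by rewrite ltNge xt in tx.
Qed.

Lemma primitive_mono x y : 0 < x -> x <= y -> W x <= W y.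
Proof.
move=> x0 xy; rewrite -lee_fin (primitive_split x0 xy) leeDl// integral_ge0//.
move=> t /=; rewrite in_itv /= => /andP[xt _]; rewrite lee_fin density_ge0//=.
by rewrite in_itv /= andbT (lt_le_trans x0).
Qed.

Lemma measurable_primitive : measurable_fun D0 (W : Leb R -> R).
Proof.
apply: (eq_measurable_fun ((fun t => if 0 < t then W t else 0) : Leb R -> R)).
  by move=> t /set_mem /D0P ->.
apply: measurable_fun_leb => //; apply: nondecreasing_measurable => // x y xy.
case: ifPn => x0; last by case: ifPn => // y0; exact/ltW/W0.
by rewrite (lt_le_trans x0 xy); exact: primitive_mono.
Qed.

Lemma measurable_primitive_sublevel c :
  measurable (D0 `&` [set t | (W t < c)%R]).
Proof.
rewrite (_ : _ `&` _ = D0 `&` W @^-1` `]-oo, c[%classic).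
  by apply: measurable_primitive; [exact: measurable_leb_itv|exact: measurable_itv].
by apply/seteqP; split=> t /=; rewrite !in_itv.
Qed.

Hypothesis Wsurj : forall c : R, 0 < c -> exists2 x : R, 0 < x & W x = c.

Lemma primitive_block_mass (c : R) : 0 < c ->
  (\int[leb R]_(t in D0 `&` [set t | (W t < c)%R]) (t^-1 * w t)%:E <= c%:E)%E.
Proof.
move=> c0; have [x x0 <-] := Wsurj c0.
rewrite -(WE x0).
apply: (ge0_subset_integral _ (measurable_primitive_sublevel _) (measurable_leb_itv _)).
- apply/measurable_EFinP; apply: (measurable_funS (measurable_leb_itv _) _ measurable_density).
  by move=> t /=; rewrite !in_itv /= => /andP[->].
- move=> t /=; rewrite in_itv /= => /andP[t0 _]; rewrite lee_fin density_ge0//.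
  by rewrite /= in_itv /= t0.
- move=> t [/D0P t0 /= Wt]; rewrite in_itv /= t0 /= ltNge.
  by apply/negP => /(primitive_mono x0); rewrite leNgt Wt.
Qed.

Lemma measurable_primitive_block c :
  measurable (D0 `&` [set t | (c <= W t < 2 * c)%R]).
Proof.
rewrite (_ : _ `&` _ = D0 `&` W @^-1` `[c, (2 * c)[%classic).
  by apply: measurable_primitive; [exact: measurable_leb_itv|exact: measurable_itv].
by apply/seteqP; split=> t /=; rewrite !in_itv.
Qed.

Lemma measurable_density_primitive p :
  measurable_fun D0 ((fun t => t^-1 * w t * W t `^ p) : Leb R -> R).
Proof.
apply: measurable_funM; first exact: measurable_density.
exact: (measurableT_comp (measurable_powR p) measurable_primitive).
Qed.

(** Where [W] lies in [[c, 2c)] the factor [W^(-p)] is at most [c^(-p)], and the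
    mass of [w(t)/t] on [{W < 2c}] is at most [2c] because [W] takes the value
    [2c]. *)
Lemma primitive_block (p c : R) : 0 <= p -> 0 < c ->
  (\int[leb R]_(t in D0 `&` [set t | (c <= W t < 2 * c)%R])
    (t^-1 * w t * W t `^ (- p))%:E <= (c `^ (- p) * (2 * c))%:E)%E.
Proof.
move=> p0 c0.
have mB := measurable_primitive_block c.
have BD : D0 `&` [set t | (c <= W t < 2 * c)%R] `<=` D0 by move=> t [].
have sub := measurable_funS (measurable_leb_itv _) BD.
have mr : measurable_fun (D0 `&` [set t | (c <= W t < 2 * c)%R])
    (fun t : Leb R => (t^-1 * w t)%:E).
  by apply/measurable_EFinP; exact: sub measurable_density.
have r0 t : (D0 `&` [set t | (c <= W t < 2 * c)%R]) t -> (0 <= (t^-1 * w t)%:E)%E.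
  by move=> [Dt _]; rewrite lee_fin density_ge0.
apply: (@le_trans _ _ (\int[leb R]_(t in D0 `&` [set t | (c <= W t < 2 * c)%R])
    ((c `^ (- p))%:E * (t^-1 * w t)%:E)))%E.
  apply: (ge0_le_integral _ mB).
  - by move=> t [Dt _]; rewrite lee_fin mulr_ge0 ?powR_ge0 ?density_ge0.
  - by apply/measurable_EFinP; exact: sub (measurable_density_primitive _).
  - exact: measurable_funeM.
  - move=> t [Dt /= /andP[cW _]]; rewrite -EFinM lee_fin mulrC.
    rewrite ler_wpM2r ?density_ge0// !powRN lef_pV2 ?posrE ?powR_gt0//.
      by rewrite ge0_ler_powR// ?nnegrE ?ltW// (lt_le_trans c0).
    exact: lt_le_trans cW.
rewrite (ge0_integralZl _ mB mr r0); last by rewrite lee_fin powR_ge0.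
rewrite EFinM lee_pmul2l ?lte_fin ?powR_gt0//.
apply: le_trans (primitive_block_mass _); last by rewrite mulr_gt0.
apply: (ge0_subset_integral _ mB (measurable_primitive_sublevel _)).
- apply/measurable_EFinP; apply: (measurable_funS (measurable_leb_itv _) _ measurable_density).
  by move=> t [].
- by move=> t [Dt _]; rewrite lee_fin density_ge0.
- by move=> t [Dt /andP[_ ?]].
Qed.

End primitive.

(** * Power integrals against a primitive *)

Section dyadic.
Context {R : realType}.

Lemma dyadic_up (c x : R) : 0 < c -> c <= x ->
  exists k : nat, c * 2 ^+ k <= x < 2 * (c * 2 ^+ k).
Proof.
move=> c0 cx.
have ex : exists n : nat, x < c * 2 ^+ n.
  exists (Num.bound (x / c)); rewrite mulrC -ltr_pdivrMr//.
  apply: (lt_le_trans (archi_boundP _)).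
    by rewrite divr_ge0 ?ltW// (lt_le_trans c0).
  by rewrite -natrX ler_nat ltnW// ltn_expl.
case: (ex_minnP ex) => -[|k] xk kmin.
  by rewrite expr0 mulr1 ltNge cx in xk.
exists k; rewrite leNgt; apply/andP; split.
  by apply/negP => /kmin; rewrite ltnn.
by rewrite mulrCA -exprS.
Qed.

Lemma dyadic_down (c x : R) : 0 < x -> x < 2 * c ->
  exists k : nat, c * 2^-1 ^+ k <= x < 2 * (c * 2^-1 ^+ k).
Proof.
move=> x0 xc; have c0 : 0 < c by rewrite -(pmulr_rgt0 _ (ltr0Sn _ 1)) (lt_trans x0).
have ex : exists n : nat, c * 2^-1 ^+ n <= x.
  exists (Num.bound (c / x)); rewrite exprVn ler_pdivrMr ?exprn_gt0// mulrC -ler_pdivrMr//.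
  apply/ltW/(lt_le_trans (archi_boundP _)); first by rewrite divr_ge0 ?ltW.
  by rewrite -natrX ler_nat ltnW// ltn_expl.
case: (ex_minnP ex) => -[|k] xk kmin.
  by exists 0%N; rewrite xk expr0 mulr1.
exists k.+1; rewrite xk/= exprS mulrCA mulVKf ?pnatr_eq0// ltNge.
by apply/negP => /kmin; rewrite ltnn.
Qed.

End dyadic.

Section primitive_geometric.
Context {R : realType}.
Local Notation D0 := (`]0, +oo[%classic : set (Leb R)).
Variables (w W : R -> R).
Hypothesis mw : measurable_fun D0 (w : Leb R -> R).
Hypothesis w0 : forall t : R, 0 < t -> 0 < w t.
Hypothesis W0 : forall x : R, 0 < x -> 0 < W x.
Hypothesis WE : forall x : R, 0 < x ->
  (\int[leb R]_(t in `]0%R, x[) (t^-1 * w t)%:E = (W x)%:E)%E.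
Hypothesis Wsurj : forall c : R, 0 < c -> exists2 x : R, 0 < x & W x = c.

(** Split according to the size of [W]: the block where [W] is about [c r^k]
    contributes at most a multiple of [(c r^k)^(1-p)], and these terms form a
    geometric series. *)
Lemma primitive_geometric (E : set R) (c r p : R) :
    measurable (E : set (Leb R)) -> E `<=` D0 -> 0 < c -> 0 < r -> 0 <= p ->
    r `^ (1 - p) < 1 ->
    (forall t, E t -> exists k : nat, c * r ^+ k <= W t < 2 * (c * r ^+ k)) ->
  (\int[leb R]_(t in E) (t^-1 * w t * W t `^ (- p))%:E <=
   (2 / (1 - r `^ (1 - p)) * c `^ (1 - p))%:E)%E.
Proof.
move=> mE ED c0 r0 p0 r1 cov.
have cr0 k : 0 < c * r ^+ k by rewrite mulr_gt0// exprn_gt0.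
pose F k := D0 `&` [set t | (c * r ^+ k <= W t < 2 * (c * r ^+ k))%R].
apply: (@le_trans _ _ (\sum_(0 <= k <oo) \int[leb R]_(t in F k)
    (t^-1 * w t * W t `^ (- p))%:E)%E).
  apply: (@le_integral_cover _ _ _ (leb R) D0 E F).
  - exact: measurable_leb_itv.
  - exact: mE.
  - by move=> k; exact: (measurable_primitive_block mw w0 W0 WE).
  - by move=> k t [].
  - by move=> t Et; have [k ck] := cov t Et; exists k => //; split; [exact: ED|].
  - by apply/measurable_EFinP; exact: (measurable_density_primitive mw w0 W0 WE).
  - by move=> t Dt; rewrite lee_fin mulr_ge0 ?powR_ge0 ?(density_ge0 w0).
apply: (@le_trans _ _ (\sum_(0 <= k <oo)
    ((2 * c `^ (1 - p)) * (r `^ (1 - p)) ^+ k)%:E)%E).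
  apply: lee_nneseries => k _.
    move=> _; apply: integral_ge0 => t [Dt _].
    by rewrite lee_fin mulr_ge0 ?powR_ge0 ?(density_ge0 w0).
  apply: (le_trans (primitive_block mw w0 W0 WE Wsurj p0 (cr0 k))).
  rewrite lee_fin mulrCA -mulrA ler_pM2l//.
  rewrite -{2}(powRr1 (ltW (cr0 k))) -powRD ?(gt_eqF (cr0 k)) ?implybT//.
  rewrite addrC powRM ?exprn_ge0 ?(ltW c0) ?(ltW r0)// -powR_mulrn ?(ltW r0)// -powRrM.
  by rewrite (mulrC k%:R) powRrM powR_mulrn ?powR_ge0.
rewrite nneseries_geometric.
- by rewrite lee_fin mulrAC.
- by rewrite mulr_ge0 ?powR_ge0.
- by rewrite powR_ge0 r1.
Qed.

(** What the substitution [y = W t] would give; the dyadic splitting avoids a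
    change of variables for a primitive that is only monotone. *)
Lemma primitive_tail (g : R) : 0 < g -> exists2 C : R, 0 < C & forall s : R, 0 < s ->
  (\int[leb R]_(t in `[s, +oo[) (t^-1 * w t * W t `^ (- (1 + g)))%:E <=
   (C * W s `^ (- g))%:E)%E.
Proof.
move=> g0.
have g2 : 2 `^ (1 - (1 + g)) < 1 :> R.
  rewrite opprD addrA subrr add0r powRN invf_lt1 ?powR_gt0//.
  have : 1 `^ g < 2 `^ g :> R by rewrite gt0_ltr_powR// ?nnegrE// ltr1n.
  by rewrite powR1.
exists (2 / (1 - 2 `^ (1 - (1 + g)))).
  by rewrite divr_gt0// subr_gt0.
move=> s s0; have -> : - g = 1 - (1 + g) by rewrite opprD addrA subrr add0r.
apply: primitive_geometric => //; [exact: measurable_leb_itv| |exact: W0| |].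
- by move=> t /=; rewrite !in_itv /= !andbT; exact: lt_le_trans.
- by rewrite addr_ge0// ltW.
- move=> t /=; rewrite in_itv /= andbT => st.
  apply: dyadic_up; first exact: W0.
  exact: (primitive_mono mw w0 WE).
Qed.

Lemma primitive_head (d : R) : 0 <= d < 1 -> exists2 C : R, 0 < C & forall s : R, 0 < s ->
  (\int[leb R]_(t in `]0%R, s[) (t^-1 * w t * W t `^ (- d))%:E <=
   (C * W s `^ (1 - d))%:E)%E.
Proof.
move=> /andP[d0 d1].
have d2 : 2^-1 `^ (1 - d) < 1 :> R.
  have : 2^-1 `^ (1 - d) < 1 `^ (1 - d) :> R.
    by rewrite gt0_ltr_powR// ?nnegrE ?subr_gt0// invf_lt1// ltr1n.
  by rewrite powR1.
exists (2 / (1 - 2^-1 `^ (1 - d))).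
  by rewrite divr_gt0// subr_gt0.
move=> s s0.
apply: primitive_geometric => //; [exact: measurable_leb_itv| |exact: W0|].
- by move=> t /=; rewrite !in_itv /= andbT => /andP[].
- move=> t /=; rewrite in_itv /= => /andP[t0 ts].
  apply: dyadic_down; first exact: W0.
  apply: (le_lt_trans (primitive_mono mw w0 WE t0 (ltW ts))).
  by rewrite mulr_natl mulr2n ltrDl W0.
Qed.

End primitive_geometric.

Section power_integral.
Context {R : realType}.

Lemma integral_identity_density (x : R) : 0 < x ->
  (\int[leb R]_(t in `]0%R, x[) (t^-1 * t)%:E = x%:E)%E.
Proof.
move=> x0; rewrite (eq_integral (cst 1%E)).
  rewrite integral_cst; last exact: measurable_leb_itv.
  rewrite mul1e [LHS]leb_itvE /= lte_fin x0.
  by rewrite sube0.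
move=> t /set_mem /=; rewrite in_itv /= => /andP[t0 _].
by rewrite mulVf// gt_eqF.
Qed.

Let mid : measurable_fun (`]0, +oo[ : set (Leb R)) (id : Leb R -> R).
Proof. by apply: measurable_fun_leb => //; exact: measurable_id. Qed.

(** The density [w t = t] has the primitive [W x = x], so power integrals are a
    special case of the integrals of powers of a primitive. *)
Lemma power_integral_tail (g : R) : 0 < g -> exists2 C : R, 0 < C &
  forall s : R, 0 < s ->
  (\int[leb R]_(t in `[s, +oo[) (t `^ (- (1 + g)))%:E <= (C * s `^ (- g))%:E)%E.
Proof.
move=> g0.
have [C C0 h] := primitive_tail mid (fun t t0 => t0) (fun t t0 => t0)
  integral_identity_density (fun c c0 => ex_intro2 _ _ c c0 erefl) g0.
exists C => // s s0; apply: le_trans (h s s0); rewrite le_eqVlt; apply/orP; left.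
apply/eqP; apply: eq_integral => t /set_mem /=; rewrite in_itv /= andbT => st.
by rewrite mulVf ?mul1r// gt_eqF// (lt_le_trans s0).
Qed.

Lemma power_integral_head (d : R) : 0 <= d < 1 -> exists2 C : R, 0 < C &
  forall s : R, 0 < s ->
  (\int[leb R]_(t in `]0%R, s[) (t `^ (- d))%:E <= (C * s `^ (1 - d))%:E)%E.
Proof.
move=> d0.
have [C C0 h] := primitive_head mid (fun t t0 => t0) (fun t t0 => t0)
  integral_identity_density (fun c c0 => ex_intro2 _ _ c c0 erefl) d0.
exists C => // s s0; apply: le_trans (h s s0); rewrite le_eqVlt; apply/orP; left.
apply/eqP; apply: eq_integral => t /set_mem /=; rewrite in_itv /= => /andP[t0 _].
by rewrite mulVf ?mul1r// gt_eqF.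
Qed.

End power_integral.

(** * Slowly varying functions *)

Section slow.
Context {R : realType}.

(** A quantitative form of slow variation (the Potter bounds), without the
    monotone equivalents: the values at two points differ by at most a small
    power of their ratio. *)
Definition slow (f : R -> R) := forall e : R, 0 < e -> exists2 C : R, 0 < C &
  forall s t : R, 0 < s -> s <= t ->
    f s <= C * (t / s) `^ e * f t /\ f t <= C * (t / s) `^ e * f s.

Lemma slowly_varying_slow (b : R -> R) : slowly_varying b -> slow b.
Proof.
move=> [b0 _ sv] e e0; have [[g gmono [c [C [c0 C0 gC]]]] [h hmono [d [E [d0 E0 hE]]]]] := sv e e0.
(* One constant for both directions: the first term serves the increasing
   equivalent, the second the decreasing one. *)
exists (C * c + E * d); first by rewrite addr_gt0// mulr_gt0.
move=> s t s0 st; have t0 : 0 < t by exact: lt_le_trans st.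
have Is : `]0, +oo[%classic s by rewrite /= in_itv /= s0.
have It : `]0, +oo[%classic t by rewrite /= in_itv /= t0.
have st0 : 0 < (t / s) `^ e by rewrite powR_gt0// divr_gt0.
have ts : (t / s) `^ e = t `^ e * s `^ (- e).
  by rewrite powRM ?invr_ge0 ?ltW// -powR_inv1 ?ltW// -powRrM mulN1r.
split.
- apply: (@le_trans _ _ (C * c * (t / s) `^ e * b t)); last first.
    by rewrite !ler_wpM2r ?ltW ?b0// ltrDl mulr_gt0.
  have h1 : s `^ e * b s <= C * c * (t `^ e * b t).
    apply: (le_trans (gC s Is).1); rewrite -mulrA ler_pM2l//.
    by apply: le_trans (gC t It).2; exact: gmono.
  rewrite -(ler_pM2l (powR_gt0 e s0)); apply: le_trans h1 _.
  rewrite ts powRN le_eqVlt; apply/orP; left; apply/eqP.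
  have : s `^ e != 0 by rewrite gt_eqF// powR_gt0.
  by move: (s `^ e) => z z0; field.
- apply: (@le_trans _ _ (E * d * (t / s) `^ e * b s)); last first.
    by rewrite !ler_wpM2r ?ltW ?b0// ltrDr mulr_gt0.
  have h1 : t `^ (- e) * b t <= E * d * (s `^ (- e) * b s).
    apply: (le_trans (hE t It).1); rewrite -mulrA ler_pM2l//.
    by apply: le_trans (hE s Is).2; exact: hmono.
  rewrite -(ler_pM2l (powR_gt0 (- e) t0)); apply: le_trans h1 _.
  rewrite ts [t `^ (- e)]powRN le_eqVlt; apply/orP; left; apply/eqP.
  have : t `^ e != 0 by rewrite gt_eqF// powR_gt0.
  by move: (t `^ e) => z z0; field.
Qed.

Lemma ratio_ge1 (s t : R) : 0 < s -> s <= t -> 1 <= t / s.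
Proof. by move=> s0 st; rewrite ler_pdivlMr// mul1r. Qed.

(** Applied with the exponent [e / (|r| + 1)], so that raising to the power [r]
    leaves at most the exponent [e]. *)
Lemma slow_powR (f : R -> R) (r : R) : (forall t : R, 0 < t -> 0 < f t) ->
  slow f -> slow (fun t => f t `^ r).
Proof.
move=> f0 sf e e0; have r10 : 0 < `|r| + 1 by rewrite ltr_wpDl.
have [C C0 h] := sf (e / (`|r| + 1)) (divr_gt0 e0 r10).
exists (C `^ `|r|); first exact: powR_gt0.
move=> s t s0 st; have t0 : 0 < t by exact: lt_le_trans st.
have ts1 := ratio_ge1 s0 st; have ts0 : 0 <= t / s := le_trans ler01 ts1.
have [h1 h2] := h s t s0 st.
set K := C * (t / s) `^ (e / (`|r| + 1)) in h1 h2.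
have K0 : 0 < K by rewrite mulr_gt0// powR_gt0// (lt_le_trans ltr01).
have Kle : K `^ `|r| <= C `^ `|r| * (t / s) `^ e.
  rewrite /K powRM ?powR_ge0 ?(ltW C0)// ler_wpM2l ?powR_ge0//.
  rewrite -powRrM ler_powR// mulrAC ler_pdivrMr// ler_wpM2l ?(ltW e0)//.
  by rewrite lerDl.
clearbody K.
have [r0|r0] := leP 0 r.
- rewrite ger0_norm// in Kle *.
  have key x y : 0 < x -> 0 < y -> y <= K * x -> y `^ r <= K `^ r * x `^ r.
    move=> x0 y0 yKx; rewrite -powRM ?(ltW K0) ?(ltW x0)//.
    by rewrite ge0_ler_powR// nnegrE ltW// mulr_gt0.
  split.
  + by apply: le_trans (key _ _ (f0 t t0) (f0 s s0) h1) _; rewrite ler_wpM2r ?powR_ge0//; exact: Kle.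
  + by apply: le_trans (key _ _ (f0 s s0) (f0 t t0) h2) _; rewrite ler_wpM2r ?powR_ge0//; exact: Kle.
- rewrite ltr0_norm// in Kle *.
  have key x y : 0 < x -> 0 < y -> y <= K * x -> x `^ r <= K `^ (- r) * y `^ r.
    move=> x0 y0 yKx; rewrite powRN mulrC ler_pdivlMr ?powR_gt0//.
    rewrite mulrC -powRM ?(ltW K0) ?(ltW x0)//.
    rewrite -[r]opprK !(powRN _ (- r)) lef_pV2 ?posrE ?powR_gt0 ?mulr_gt0//.
    by rewrite ge0_ler_powR// ?nnegrE ?oppr_ge0 ltW// mulr_gt0.
  split.
  + by apply: le_trans (key _ _ (f0 s s0) (f0 t t0) h2) _; rewrite ler_wpM2r ?powR_ge0//; exact: Kle.
  + by apply: le_trans (key _ _ (f0 t t0) (f0 s s0) h1) _; rewrite ler_wpM2r ?powR_ge0//; exact: Kle.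
Qed.

Lemma slow_mul (f g : R -> R) : (forall t : R, 0 < t -> 0 < f t) ->
    (forall t : R, 0 < t -> 0 < g t) -> slow f -> slow g ->
  slow (fun t => f t * g t).
Proof.
move=> f0 g0 sf sg e e0; have e20 : 0 < e / 2 by rewrite divr_gt0.
have [C C0 hf] := sf _ e20; have [E E0 hg] := sg _ e20.
exists (C * E); first exact: mulr_gt0.
move=> s t s0 st; have t0 : 0 < t by exact: lt_le_trans st.
have [f1 f2] := hf s t s0 st; have [g1 g2] := hg s t s0 st.
have -> : (t / s) `^ e = (t / s) `^ (e / 2) * (t / s) `^ (e / 2).
  rewrite -powRD -?splitr//; apply/implyP => _.
  by rewrite gt_eqF// divr_gt0.
set z := (t / s) `^ (e / 2) in f1 f2 g1 g2 *.
split.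
- rewrite (_ : C * E * (z * z) * _ = (C * z * f t) * (E * z * g t)); last by ring.
  by apply: ler_pM f1 g1; [exact/ltW/f0|exact/ltW/g0].
- rewrite (_ : C * E * (z * z) * _ = (C * z * f s) * (E * z * g s)); last by ring.
  by apply: ler_pM f2 g2; [exact/ltW/f0|exact/ltW/g0].
Qed.

End slow.

(** * The primitive of a slowly varying density *)

Section slow_primitive.
Context {R : realType}.
Local Notation D0 := (`]0, +oo[%classic : set (Leb R)).
Variables (w W : R -> R).
Hypothesis mw : measurable_fun D0 (w : Leb R -> R).
Hypothesis w0 : forall t : R, 0 < t -> 0 < w t.
Hypothesis sw : slow w.
Hypothesis WE : forall x : R, 0 < x ->
  (\int[leb R]_(t in `]0%R, x[) (t^-1 * w t)%:E = (W x)%:E)%E.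

Lemma measurable_density_sub (E : set R) : E `<=` D0 ->
  measurable_fun (E : set (Leb R)) (fun t : Leb R => (t^-1 * w t)%:E).
Proof.
move=> ED; apply/measurable_EFinP.
exact: (measurable_funS (measurable_leb_itv _) ED (measurable_density mw)).
Qed.

Lemma integral_density_le (x y L : R) : 0 < x -> x <= y ->
    (forall t, x <= t < y -> t^-1 * w t <= L) -> 0 <= L ->
  (\int[leb R]_(t in `[x, y[) (t^-1 * w t)%:E <= (L * (y - x))%:E)%E.
Proof.
move=> x0 xy tL L0; have sub : `[x, y[%classic `<=` D0.
  move=> t /=; rewrite !in_itv /= andbT => /andP[xt _].
  exact: lt_le_trans xt.
apply: (@le_trans _ _ (\int[leb R]_(t in `[x, y[) (cst L%:E) t)%E).
  apply: (ge0_le_integral _ (measurable_leb_itv _)).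
  - by move=> t /sub Dt; rewrite lee_fin (density_ge0 w0).
  - exact: measurable_density_sub.
  - exact: measurable_cst.
  - by move=> t /=; rewrite in_itv /= lee_fin; exact: tL.
rewrite (integral_cst _ (measurable_leb_itv _)) [X in (_ * X)%E]leb_itvE /= lte_fin.
case: ltP => [_|_]; first by rewrite -EFinB -EFinM.
by rewrite mule0 lee_fin mulr_ge0// subr_ge0.
Qed.

(** By slow variation [w] is comparable to [w t] on [[t/2, t)], an interval of
    fixed [dt/t]-mass. *)
Lemma density_le_primitive : exists2 C : R, 0 < C &
  forall t : R, 0 < t -> w t <= C * W t.
Proof.
(* The exponent 1 is enough here; on [[t/2, t)] the ratio is at most 2. *)
have [C C0 h] := sw ltr01; exists (2 * C); first by rewrite mulr_gt0.
move=> t t0; have t20 : 0 < t / 2 by rewrite divr_gt0.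
have t2t : t / 2 < t by rewrite ltr_pdivrMr// mulr_natr mulr2n ltrDl.
have sub : `[t / 2, t[%classic `<=` `]0, t[%classic.
  move=> s /=; rewrite !in_itv /= => /andP[ts ->]; rewrite andbT.
  exact: lt_le_trans ts.
have sub0 : `]0, t[%classic `<=` D0.
  by move=> s /=; rewrite !in_itv /= => /andP[->].
have Ct0 : 0 < C * t by rewrite mulr_gt0.
have : ((w t / (C * t))%:E * (t / 2)%:E <= (W t)%:E)%E.
  rewrite -WE//.
  apply: le_trans (ge0_subset_integral _ (measurable_leb_itv _) (measurable_leb_itv _)
     (measurable_density_sub sub0) _ sub); last first.
    by move=> s /sub0 Ds; rewrite lee_fin (density_ge0 w0).
  have -> : ((t / 2)%:E = leb R (`[(t / 2)%R, t[%classic : set R))%E.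
    rewrite leb_itvE /= lte_fin t2t -EFinB; congr (_%:E).
    by rewrite {2}[t]splitr addrK.
  rewrite -(integral_cst _ (measurable_leb_itv _)).
  apply: (ge0_le_integral _ (measurable_leb_itv _)).
  - by move=> s _; rewrite lee_fin divr_ge0// ltW// w0.
  - exact: measurable_cst.
  - by apply: measurable_density_sub; exact: subset_trans sub sub0.
  - move=> s /=; rewrite in_itv /= => /andP[ts st].
    have s0 : 0 < s by exact: lt_le_trans ts.
    have [_] := h s t s0 (ltW st).
    rewrite powRr1 ?divr_ge0 ?(ltW t0) ?(ltW s0)// => hs.
    rewrite lee_fin ler_pdivrMr//; apply: le_trans hs _.
    rewrite le_eqVlt; apply/orP; left; apply/eqP; field.
    by rewrite gt_eqF.
rewrite -EFinM lee_fin => hW.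
rewrite -(ler_pM2l (_ : 0 < (2 * C)^-1)) ?invr_gt0 ?mulr_gt0// mulKf ?gt_eqF ?mulr_gt0//.
apply: le_trans hW; rewrite le_eqVlt; apply/orP; left; apply/eqP; field.
by rewrite !gt_eqF.
Qed.

Lemma primitive_gt0 (x : R) : 0 < x -> 0 < W x.
Proof.
move=> x0; have [C C0 h] := density_le_primitive.
by rewrite -(pmulr_rgt0 _ C0) (lt_le_trans (w0 x0))// h.
Qed.

(** Between [s] and [t] the density is at most [(x/s)^e w(s)] up to a constant;
    integrating gives [(t/s)^e w(s)], and [w(s)] is at most a multiple of [W(s)]. *)
Lemma slow_primitive : slow W.
Proof.
move=> e e0; pose e' := Num.min e 2^-1.
have e'0 : 0 < e' by rewrite lt_min e0 invr_gt0 ltr0n.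
have e'1 : 0 <= 1 - e' < 1.
  by rewrite subr_ge0 ltrBlDr ltrDl e'0 andbT ge_min invf_le1// ler1n orbT.
have [C C0 h] := sw e'0; have [H H0 hH] := power_integral_head e'1.
have [G G0 hG] := density_le_primitive.
exists (1 + C * H * G); first by rewrite addr_gt0// !mulr_gt0.
move=> s t s0 st; have t0 := lt_le_trans s0 st.
have ts1 := ratio_ge1 s0 st; have Ws0 := primitive_gt0 s0.
have Wt0 := primitive_gt0 t0.
have P1 : 1 <= (t / s) `^ e.
  have : 1 `^ e <= (t / s) `^ e.
    by rewrite ge0_ler_powR ?(ltW e0)// nnegrE// (le_trans _ ts1).
  by rewrite powR1.
have CHG1 : 1 <= 1 + C * H * G by rewrite lerDl !mulr_ge0// ltW.
split.
  apply: (le_trans (primitive_mono mw w0 WE s0 st)).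
  by rewrite ler_peMl ?(ltW Wt0)// mulr_ege1.
have sub : `[s, t[%classic `<=` `]0, t[%classic.
  move=> x /=; rewrite !in_itv /= => /andP[sx ->]; rewrite andbT.
  exact: lt_le_trans sx.
have sub0 : `]0, t[%classic `<=` D0.
  by move=> x /=; rewrite !in_itv /= => /andP[->].
have mpow : measurable_fun (`]0, t[ : set (Leb R))
    (fun x : Leb R => (x `^ (- (1 - e')))%:E).
  apply/measurable_EFinP; apply: measurable_fun_leb; first exact: measurable_itv.
  by apply: (measurable_funS measurableT) => //; exact: measurable_powR.
have K0 : 0 <= C * w s * s `^ (- e').
  by rewrite !mulr_ge0 ?powR_ge0// ltW// w0.
have I : (\int[leb R]_(x in `[s, t[) (x^-1 * w x)%:E <=
    ((C * w s * s `^ (- e')) * (H * t `^ e'))%:E)%E.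
  apply: (@le_trans _ _ (\int[leb R]_(x in `[s, t[)
      ((C * w s * s `^ (- e'))%:E * (x `^ (- (1 - e')))%:E))%E).
    apply: (ge0_le_integral _ (measurable_leb_itv _)).
    - by move=> x /sub /sub0 Dx; rewrite lee_fin (density_ge0 w0).
    - by apply: measurable_density_sub; exact: subset_trans sub sub0.
    - apply: measurable_funeM.
      by apply: (measurable_funS (measurable_leb_itv _) sub mpow).
    - move=> x /=; rewrite in_itv /= => /andP[sx xt].
      have x0 : 0 < x := lt_le_trans s0 sx.
      rewrite -EFinM lee_fin ler_pdivrMl//; apply: le_trans (h s x s0 sx).2 _.
      rewrite powRM ?invr_ge0 ?(ltW x0) ?(ltW s0)// -[s^-1](powR_inv1 (ltW s0)) -powRrM mulN1r.
      rewrite opprB powRB ?(gt_eqF x0) ?implybT// powRr1 ?(ltW x0)//.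
      by rewrite le_eqVlt; apply/orP; left; apply/eqP; field; rewrite gt_eqF.
  rewrite (ge0_integralZl _ (measurable_leb_itv _)); last 3 first.
  - exact: (measurable_funS (measurable_leb_itv _) sub mpow).
  - by move=> x _; rewrite lee_fin powR_ge0.
  - by rewrite lee_fin.
  rewrite [leRHS]EFinM lee_wpmul2l ?lee_fin//.
  apply: (@le_trans _ _ (\int[leb R]_(x in `]0%R, t[) (x `^ (- (1 - e')))%:E)%E).
    apply: (ge0_subset_integral _ (measurable_leb_itv _) (measurable_leb_itv _) mpow _ sub).
    by move=> x _; rewrite lee_fin powR_ge0.
  by apply: le_trans (hH t t0) _; rewrite opprB addrCA subrr addr0.
rewrite -lee_fin (primitive_split mw w0 WE s0 st).
apply: (@le_trans _ _ ((W s)%:E + ((C * w s * s `^ (- e')) * (H * t `^ e'))%:E)%E).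
  by rewrite leeD2l.
rewrite -EFinD lee_fin.
rewrite [leRHS](_ : _ = (t / s) `^ e * W s + C * H * G * (t / s) `^ e * W s); last by ring.
apply: lerD; first by rewrite ler_peMl// ltW.
have -> : C * w s * s `^ (- e') * (H * t `^ e') = C * H * (t / s) `^ e' * w s.
  rewrite powRM ?invr_ge0 ?(ltW t0) ?(ltW s0)// -[s^-1](powR_inv1 (ltW s0)) -powRrM mulN1r.
  by ring.
apply: (@le_trans _ _ (C * H * (t / s) `^ e * (G * W s))).
  apply: ler_pM.
  - by rewrite !mulr_ge0 ?powR_ge0 ?ltW.
  - by rewrite ltW ?w0.
  - by rewrite ler_wpM2l ?mulr_ge0 ?(ltW C0) ?(ltW H0)// ler_powR// ge_min lexx.
  - exact: hG.
by rewrite le_eqVlt; apply/orP; left; apply/eqP; ring.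
Qed.

Lemma primitive_small (c : R) : 0 < c -> exists2 x : R, 0 < x & W x < c.
Proof.
move=> c0.
pose F (n : nat) : set (Leb R) := `[n.+1%:R^-1, 1[%classic.
have F1 n : n.+1%:R^-1 <= 1 :> R by rewrite invf_le1// ler1n.
have UF : \bigcup_n F n = `]0, 1[%classic :> set R.
  apply/seteqP; split=> [x [n _]|x]; rewrite /F /= !in_itv /=.
    by move=> /andP[nx ->]; rewrite andbT (lt_le_trans _ nx).
  move=> /andP[x0 x1]; exists (Num.bound x^-1) => //=.
  rewrite in_itv /= x1 andbT -[leRHS]invrK lef_pV2 ?posrE ?invr_gt0//.
  apply: ltW; apply: lt_trans (archi_boundP _) _; first by rewrite invr_ge0 ltW.
  by rewrite ltr_nat.
have sub n : F n `<=` D0.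
  move=> x; rewrite /F /= !in_itv /= andbT => /andP[nx _].
  by rewrite (lt_le_trans _ nx).
have h := @ge0_nondecreasing_set_cvg_integral _ _ R F (fun t => (t^-1 * w t)%:E) (leb R).
have {}h := h _ (fun n => measurable_leb_itv _) (fun n => measurable_density_sub (@sub n)) _.
have : (\int[leb R]_(t in F n) (t^-1 * w t)%:E)%E @[n --> \oo] --> (W 1)%:E.
  rewrite -WE// -UF; apply: h.
  - move=> n m nm; apply/subsetPset => x; rewrite /F /= !in_itv /= => /andP[nx ->].
    by rewrite andbT (le_trans _ nx)// lef_pV2 ?posrE// ler_nat ltnS.
  - by move=> n x /sub Dx; rewrite lee_fin (density_ge0 w0).
have FE n : (\int[leb R]_(t in F n) (t^-1 * w t)%:E = (W 1 - W n.+1%:R^-1)%:E)%E.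
  have n0 : 0 < n.+1%:R^-1 :> R by rewrite invr_gt0.
  by rewrite EFinB (primitive_split mw w0 WE n0 (F1 n)) addeAC subee// add0e.
under eq_cvg do rewrite FE.
move/fine_cvg => hc.
have [|n _ hn] := @cvgr_gt _ _ _ _ _ (W 1) hc (W 1 - c).
  by rewrite ltrBlDr ltrDl.
exists n.+1%:R^-1; first by rewrite invr_gt0.
by have := hn n (leqnn n); rewrite /= ltrD2l ltrN2.
Qed.

Hypothesis Woo : forall c : R, exists2 x : R, 0 < x & c < W x.

(** On a compact interval [w(t)/t] is bounded, so [W] is Lipschitz there and the
    intermediate value theorem applies. *)
Lemma primitive_surj (c : R) : 0 < c -> exists2 x : R, 0 < x & W x = c.
Proof.
move=> c0; have [x x0 xc] := primitive_small c0; have [y y0 yc] := Woo c.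
have xy : x <= y.
  rewrite leNgt; apply/negP => /ltW /(primitive_mono mw w0 WE y0).
  by rewrite leNgt (lt_trans xc yc).
have [C C0 h] := sw ltr01.
pose L := x^-1 * (C * (y / x) * w x).
have L0 : 0 < L by rewrite !mulr_gt0 ?invr_gt0 ?w0.
have lip s t : x <= s -> s <= t -> t <= y -> W t - W s <= L * (t - s).
  move=> xs st ty; have s0 := lt_le_trans x0 xs.
  rewrite lerBlDl -lee_fin (primitive_split mw w0 WE s0 st) EFinD leeD2l//.
  apply: integral_density_le => //; last exact: ltW.
  move=> r /andP[sr rt]; have r0 := lt_le_trans s0 sr; have xr := le_trans xs sr.
  apply: ler_pM.
  - by rewrite invr_ge0 ltW.
  - exact/ltW/w0.
  - by rewrite lef_pV2.
  apply: le_trans (h x r x0 xr).2 _.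
  rewrite powRr1 ?divr_ge0 ?(ltW r0) ?(ltW x0)// ler_pM2r ?w0// ler_pM2l// ler_pM2r ?invr_gt0//.
  exact/ltW/(lt_le_trans rt ty).
pose f t := W (Num.max x (Num.min t y)).
have fc : continuous f.
  move=> t; apply/cvgrPdist_lt => e e0; near=> s.
  have clamp r : x <= Num.max x (Num.min r y) <= y.
    by rewrite le_max lexx ge_max xy ge_min lexx orbT.
  have mono r1 r2 : r1 <= r2 -> `|f r1 - f r2| <= L * `|r1 - r2|.
    move=> r12; have rr : Num.max x (Num.min r1 y) <= Num.max x (Num.min r2 y).
      rewrite ge_max !le_max lexx /= le_min !ge_min r12 lexx !orbT //.
    have /andP[a1 b1] := clamp r1; have /andP[a2 b2] := clamp r2.
    rewrite distrC ger0_norm ?subr_ge0 ?(primitive_mono mw w0 WE)//; last first.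
      exact: lt_le_trans a1.
    apply: le_trans (lip _ _ a1 rr b2) _; rewrite ler_pM2l// distrC ger0_norm ?subr_ge0//.
    case: (leP r1 y) => ?; case: (leP r2 y) => ?; do 2?[case: (leP x _) => ?]; lra.
  have tse : L * `|t - s| < e.
    rewrite mulrC -ltr_pdivlMr//; near: s.
    by apply: (@cvgr_dist_lt _ _ _ _ _ idfun t) => //; rewrite divr_gt0.
  have [ts|/ltW st] := leP t s; first exact: le_lt_trans (mono _ _ ts) tse.
  by rewrite distrC (le_lt_trans (mono _ _ st))// distrC.
have fx : f x = W x by rewrite /f min_l// max_l.
have fy : f y = W y by rewrite /f min_l// max_r.
have [||z zxy fz] := @IVT _ f x y c xy.
- exact: continuous_subspaceT.
- by rewrite fx fy ge_min (ltW xc) le_max (ltW yc) orbT.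
exists (Num.max x (Num.min z y)); last exact: fz.
by rewrite lt_max x0.
Unshelve. all: by end_near. Qed.

End slow_primitive.

(** * Weighted norms *)

Lemma le_poweR {R : realType} (x y : \bar R) (r : R) :
  0 <= r -> (0 <= x)%E -> (x <= y)%E -> (x `^ r <= y `^ r)%E.
Proof.
move=> r0 x0 xy; apply: gt0_ler_poweR => //.
- by rewrite in_itv /= x0 leey.
- by rewrite in_itv /= leey andbT (le_trans x0).
Qed.

Section weighted_hoelder.
Context d (T : measurableType d) {R : realType} (mu : {measure set T -> \bar R}).

(** The density is shared between the factors as [om^(1/r)] and [om^(1/r')]. *)
Lemma weighted_hoelder (E : set T) (om F G : T -> R) (r r' : R) :
    measurable E -> 0 < r -> 0 < r' -> r^-1 + r'^-1 = 1 ->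
    measurable_fun E om -> measurable_fun E F -> measurable_fun E G ->
    (forall x, E x -> [/\ 0 <= om x, 0 <= F x & 0 <= G x]) ->
  (\int[mu]_(x in E) (om x * (F x * G x))%:E <=
   (\int[mu]_(x in E) (om x * F x `^ r)%:E) `^ r^-1 *
   (\int[mu]_(x in E) (om x * G x `^ r')%:E) `^ r'^-1)%E.
Proof.
move=> mE r0 r'0 rr' mom mF mG pos.
have mpow (f : T -> R) (p : R) : measurable_fun E f -> measurable_fun E (fun x => f x `^ p).
  by move=> mf; exact: (measurableT_comp (measurable_powR p) mf).
pose f1 := (fun x => om x `^ r^-1 * F x) \_ E.
pose f2 := (fun x => om x `^ r'^-1 * G x) \_ E.
have m1 : measurable_fun setT f1.
  by apply/(measurable_restrictT _ mE); apply: measurable_funM => //; exact: mpow.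
have m2 : measurable_fun setT f2.
  by apply/(measurable_restrictT _ mE); apply: measurable_funM => //; exact: mpow.
have nrm (f : T -> R) (p : R) : 0 < p -> measurable_fun E f ->
    (forall x, E x -> 0 <= f x) ->
    (Lnorm mu p%:E (EFin \o ((fun x => om x `^ p^-1 * f x)%R \_ E)) =
    (\int[mu]_(x in E) (om x * f x `^ p)%:E) `^ p^-1)%E.
  move=> p0 mf f0; rewrite unlock; congr (_ `^ _)%E.
  rewrite [RHS]integral_mkcond; apply: eq_integral => x _.
  rewrite /patch /=; case: ifPn => [/set_mem Ex|_].
    rewrite ger0_norm ?mulr_ge0 ?powR_ge0 ?f0// powRM ?powR_ge0 ?f0//.
    have [omx _ _] := pos x Ex.
    by rewrite -powRrM mulVf ?gt_eqF// powRr1.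
  by rewrite normr0 powR0// gt_eqF.
have := hoelder mu m1 m2 r0 r'0 rr'.
rewrite !nrm//; [|by move=> x /pos[]|by move=> x /pos[]].
rewrite Lnorm1 => /(le_trans _); apply.
rewrite [leLHS]integral_mkcond le_eqVlt; apply/orP; left; apply/eqP.
apply: eq_integral => x _; rewrite /f1 /f2 /patch /=.
case: ifPn => [/set_mem Ex|_]; last by rewrite mulr0 normr0.
have [omx Fx Gx] := pos x Ex.
rewrite ger0_norm ?mulr_ge0 ?powR_ge0//; congr (_%:E).
rewrite mulrACA -powRD ?rr' ?powRr1//.
by apply/implyP; rewrite oner_eq0.
Qed.

End weighted_hoelder.

Section weighted_norm.
Context {R : realType}.
Local Notation D0 := (`]0, +oo[%classic : set (Leb R)).

(** The inequality [weighted_norm q v phi <= c] with the root removed.  It keeps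
    all comparisons of norms at the level of integrals of non-negative functions
    and treats the exponent [+oo] along with the finite ones. *)
Definition weighted_bound (q : \bar R) (v phi : R -> R) (c : R) : Prop :=
  if q is r%:E then
    (\int[leb R]_(t in D0) (t^-1 * (v t * phi t) `^ r)%:E <= (c `^ r)%:E)%E
  else {ae leb R, forall t, D0 t -> v t * phi t <= c}.

Lemma weighted_norm_leP (q : \bar R) (v phi : R -> R) (c : R) :
    (1 < q)%E -> 0 <= c -> (forall t : R, 0 < t -> 0 <= v t * phi t) ->
  (weighted_norm q v phi <= c%:E)%E <-> weighted_bound q v phi c.
Proof.
move=> q1 c0 vphi0; case: q q1 => [r||//] q1; rewrite /weighted_norm unlock /=.
- have r0 : 0 < r by rewrite (lt_trans ltr01)// -lte_fin.
  pose I := (\int[leb R]_(t in D0) (t^-1 * (v t * phi t) `^ r)%:E)%E.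
  rewrite (_ : integral _ _ _ = I); last first.
    rewrite [RHS]integral_mkcond; apply: eq_integral => t _.
    rewrite /patch /=; case: ifPn => [/set_mem /=|_]; last first.
      by rewrite abse0 poweR0r// gt_eqF.
    rewrite in_itv /= andbT => t0.
    have vp := vphi0 t t0.
    rewrite inver gt_eqF//= -mulrA ger0_norm; last by rewrite mulr_ge0 ?powR_ge0.
    rewrite powRM ?powR_ge0// -powRrM mulNr mulVf ?gt_eqF//.
    by rewrite powR_inv1// ltW.
  rewrite /weighted_bound -/I; have I0 : (0 <= I)%E.
    apply: integral_ge0 => t /=; rewrite in_itv /= andbT => t0.
    by rewrite lee_fin mulr_ge0 ?powR_ge0// invr_ge0 ltW.
  split=> h.
  + have : ((I `^ r^-1) `^ r <= (c%:E) `^ r)%E.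
      by apply: le_poweR h; rewrite ?poweR_ge0// ltW.
    by rewrite -poweRrM mulVf ?gt_eqF// poweRe1// poweR_EFin.
  + have : (I `^ r^-1 <= ((c `^ r)%:E) `^ r^-1)%E.
      by apply: le_poweR h; rewrite ?invr_ge0// ltW.
    by rewrite poweR_EFin -powRrM mulfV ?gt_eqF// powRr1.
- have -> : (0 < leb R [set: Leb R])%E.
    apply: (@lt_le_trans _ _ (leb R (`]0%R, 1%R[%classic : set R))).
      by rewrite leb_itvE /= lte_fin ltr01 sube0.
    by apply: le_measure; rewrite ?inE//; exact: measurable_leb_itv.
  split.
  + move/ess_supP; apply: filterS => t /= + t0.
    rewrite /patch mem_set//= lee_fin => h; apply: le_trans h.
    rewrite oppr0 powRr0 mul1r ler_norm//.
  + move=> h; apply/ess_supP; apply: filterS h => t h.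
    rewrite /= /patch; case: ifPn => [/set_mem Dt|_]; last by rewrite abse0 lee_fin.
    rewrite oppr0 powRr0 mul1r lee_fin ger0_norm ?h//.
    by apply: vphi0; move: Dt; rewrite /= in_itv /= andbT.
Qed.

End weighted_norm.

Section conjugate.
Context {R : realType}.

(** The exponent [+oo] has to be treated apart throughout, since its norm is an
    essential supremum. *)
Lemma conjugate_cases (q : \bar R) (q' : R) :
    (1 < q)%E -> q'%:E = hoelder_conjugate q ->
  (q = +oo%E /\ q' = 1) \/
  (exists2 r : R, q = r%:E & [/\ 1 < r, 1 < q' & r^-1 + q'^-1 = 1]).
Proof.
case: q => [r||//] q1; last by rewrite hoelder_conjugatey => -[->]; left.
have r1 : 1 < r by rewrite -lte_fin.
have r0 : 0 < r by rewrite (lt_trans ltr01).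
rewrite /hoelder_conjugate /= eqe gt_eqF// inver subr_eq0 gt_eqF// -EFinM => -[q'E].
right; exists r => //.
have r10 : r - 1 != 0 by rewrite subr_eq0 gt_eqF.
split=> //.
  by rewrite q'E ltr_pdivlMr ?subr_gt0// mul1r ltrBlDr ltrDl.
by rewrite q'E; field; rewrite r10 gt_eqF.
Qed.

End conjugate.

Lemma le_holder_eq {R : realType} (a a' b b' c c' : \bar R) (x y : R) :
  a = a' -> b = b' -> c = c' ->
  (a <= b `^ x * c `^ y -> a' <= b' `^ x * c' `^ y)%E.
Proof. by move=> -> -> ->. Qed.

(** The inequality obtained from Hoelder's with [kernel_head] for [d = 1/2],
    raised to the power [r]. *)
Lemma le_holder_pow {R : realType} (k C y r q' : R) (x : \bar R) :
    0 <= k -> 0 < C -> 0 < y -> (0 <= x)%E -> 0 < r ->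
    (k%:E <= x `^ r^-1 * ((C * y `^ (1 - 2^-1))%:E) `^ q'^-1)%E ->
  ((k `^ r)%:E <= x * (C `^ (r / q') * y `^ (r / q' / 2))%:E)%E.
Proof.
move=> k0 C0 y0 x0 r0 hold; have Ek0 : (0 <= k%:E)%E by rewrite lee_fin.
have := le_poweR (ltW r0) Ek0 hold.
rewrite poweR_EFin poweRM ?poweR_ge0// -!poweRrM mulVf ?gt_eqF// poweRe1//.
move=> /le_trans; apply; apply: lee_wpmul2l => //; rewrite poweR_EFin lee_fin.
rewrite powRM ?powR_ge0 ?(ltW C0)// (mulrC q'^-1) -powRrM.
move: (r / q') => z.
by rewrite (_ : (1 - 2^-1) * z = z / 2)//; field.
Qed.

Section weighted_bound_theory.
Context {R : realType}.
Local Notation D0 := (`]0, +oo[%classic : set (Leb R)).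

Let mD : measurable D0 := measurable_leb_itv _.

Let D0P (t : R) : D0 t -> 0 < t.
Proof. by rewrite /= in_itv /= andbT. Qed.

Lemma measurable_bound_integrand (v phi : R -> R) (r : R) :
    measurable_fun D0 (v : Leb R -> R) -> measurable_fun D0 (phi : Leb R -> R) ->
  measurable_fun D0 (fun t : Leb R => (t^-1 * (v t * phi t) `^ r)%:E).
Proof.
move=> mv mphi; apply/measurable_EFinP.
apply: measurable_funM; first exact: measurable_inv_pos.
by apply: (measurableT_comp (measurable_powR _)); exact: measurable_funM mv mphi.
Qed.

Lemma bound_integrand_ge0 (v phi : R -> R) (r : R) (t : R) :
  D0 t -> (0 <= (t^-1 * (v t * phi t) `^ r)%:E)%E.
Proof. by move=> /D0P t0; rewrite lee_fin mulr_ge0 ?powR_ge0// invr_ge0 ltW. Qed.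

Lemma weighted_bound_le (q : \bar R) (v v' phi phi' : R -> R) (c : R) :
    (1 < q)%E ->
    measurable_fun D0 (v : Leb R -> R) -> measurable_fun D0 (phi : Leb R -> R) ->
    measurable_fun D0 (v' : Leb R -> R) -> measurable_fun D0 (phi' : Leb R -> R) ->
    (forall t : R, 0 < t -> 0 <= v' t * phi' t <= v t * phi t) ->
  weighted_bound q v phi c -> weighted_bound q v' phi' c.
Proof.
case: q => [r||//] q1 mv mphi mv' mphi' le; rewrite /weighted_bound.
  move=> h; apply: le_trans h; apply: (ge0_le_integral _ mD).
  - exact: bound_integrand_ge0.
  - exact: measurable_bound_integrand.
  - exact: measurable_bound_integrand.
  - move=> t /D0P t0; have /andP[p0 pv] := le t t0.
    rewrite lee_fin; apply: ler_wpM2l; first by rewrite invr_ge0 ltW.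
    apply: ge0_ler_powR; rewrite ?nnegrE//.
    + by rewrite -lee_fin (le_trans _ (ltW q1))// lee_fin ler01.
    + exact: le_trans pv.
apply: filterS => t h Dt; have /andP[_ pv] := le t (D0P Dt).
exact: le_trans pv (h Dt).
Qed.

Lemma weighted_bound_widen (q : \bar R) (v phi : R -> R) (c c' : R) :
  (1 < q)%E -> 0 <= c -> c <= c' ->
  weighted_bound q v phi c -> weighted_bound q v phi c'.
Proof.
case: q => [r||//] q1 c0 cc'; rewrite /weighted_bound.
  move=> /le_trans; apply; rewrite lee_fin; apply: ge0_ler_powR; rewrite ?nnegrE//.
  - by rewrite -lee_fin (le_trans _ (ltW q1))// lee_fin ler01.
  - exact: le_trans cc'.
by apply: filterS => t h Dt; exact: le_trans (h Dt) cc'.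
Qed.

Lemma powR_addl (r x y : R) : 1 <= r -> 0 <= x -> 0 <= y ->
  x `^ r + y `^ r <= (x + y) `^ r.
Proof.
move=> r1 x0 y0; have r0 : 0 <= r - 1 by rewrite subr_ge0.
have key z : 0 <= z -> z <= x + y -> z `^ r <= z * (x + y) `^ (r - 1).
  move=> z0 zxy; have [->|zn0] := eqVneq z 0.
    by rewrite powR0 ?mul0r// gt_eqF// (lt_le_trans ltr01).
  have -> : z `^ r = z * z `^ (r - 1).
    rewrite -{2}(powRr1 z0) -powRD; last by rewrite zn0 implybT.
    by rewrite addrC subrK.
  by rewrite ler_wpM2l// ge0_ler_powR// nnegrE (le_trans z0).
have xy0 : 0 <= x + y by rewrite addr_ge0.
have [xy|xyn0] := eqVneq (x + y) 0.
  have := key x x0; have := key y y0; rewrite xy.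
  have rn : r - 1 + 1 = r by rewrite subrK.
  have x00 : x = 0 by apply/eqP; rewrite eq_le x0 -xy lerDl y0.
  have y00 : y = 0 by apply/eqP; rewrite eq_le y0 -xy lerDr x0.
  by rewrite x00 y00 powR0 ?addr0// gt_eqF// (lt_le_trans ltr01).
have -> : (x + y) `^ r = x * (x + y) `^ (r - 1) + y * (x + y) `^ (r - 1).
  rewrite -mulrDl -{2}(powRr1 xy0) -powRD; last by rewrite xyn0 implybT.
  by rewrite (addrC 1) subrK.
by apply: lerD; apply: key; rewrite ?lerDl ?lerDr.
Qed.

Lemma powR_addr (r x y : R) : 1 <= r -> 0 <= x -> 0 <= y ->
  (x + y) `^ r <= 2 `^ r * (x `^ r + y `^ r).
Proof.
move=> r1 x0 y0; have r0 : 0 <= r := le_trans ler01 r1.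
have key a b : 0 <= a -> 0 <= b -> a <= b -> (a + b) `^ r <= 2 `^ r * b `^ r.
  move=> a0 b0 ab; rewrite -powRM// ge0_ler_powR// ?nnegrE ?addr_ge0 ?mulr_ge0//.
  by rewrite mulr_natl mulr2n lerD2r.
have [xy|/ltW yx] := leP x y.
  by apply: le_trans (key _ _ x0 y0 xy) _; rewrite ler_wpM2l ?powR_ge0// lerDr powR_ge0.
rewrite addrC; apply: le_trans (key _ _ y0 x0 yx) _.
by rewrite ler_wpM2l ?powR_ge0// lerDl powR_ge0.
Qed.

Lemma weighted_boundD (q : \bar R) (v phi psi : R -> R) (c d : R) :
    (1 < q)%E -> (forall t : R, 0 < t -> 0 <= v t) ->
    measurable_fun D0 (v : Leb R -> R) ->
    measurable_fun D0 (phi : Leb R -> R) -> measurable_fun D0 (psi : Leb R -> R) ->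
    (forall t : R, 0 < t -> 0 <= phi t) -> (forall t : R, 0 < t -> 0 <= psi t) ->
    0 <= c -> 0 <= d ->
    weighted_bound q v phi c -> weighted_bound q v psi d ->
  weighted_bound q v (fun t => phi t + psi t) (2 * (c + d)).
Proof.
case: q => [r||//] q1 v0 mv mphi mpsi phi0 psi0 c0 d0; rewrite /weighted_bound.
  have r1 : 1 <= r by rewrite -lee_fin ltW.
  have cd : 2 `^ r * (c `^ r + d `^ r) <= (2 * (c + d)) `^ r.
    by rewrite powRM ?addr_ge0// ler_wpM2l ?powR_ge0// powR_addl.
  have m1 := measurable_bound_integrand r mv mphi.
  have m2 := measurable_bound_integrand r mv mpsi.
  have p1 t := @bound_integrand_ge0 v phi r t.
  have p2 t := @bound_integrand_ge0 v psi r t.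
  have le (t : R) : D0 t -> ((t^-1 * (v t * (phi t + psi t)) `^ r)%:E <=
      (2 `^ r)%:E * ((t^-1 * (v t * phi t) `^ r)%:E + (t^-1 * (v t * psi t) `^ r)%:E))%E.
    move=> /D0P t0; rewrite -EFinD -EFinM lee_fin -mulrDr mulrCA.
    apply: ler_wpM2l; first by rewrite invr_ge0 ltW.
    rewrite mulrDr; apply: powR_addr => //; apply: mulr_ge0.
    + exact: v0. + exact: phi0. + exact: v0. + exact: psi0.
  move=> h1 h2.
  apply: (@le_trans _ _ (\int[leb R]_(t in D0) ((2 `^ r)%:E *
      ((t^-1 * (v t * phi t) `^ r)%:E + (t^-1 * (v t * psi t) `^ r)%:E)))%E).
    apply: (ge0_le_integral _ mD).
    - exact: (@bound_integrand_ge0 v (fun t => phi t + psi t)).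
    - apply: (@measurable_bound_integrand v (fun t => phi t + psi t)); first exact: mv.
      exact: measurable_funD mphi mpsi.
    - by apply: measurable_funeM; exact: emeasurable_funD m1 m2.
    - exact: le.
  rewrite (ge0_integralZl _ mD); last 3 first.
  - exact: emeasurable_funD m1 m2.
  - by move=> t Dt; apply: adde_ge0; [exact: p1|exact: p2].
  - by rewrite lee_fin powR_ge0.
  rewrite (ge0_integralD _ mD p1 m1 p2 m2).
  apply: (@le_trans _ _ ((2 `^ r)%:E * ((c `^ r)%:E + (d `^ r)%:E))%E).
    apply: lee_wpmul2l; first by rewrite lee_fin powR_ge0.
    exact: leeD.
  by rewrite -EFinD -EFinM lee_fin.
apply: filterS2 => t h1 h2 Dt; rewrite mulrDr (le_trans (lerD (h1 Dt) (h2 Dt)))//.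
by rewrite ler_peMl ?addr_ge0// ler1n.
Qed.

Lemma weighted_boundZ (q : \bar R) (v phi : R -> R) (c k : R) :
    (1 < q)%E -> (forall t : R, 0 < t -> 0 <= v t) ->
    measurable_fun D0 (v : Leb R -> R) -> measurable_fun D0 (phi : Leb R -> R) ->
    (forall t : R, 0 < t -> 0 <= phi t) -> 0 <= k -> 0 <= c ->
  weighted_bound q v phi c -> weighted_bound q v (fun t => k * phi t) (k * c).
Proof.
case: q => [r||//] q1 v0 mv mphi phi0 k0 c0; rewrite /weighted_bound.
  have E : (\int[leb R]_(t in D0) (t^-1 * (v t * (k * phi t)) `^ r)%:E =
      \int[leb R]_(t in D0) ((k `^ r)%:E * (t^-1 * (v t * phi t) `^ r)%:E))%E.
    apply: eq_integral => t /set_mem/D0P t0; rewrite -EFinM; congr (_%:E).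
    by rewrite mulrCA (powRM _ k0 (mulr_ge0 (v0 t t0) (phi0 t t0))) mulrCA.
  rewrite E (ge0_integralZl _ mD); last 3 first.
  - exact: measurable_bound_integrand.
  - exact: bound_integrand_ge0.
  - by rewrite lee_fin powR_ge0.
  rewrite powRM// EFinM => h.
  by apply: lee_wpmul2l h; rewrite lee_fin powR_ge0.
apply: filterS => t h Dt; rewrite mulrCA; apply: ler_wpM2l k0 _ _ _.
exact: h Dt.
Qed.

(** Pairing with [g] over any part [E] of the half-line; the result is later used
    with [E] a block, an initial interval or everything. *)
Lemma weighted_bound_hoelder (q : \bar R) (q' : R) (v g phi : R -> R)
    (E : set R) (M c : R) :
    (1 < q)%E -> q'%:E = hoelder_conjugate q ->
    measurable (E : set (Leb R)) -> E `<=` D0 ->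
    (forall t : R, 0 < t -> 0 < v t) ->
    (forall t : R, 0 < t -> 0 <= g t) -> (forall t : R, 0 < t -> 0 <= phi t) ->
    measurable_fun D0 (v : Leb R -> R) -> measurable_fun D0 (g : Leb R -> R) ->
    measurable_fun D0 (phi : Leb R -> R) -> 0 <= M -> 0 <= c ->
    (\int[leb R]_(t in E) (t^-1 * (g t * v t `^ (-1)) `^ q')%:E <= M%:E)%E ->
    weighted_bound q v phi c ->
  (\int[leb R]_(t in E) (t^-1 * (g t * phi t))%:E <= (M `^ q'^-1 * c)%:E)%E.
Proof.
move=> q1 qq' mE ED v0 g0 phi0 mv mg mphi M0 c0.
have sub (f : Leb R -> R) : measurable_fun D0 f -> measurable_fun (E : set (Leb R)) f.
  exact: (measurable_funS mD ED).
have mvi : measurable_fun D0 ((fun t => v t `^ (-1)) : Leb R -> R).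
  exact: (measurableT_comp (measurable_powR _) mv).
have EP (t : R) : E t -> 0 < t by move=> /ED/D0P.
have mvphi : measurable_fun D0 ((fun t => v t * phi t) : Leb R -> R).
  exact: measurable_funM mv mphi.
have mgv : measurable_fun D0 ((fun t => g t * v t `^ (-1)) : Leb R -> R).
  exact: measurable_funM mg mvi.
have mgvi u : measurable_fun (E : set (Leb R))
    (fun t : Leb R => (t^-1 * (g t * v t `^ (-1)) `^ u)%:E).
  apply/measurable_EFinP; apply: sub; apply: measurable_funM; first exact: measurable_inv_pos.
  exact: (measurableT_comp (measurable_powR _) mgv).
have [[qy q'1]|[r qr [r1 q'1 rr']]] := conjugate_cases q1 qq'.
  rewrite qy q'1 invr1 powRr1// mulrC /weighted_bound => hM h.
  apply: (@le_trans _ _ (\int[leb R]_(t in E) (c%:E * (t^-1 * (g t * v t `^ (-1)) `^ 1)%:E))%E).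
    apply: (ae_ge0_le_integral mE).
    - move=> t /EP t0; rewrite lee_fin; apply: mulr_ge0; first by rewrite invr_ge0 ltW.
      by apply: mulr_ge0; [exact: g0|exact: phi0].
    - apply/measurable_EFinP; apply: sub; apply: measurable_funM; first exact: measurable_inv_pos.
      exact: measurable_funM mg mphi.
    - move=> t /EP t0; rewrite -EFinM lee_fin; apply: mulr_ge0 => //.
      by apply: mulr_ge0; [rewrite invr_ge0 ltW|exact: powR_ge0].
    - exact: measurable_funeM.
    - apply: filterS h => t h Et; have t0 := EP t Et; have vt := v0 t t0.
      have gv0 : 0 <= g t * v t `^ (-1) by apply: mulr_ge0; [exact: g0|exact: powR_ge0].
      rewrite -EFinM lee_fin [leRHS]mulrCA; apply: ler_wpM2l; first by rewrite invr_ge0 ltW.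
      rewrite powRr1// [leRHS]mulrCA; apply: ler_wpM2l; first exact: g0.
      rewrite powR_inv1 ?(ltW vt)// ler_pdivlMr// mulrC.
      by apply: h; exact: ED.
  rewrite (ge0_integralZl _ mE (mgvi 1)); last 2 first.
  - move=> t /EP t0; rewrite lee_fin.
    by apply: mulr_ge0; [rewrite invr_ge0 ltW|exact: powR_ge0].
  - by rewrite lee_fin.
  rewrite EFinM; apply: lee_wpmul2l hM; by rewrite lee_fin.
have r0 : 0 < r := lt_trans ltr01 r1.
have q'0 : 0 < q' := lt_trans ltr01 q'1.
have pos : forall t, E t -> [/\ 0 <= t^-1, 0 <= v t * phi t & 0 <= g t * v t `^ (-1)].
  move=> t /EP t0; split; first by rewrite invr_ge0 ltW.
  - by apply: mulr_ge0; [exact/ltW/v0|exact: phi0].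
  - by apply: mulr_ge0; [exact: g0|exact: powR_ge0].
have hold := weighted_hoelder (leb R) mE r0 q'0 rr'
  (sub _ measurable_inv_pos) (sub _ mvphi) (sub _ mgv) pos.
have I0 (f : R -> R) : (0 <= \int[leb R]_(t in E) (t^-1 * f t `^ q')%:E)%E.
  apply: integral_ge0 => t /EP t0; rewrite lee_fin.
  by apply: mulr_ge0; [rewrite invr_ge0 ltW|exact: powR_ge0].
rewrite qr /weighted_bound => hM h.
have -> : (\int[leb R]_(t in E) (t^-1 * (g t * phi t))%:E =
    \int[leb R]_(t in E) (t^-1 * ((v t * phi t) * (g t * v t `^ (-1))))%:E)%E.
  apply: eq_integral => t /set_mem/EP t0; congr (_%:E); congr (_ * _).
  rewrite (powR_inv1 (ltW (v0 t t0))); have := v0 t t0; clear.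
  by move: (v t) (phi t) (g t) => x y z x0; field; rewrite gt_eqF.
apply: (le_trans hold); rewrite mulrC EFinM; apply: lee_pmul.
- exact: poweR_ge0.
- exact: poweR_ge0.
- apply: (@le_trans _ _ (((c `^ r)%:E) `^ r^-1)%E).
    apply: le_poweR; first by rewrite invr_ge0 ltW.
      apply: integral_ge0 => t /EP t0; rewrite lee_fin.
      by apply: mulr_ge0; [rewrite invr_ge0 ltW|exact: powR_ge0].
    apply: le_trans h; apply: (ge0_subset_integral _ mE mD).
    + exact: measurable_bound_integrand.
    + exact: bound_integrand_ge0.
    + exact: ED.
  by rewrite poweR_EFin lee_fin -powRrM (mulfV (negbT (gt_eqF r0))) powRr1.
- rewrite -poweR_EFin; apply: le_poweR hM; first by rewrite invr_ge0 ltW.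
  exact: I0.
Qed.

End weighted_bound_theory.

(** * The kernel min(1, t/s) *)

Section kernel.
Context {R : realType}.
Local Notation D0 := (`]0, +oo[%classic : set (Leb R)).
Variables (w W : R -> R).
Hypothesis mw : measurable_fun D0 (w : Leb R -> R).
Hypothesis w0 : forall t : R, 0 < t -> 0 < w t.
Hypothesis sw : slow w.
Hypothesis WE : forall x : R, 0 < x ->
  (\int[leb R]_(t in `]0%R, x[) (t^-1 * w t)%:E = (W x)%:E)%E.
Hypothesis Woo : forall c : R, exists2 x : R, 0 < x & c < W x.

Let W0 := primitive_gt0 mw w0 sw WE.
Let Wsurj := primitive_surj mw w0 sw WE Woo.

Let splitD (t : R) : 0 < t -> D0 = `]0, t[%classic `|` `[t, +oo[%classic :> set R.
Proof.
move=> t0; apply/seteqP; split=> s /=; rewrite !in_itv /= !andbT.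
  by move=> s0; case: (ltP s t) => st; [left|right]; rewrite ?s0.
by move=> [/andP[]//|]; exact: lt_le_trans.
Qed.

Let integral_split (f : R -> R) (t a b : R) : 0 < t ->
    measurable_fun D0 (f : Leb R -> R) -> (forall s : R, 0 < s -> 0 <= f s) ->
    (\int[leb R]_(s in `]0%R, t[) (f s)%:E <= a%:E)%E ->
    (\int[leb R]_(s in `[t, +oo[) (f s)%:E <= b%:E)%E ->
  (\int[leb R]_(s in D0) (f s)%:E <= (a + b)%:E)%E.
Proof.
move=> t0 mf f0 fa fb; rewrite (splitD t0).
rewrite (ge0_integral_setU _ (measurable_leb_itv _) (measurable_leb_itv _)).
- by rewrite EFinD leeD.
- by rewrite -(splitD t0); exact/measurable_EFinP.
- by rewrite -(splitD t0) => s /=; rewrite in_itv /= andbT => s0; rewrite lee_fin f0.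
- apply/disj_setPS => s /=; rewrite !in_itv /= andbT => -[/andP[_ st] ts].
  by rewrite ltNge ts in st.
Qed.

Lemma measurable_kernel_l (t : R) :
  measurable_fun D0 ((fun s => Num.min 1 (t / s)) : Leb R -> R).
Proof.
apply: measurable_minr; first exact: measurable_cst.
by apply: measurable_funM; [exact: measurable_cst|exact: measurable_inv_pos].
Qed.

Lemma measurable_kernel_r (s : R) :
  measurable_fun D0 ((fun t => Num.min 1 (t / s)) : Leb R -> R).
Proof.
apply: measurable_minr; first exact: measurable_cst.
apply: measurable_funM; last exact: measurable_cst.
by apply: measurable_fun_leb => //; exact: measurable_id.
Qed.

Let min_ge0 (s t : R) : 0 < s -> 0 < t -> 0 <= Num.min 1 (t / s).
Proof. by move=> s0 t0; rewrite le_min ler01 divr_ge0// ltW. Qed.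

Let sub_head (t : R) : (`]0, t[%classic : set R) `<=` D0.
Proof. by move=> s /=; rewrite !in_itv /= => /andP[->]. Qed.

Let sub_tail (t : R) : 0 < t -> (`[t, +oo[%classic : set R) `<=` D0.
Proof. by move=> t0 s /=; rewrite !in_itv /= !andbT; exact: lt_le_trans. Qed.

Let D0P (t : R) : D0 t -> 0 < t.
Proof. by rewrite /= in_itv /= andbT. Qed.

Let half01 : 0 <= (2^-1 : R) < 1.
Proof. by rewrite invr_ge0 ler0n invf_lt1// ltr1n. Qed.

Let half_sub : 1 - 2^-1 = 2^-1 :> R.
Proof. by field. Qed.

Let half_add : 2^-1 + 2^-1 = 1 :> R.
Proof. by field. Qed.

Let powR_half (x : R) : 0 < x -> x = x `^ 2^-1 * x `^ 2^-1.
Proof.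
move=> x0; rewrite -powRD; last by rewrite (gt_eqF x0) implybT.
by rewrite half_add powRr1// ltW.
Qed.

(** For [s < t] the kernel is 1 and the integral is that of a power of [W].  For
    [s > t] slow variation gives [w(s) <= C (s/t)^(1/2) w(t)], so the factor
    [t/s] makes the integral converge, with value at most a multiple of
    [w(t) W(t)^(-d)], and [w <= C W]. *)
Lemma kernel_head (d : R) : 0 <= d < 1 -> exists2 C : R, 0 < C &
  forall t : R, 0 < t ->
  (\int[leb R]_(s in D0) (Num.min 1 (t / s) * (s^-1 * w s * W s `^ (- d)))%:E <=
   (C * W t `^ (1 - d))%:E)%E.
Proof.
move=> d01; have /andP[d0 _] := d01.
have [C1 C10 h1] := primitive_head mw w0 W0 WE Wsurj d01.
have half0 : 0 < 2^-1 :> R by rewrite invr_gt0.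
have [C2 C20 h2] := power_integral_tail half0.
have [C3 C30 h3] := sw half0.
have [G G0 hG] := density_le_primitive mw w0 sw WE.
exists (C1 + C3 * C2 * G); first by rewrite addr_gt0// !mulr_gt0.
move=> t t0; have Wt0 := W0 t0; rewrite mulrDl.
have mf := measurable_density_primitive mw w0 W0 WE (- d).
have mkf := measurable_funM (measurable_kernel_l t) mf.
have f0 s : 0 < s -> 0 <= s^-1 * w s * W s `^ (- d).
  by move=> s0; rewrite !mulr_ge0 ?powR_ge0 ?invr_ge0 ?(ltW s0) ?(ltW (w0 s0)).
apply: (integral_split t0) => //.
- by move=> s s0; rewrite mulr_ge0 ?min_ge0 ?f0.
- apply: le_trans (h1 t t0); apply: (ge0_le_integral _ (measurable_leb_itv _)).
  + by move=> s /sub_head/D0P s0; rewrite lee_fin mulr_ge0 ?min_ge0 ?f0.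
  + by apply/measurable_EFinP; exact: (measurable_funS (measurable_leb_itv _) (@sub_head t) mkf).
  + by apply/measurable_EFinP; exact: (measurable_funS (measurable_leb_itv _) (@sub_head t) mf).
  + move=> s /sub_head/D0P s0; rewrite lee_fin ler_piMl ?f0//.
    by rewrite ge_min lexx.
- have mp : measurable_fun (`[t, +oo[ : set (Leb R))
      (fun x : Leb R => (x `^ (- (1 + 2^-1)))%:E).
    apply/measurable_EFinP; apply: measurable_fun_leb; first exact: measurable_itv.
    by apply: (measurable_funS measurableT) => //; exact: measurable_powR.
  pose c := C3 * w t * W t `^ (- d) * t `^ (2^-1).
  have c0 : 0 <= c by rewrite !mulr_ge0 ?powR_ge0 ?(ltW C30) ?(ltW (w0 t0)).
  apply: (@le_trans _ _ (\int[leb R]_(s in `[t, +oo[)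
      (c%:E * (s `^ (- (1 + 2^-1)))%:E))%E).
    apply: (ge0_le_integral _ (measurable_leb_itv _)).
    + by move=> s /(sub_tail t0)/D0P s0; rewrite lee_fin mulr_ge0 ?min_ge0 ?f0.
    + by apply/measurable_EFinP; exact: (measurable_funS (measurable_leb_itv _) (sub_tail t0) mkf).
    + exact: measurable_funeM.
    + move=> s /=; rewrite in_itv /= andbT => ts; have s0 := lt_le_trans t0 ts.
      rewrite -EFinM lee_fin.
      apply: (@le_trans _ _ (t / s * (s^-1 * (C3 * (s / t) `^ 2^-1 * w t) * W t `^ (- d)))).
        apply: ler_pM; rewrite ?min_ge0 ?f0//; first by rewrite ge_min lexx orbT.
        apply: ler_pM; rewrite ?powR_ge0 ?mulr_ge0 ?invr_ge0 ?(ltW s0) ?(ltW (w0 s0))//.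
          by rewrite ler_pM2l ?invr_gt0//; exact: (h3 t s t0 ts).2.
        rewrite !powRN lef_pV2 ?posrE ?powR_gt0 ?W0//.
        rewrite ge0_ler_powR// ?nnegrE ?(ltW (W0 _))//.
        exact: (primitive_mono mw w0 WE).
      rewrite le_eqVlt; apply/orP; left; apply/eqP.
      have st2 : (s / t) `^ 2^-1 = s `^ 2^-1 / t `^ 2^-1.
        by rewrite powRM ?invr_ge0 ?(ltW s0) ?(ltW t0)// -[t^-1](powR_inv1 (ltW t0)) -powRrM mulN1r powRN.
      have s32 : s `^ (- (1 + 2^-1)) = (s * s `^ 2^-1)^-1.
        by rewrite powRN powRD ?powRr1 ?(ltW s0)// (gt_eqF s0) implybT.
      have tt := powR_half t0; have ss := powR_half s0.
      rewrite /c s32 st2 {1}tt.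
      have := powR_gt0 2^-1 s0; have := powR_gt0 2^-1 t0.
      move: (t `^ 2^-1) (s `^ 2^-1) ss => x y ss x0 y0.
      rewrite ss; field.
      by rewrite !gt_eqF.
  rewrite (ge0_integralZl _ (measurable_leb_itv _) mp); last 2 first.
  + by move=> s _; rewrite lee_fin powR_ge0.
  + by rewrite lee_fin.
  apply: (@le_trans _ _ (c%:E * (C2 * t `^ (- 2^-1))%:E)%E).
    by rewrite lee_wpmul2l ?lee_fin// h2.
  rewrite -EFinM lee_fin /c.
  rewrite [leLHS](_ : _ = C3 * C2 * W t `^ (- d) * w t); last first.
    rewrite [t `^ (- _)]powRN; have := powR_gt0 2^-1 t0; move: (t `^ 2^-1) => x x0; field.
    by rewrite gt_eqF.
  rewrite addrC powRD ?(gt_eqF Wt0) ?implybT// powRr1 ?(ltW Wt0)//.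
  rewrite [leRHS](_ : _ = C3 * C2 * W t `^ (- d) * (G * W t)); last by ring.
  by rewrite ler_wpM2l ?hG// !mulr_ge0 ?powR_ge0// ltW.
Qed.

(** Dual to [kernel_head], with the two ranges exchanged.  Slow variation is now
    used for [w W^(-p)]. *)
Lemma kernel_tail (p : R) : 1 < p -> exists2 C : R, 0 < C &
  forall s : R, 0 < s ->
  (\int[leb R]_(t in D0) (Num.min 1 (t / s) * (t^-1 * w t * W t `^ (- p)))%:E <=
   (C * W s `^ (1 - p))%:E)%E.
Proof.
move=> p1; have p0 : 0 < p - 1 by rewrite subr_gt0.
have [C1 C10 h1] := primitive_tail mw w0 W0 WE Wsurj p0.
have half0 : 0 < 2^-1 :> R by rewrite invr_gt0.
have [C2 C20 h2] := power_integral_head half01.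
pose v t := w t * W t `^ (- p).
have v0 (t : R) : 0 < t -> 0 < v t by move=> t0; rewrite mulr_gt0 ?w0 ?powR_gt0 ?W0.
have sv : slow v.
  apply: slow_mul => //; first by move=> t t0; rewrite powR_gt0 ?W0.
  exact: (slow_powR _ W0 (slow_primitive mw w0 sw WE)).
have [C3 C30 h3] := sv _ half0.
have [G G0 hG] := density_le_primitive mw w0 sw WE.
exists (C3 * C2 * G + C1); first by rewrite addr_gt0// !mulr_gt0.
move=> s s0; have Ws0 := W0 s0; rewrite mulrDl.
have mf := measurable_density_primitive mw w0 W0 WE (- p).
have mkf := measurable_funM (measurable_kernel_r s) mf.
have f0 t : 0 < t -> 0 <= t^-1 * w t * W t `^ (- p).
  by move=> t0; rewrite !mulr_ge0 ?powR_ge0 ?invr_ge0 ?(ltW t0) ?(ltW (w0 t0)).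
apply: (integral_split s0) => //.
- by move=> t t0; rewrite mulr_ge0 ?min_ge0 ?f0.
- have mp : measurable_fun (`]0, s[ : set (Leb R))
      (fun x : Leb R => (x `^ (- 2^-1))%:E).
    apply/measurable_EFinP; apply: measurable_fun_leb; first exact: measurable_itv.
    by apply: (measurable_funS measurableT) => //; exact: measurable_powR.
  pose c := C3 * v s * (s `^ (2^-1) / s).
  have c0 : 0 <= c by rewrite !mulr_ge0 ?powR_ge0 ?invr_ge0 ?(ltW C30) ?(ltW (w0 s0)) ?(ltW s0).
  apply: (@le_trans _ _ (\int[leb R]_(t in `]0%R, s[)
      (c%:E * (t `^ (- 2^-1))%:E))%E).
    apply: (ge0_le_integral _ (measurable_leb_itv _)).
    + by move=> t /sub_head/D0P t0; rewrite lee_fin mulr_ge0 ?min_ge0 ?f0.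
    + by apply/measurable_EFinP; exact: (measurable_funS (measurable_leb_itv _) (@sub_head s) mkf).
    + exact: measurable_funeM.
    + move=> t /=; rewrite in_itv /= => /andP[t0 ts].
      rewrite -EFinM lee_fin.
      apply: (@le_trans _ _ (t / s * (t^-1 * (C3 * (s / t) `^ 2^-1 * v s)))).
        rewrite -(mulrA t^-1) -/(v t).
        apply: ler_pM; rewrite ?min_ge0//; first by rewrite mulr_ge0 ?invr_ge0 ?(ltW t0) ?(ltW (v0 t t0)).
          by rewrite ge_min lexx orbT.
        by rewrite ler_pM2l ?invr_gt0//; exact: (h3 t s t0 (ltW ts)).1.
      rewrite le_eqVlt; apply/orP; left; apply/eqP; rewrite /c.
      rewrite powRM ?invr_ge0 ?(ltW s0) ?(ltW t0)// -[t^-1](powR_inv1 (ltW t0)) -powRrM mulN1r.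
      by rewrite (powR_inv1 (ltW t0)); field; rewrite !gt_eqF.
  rewrite (ge0_integralZl _ (measurable_leb_itv _) mp); last 2 first.
  + by move=> t _; rewrite lee_fin powR_ge0.
  + by rewrite lee_fin.
  apply: (@le_trans _ _ (c%:E * (C2 * s `^ (1 - 2^-1))%:E)%E).
    by rewrite lee_wpmul2l ?lee_fin// h2.
  rewrite -EFinM lee_fin /c half_sub.
  rewrite [leLHS](_ : _ = C3 * C2 * W s `^ (- p) * w s); last first.
    have E : s `^ 2^-1 / s * s `^ 2^-1 = 1.
      by rewrite mulrAC -powR_half// divff// gt_eqF.
    rewrite [LHS](_ : _ = C3 * C2 * v s * (s `^ 2^-1 / s * s `^ 2^-1)); last by ring.
    by rewrite E /v; ring.
  rewrite addrC powRD ?(gt_eqF Ws0) ?implybT// powRr1 ?(ltW Ws0)//.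
  rewrite [leRHS](_ : _ = C3 * C2 * W s `^ (- p) * (G * W s)); last by ring.
  by rewrite ler_wpM2l ?hG// !mulr_ge0 ?powR_ge0// ltW.
- apply: (@le_trans _ _ (C1 * W s `^ (- (p - 1)))%:E); last by rewrite opprB.
  apply: le_trans (h1 s s0); apply: (ge0_le_integral _ (measurable_leb_itv _)).
  + by move=> t /(sub_tail s0)/D0P t0; rewrite lee_fin mulr_ge0 ?min_ge0 ?f0.
  + by apply/measurable_EFinP; exact: (measurable_funS (measurable_leb_itv _) (sub_tail s0) mkf).
  + rewrite addrC subrK.
    by apply/measurable_EFinP; exact: (measurable_funS (measurable_leb_itv _) (sub_tail s0) mf).
  + move=> t /(sub_tail s0)/D0P t0; rewrite addrC subrK lee_fin ler_piMl ?f0//.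
    by rewrite ge_min lexx.
Qed.

End kernel.

Section tonelli.
Context {R : realType}.
Local Notation D0 := (`]0, +oo[%classic : set (Leb R)).

(** Tonelli's theorem for the kernel, together with the measurability of both
    inner integrals. *)
Lemma tonelli_kernel (al be : R -> R) :
    measurable_fun D0 (al : Leb R -> R) -> measurable_fun D0 (be : Leb R -> R) ->
    (forall t : R, 0 < t -> 0 <= al t) -> (forall t : R, 0 < t -> 0 <= be t) ->
  measurable_fun D0 (fun t : Leb R => ((al t)%:E *
     \int[leb R]_(s in D0) (Num.min 1 ((t : R) / s) * be s)%:E)%E) /\
  measurable_fun D0 (fun s : Leb R => ((be s)%:E *
     \int[leb R]_(t in D0) (Num.min 1 ((t : R) / s) * al t)%:E)%E) /\
  (\int[leb R]_(t in D0) ((al t)%:E * \int[leb R]_(s in D0) (Num.min 1 (t / s) * be s)%:E) =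
   \int[leb R]_(s in D0) ((be s)%:E * \int[leb R]_(t in D0) (Num.min 1 (t / s) * al t)%:E))%E.
Proof.
move=> mal mbe al0 be0.
have mD := @measurable_leb_itv R `]0, +oo[.
have D0P (t : R) : D0 t -> 0 < t by rewrite /= in_itv /= andbT.
have kmin (t s : R) : 0 < t -> 0 < s -> 0 <= Num.min 1 (t / s).
  by move=> t0 s0; rewrite le_min ler01 divr_ge0// ltW.
(* Everything is extended by 0 from the quadrant to the plane. *)
pose f (z : Leb R * Leb R) : \bar R := (Num.min 1 ((z.1 : R) * ((@GRing.inv R) \_ D0) z.2) *
  ((al \_ D0) z.1 * (be \_ D0) z.2))%:E.
have mid : measurable_fun setT (id : Leb R -> R).
  by apply: measurable_fun_leb => //; exact: measurable_id.
have m1 (g : Leb R -> R) : measurable_fun setT g ->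
    measurable_fun setT (fun z : Leb R * Leb R => g z.1).
  by move=> mg; exact: (measurableT_comp mg measurable_fst).
have m2 (g : Leb R -> R) : measurable_fun setT g ->
    measurable_fun setT (fun z : Leb R * Leb R => g z.2).
  by move=> mg; exact: (measurableT_comp mg measurable_snd).
have mr (g : Leb R -> R) : measurable_fun D0 g -> measurable_fun setT (g \_ D0).
  by move=> mg; apply/(measurable_restrictT _ mD).
have mf : measurable_fun setT f.
  apply/measurable_EFinP; apply: measurable_funM.
    apply: measurable_minr; first exact: measurable_cst.
    apply: measurable_funM; first exact: (m1 _ mid).
    exact: (m2 _ (mr _ measurable_inv_pos)).
  by apply: measurable_funM; [exact: (m1 _ (mr _ mal))|exact: (m2 _ (mr _ mbe))].
have f0 z : (0 <= f z)%E.
  rewrite lee_fin /f /patch; case: ifPn => [/set_mem/D0P z2|_]; last by rewrite !mulr0.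
  case: ifPn => [/set_mem/D0P z1|_]; last by rewrite mul0r mulr0.
  by apply: mulr_ge0; [exact: kmin|rewrite mulr_ge0 ?al0 ?be0].
have fin1 (t : R) : 0 < t -> (\int[leb R]_s f (t, s) =
    (al t)%:E * \int[leb R]_(s in D0) (Num.min 1 (t / s) * be s)%:E)%E.
  move=> t0; have tD : (t : Leb R) \in D0 by rewrite mem_set//= in_itv /= t0.
  rewrite -(ge0_integralZl _ mD); last 3 first.
  - apply/measurable_EFinP; apply: measurable_funM mbe.
    apply: measurable_minr; first exact: measurable_cst.
    by apply: measurable_funM; [exact: measurable_cst|exact: measurable_inv_pos].
  - move=> s /D0P s0; rewrite lee_fin; apply: mulr_ge0; [exact: kmin|exact: be0].
  - by rewrite lee_fin al0.
  rewrite [RHS]integral_mkcond; apply: eq_integral => s _.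
  rewrite /f /= /patch /= tD; case: ifPn => _; last by rewrite !mulr0.
  by rewrite -EFinM; congr (_%:E); ring.
have fin2 (s : R) : 0 < s -> (\int[leb R]_t f (t, s) =
    (be s)%:E * \int[leb R]_(t in D0) (Num.min 1 (t / s) * al t)%:E)%E.
  move=> s0; have sD : (s : Leb R) \in D0 by rewrite mem_set//= in_itv /= s0.
  rewrite -(ge0_integralZl _ mD); last 3 first.
  - apply/measurable_EFinP; apply: measurable_funM mal.
    exact: measurable_kernel_r.
  - move=> t /D0P t0; rewrite lee_fin; apply: mulr_ge0; [exact: kmin|exact: al0].
  - by rewrite lee_fin be0.
  rewrite [RHS]integral_mkcond; apply: eq_integral => t _.
  rewrite /f /= /patch /= sD; case: ifPn => _; last by rewrite mul0r !mulr0.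
  by rewrite -EFinM; congr (_%:E); ring.
split; [|split].
- apply: (eq_measurable_fun (fun t : Leb R => \int[leb R]_s f (t, s))%E).
    by move=> t /set_mem/D0P t0; exact: fin1.
  apply: (measurable_funS measurableT (@subsetT _ _)).
  exact: (measurable_fun_fubini_tonelli_F f mf f0).
- apply: (eq_measurable_fun (fun s : Leb R => \int[leb R]_t f (t, s))%E).
    by move=> s /set_mem/D0P s0; exact: fin2.
  apply: (measurable_funS measurableT (@subsetT _ _)).
  exact: (measurable_fun_fubini_tonelli_G f mf f0).
- have := @fubini_tonelli _ _ _ _ R (leb R) (leb R) f mf f0.
  move=> E; transitivity (\int[leb R]_t \int[leb R]_s f (t, s))%E.
    rewrite [LHS]integral_mkcond; apply: eq_integral => t _.
    rewrite /patch /=; case: ifPn => [/set_mem/D0P t0|tD]; first by rewrite fin1.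
    rewrite (eq_integral (cst 0%E)) ?integral0// => s _.
    by rewrite /f /patch /= (negbTE tD) mul0r mulr0.
  rewrite E [RHS]integral_mkcond; apply: eq_integral => s _.
  rewrite /patch /=; case: ifPn => [/set_mem/D0P s0|sD]; first by rewrite fin2.
  rewrite (eq_integral (cst 0%E)) ?integral0// => t _.
  by rewrite /f /patch /= (negbTE sD) !mulr0.
Qed.

End tonelli.

(** * Representations and the norm of a J-space *)

Section representation.
Context {R : realType} {Z : topologicalLmodType R} (C : compatible_couple Z).
Local Notation D0 := (`]0, +oo[%classic : set (Leb R)).

Lemma space0_in_sum (x : space0 C) : emb0 C x \in sum_pred C.
Proof.
by apply/sum_predP; exists (x, 0); rewrite /decomp /= linear0 addr0.
Qed.

(** Representations are required to converge in X0 + X1, but every integral met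
    here converges in X0; this map transports it. *)
Definition space0_to_sum (x : space0 C) : sum_space C := SumSpace (space0_in_sum x).

Lemma space0_to_sum_linear : linear space0_to_sum.
Proof. by move=> a x y; apply: val_inj; rewrite /= linearP. Qed.

HB.instance Definition _ :=
  GRing.isLinear.Build R (space0 C) (sum_space C) *:%R space0_to_sum
    space0_to_sum_linear.

Lemma ler_norm_space0_to_sum (x : space0 C) : `|space0_to_sum x| <= `|x|.
Proof.
have -> : `|x| = `|x| + `|0 : space1 C| by rewrite normr0 addr0.
apply: ge_inf; first by exists 0 => _ [p _ <-]; rewrite addr_ge0.
by exists (x, 0) => //; rewrite /decomp /= linear0 addr0.
Qed.

Lemma cap_to_sumE (f : cap C) : cap_to_sum f = space0_to_sum (cap0 f).
Proof. exact: val_inj. Qed.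

Lemma strongly_measurable_scale_inv (V : normedModType R) (u : R -> V) :
    strongly_measurable (leb R) D0 u ->
  strongly_measurable (leb R) D0 (fun s : Leb R => (s^-1 : R) *: u s).
Proof.
move=> su; apply: (strongly_measurableZ (measurable_leb_itv _) _ su).
exact: measurable_inv_pos.
Qed.

Let scale_cap_to_sumE (u : R -> cap C) :
  (fun s : Leb R => (s^-1 : R) *: cap_to_sum (u s)) =
  space0_to_sum \o (fun s : Leb R => (s^-1 : R) *: cap0 (u s)).
Proof. by apply/funext => s /=; rewrite cap_to_sumE linearZ. Qed.

Let bochner_space0_to_sum (h : Leb R -> space0 C) (L : space0 C) :
  is_bochner_integral (leb R) D0 h L ->
  is_bochner_integral (leb R) D0 (space0_to_sum \o h) (space0_to_sum L).
Proof.
have le1 x : `|space0_to_sum x| <= 1 * `|x| by rewrite mul1r ler_norm_space0_to_sum.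
exact: (bochner_integral_linear (measurable_leb_itv _)
  (@completed_lebesgue_measure_is_complete R) le1).
Qed.

(** When the integral converges absolutely in X0, its value there is the element
    represented, because X0 embeds continuously in X0 + X1 and Bochner integrals
    are unique. *)
Lemma J_represents_bochner (u : R -> cap C) (f : Z) :
    (\int[leb R]_(s in D0) `|(s^-1 : R) *: cap0 (u s)|%:E < +oo)%E ->
    J_represents u f -> exists2 L, emb0 C L = f &
    is_bochner_integral (leb R) D0 (fun s : Leb R => (s^-1 : R) *: cap0 (u s)) L.
Proof.
move=> fin [su [F <- bF]].
have mD : measurable D0 := measurable_leb_itv _.
have cmp := @completed_lebesgue_measure_is_complete R.
have su0 : strongly_measurable (leb R) D0 (fun s : Leb R => (s^-1 : R) *: cap0 (u s)).
  have h := strongly_measurable_comp (@cap0_continuous _ _ C) su.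
  exact: (strongly_measurable_scale_inv h).
have [L bL] := bochner_integral_exists mD cmp su0 fin.
exists L => //; rewrite -[LHS]/(sum_val (space0_to_sum L)); congr sum_val.
apply: (bochner_integral_unique mD cmp _ bF).
by rewrite scale_cap_to_sumE; exact: (bochner_space0_to_sum bL).
Qed.

Lemma bochner_J_represents (u : R -> cap C) (L : space0 C) :
    strongly_measurable (leb R) D0 u ->
    is_bochner_integral (leb R) D0 (fun s : Leb R => (s^-1 : R) *: cap0 (u s)) L ->
  J_represents u (emb0 C L).
Proof.
move=> su bL; split=> //; exists (space0_to_sum L) => //.
by rewrite scale_cap_to_sumE; exact: (bochner_space0_to_sum bL).
Qed.

End representation.

Section transfer.
Context {R : realType} {Z : topologicalLmodType R}.
Local Notation D0 := (`]0, +oo[%classic : set (Leb R)).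

Lemma same_spaceI (E F : @normed_subspace R Z) (c C : R) : 0 < c -> 0 < C ->
    (forall f, carrier E f ->
       carrier F f /\ (subnorm F f <= C%:E * subnorm E f)%E) ->
    (forall f, carrier F f ->
       carrier E f /\ (subnorm E f <= c%:E * subnorm F f)%E) ->
  same_space E F.
Proof.
move=> c0 C0 EF FE; split.
  by apply/seteqP; split=> f; [move=> /EF[]|move=> /FE[]].
exists c^-1, C; split=> //; first by rewrite invr_gt0.
move=> f Ef; have [Ff h] := EF f Ef; split=> //.
have [_ h'] := FE f Ff.
apply: le_trans (lee_wpmul2l _ h') _; first by rewrite lee_fin invr_ge0 ltW.
by rewrite muleA -EFinM mulVf ?gt_eqF// mul1e.
Qed.

Lemma weighted_norm_ge0 (q : \bar R) (v phi : R -> R) :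
  (0 <= weighted_norm q v phi)%E.
Proof. exact: Lnorm_ge0. Qed.

Lemma J_functional_ge0 (X : compatible_couple Z) (f : cap X) (t : R) :
  0 <= J_functional f t.
Proof. by rewrite /J_functional le_max normr_ge0. Qed.

Lemma J_norm_leP (X : compatible_couple Z) (q : \bar R) (v : R -> R) (f : Z)
    (c : R) : (1 < q)%E -> (forall t : R, 0 < t -> 0 <= v t) -> 0 < c ->
    (J_norm X q v f < c%:E)%E -> exists2 u : R -> cap X, J_represents u f &
      weighted_bound q v (fun t => J_functional (u t) t) c.
Proof.
move=> q1 v0 c0 /ereal_inf_lt[_ [u uf <-]] uc; exists u => //.
apply/weighted_norm_leP => //; last exact: ltW.
- exact: ltW.
- by move=> t t0; apply: mulr_ge0; [exact: v0|exact: J_functional_ge0].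
Qed.

Lemma J_norm_le (X : compatible_couple Z) (q : \bar R) (v : R -> R) (f : Z)
    (u : R -> cap X) (c : R) :
    (1 < q)%E -> (forall t : R, 0 < t -> 0 <= v t) -> 0 <= c ->
    J_represents u f -> weighted_bound q v (fun t => J_functional (u t) t) c ->
  (J_norm X q v f <= c%:E)%E.
Proof.
move=> q1 v0 c0 uf uc; apply: le_trans (ereal_inf_lbound _) _.
  by exists u.
apply/weighted_norm_leP => // t t0.
by apply: mulr_ge0; [exact: v0|exact: J_functional_ge0].
Qed.

Lemma J_norm_ge0 (X : compatible_couple Z) (q : \bar R) (v : R -> R) (f : Z) :
  (0 <= J_norm X q v f)%E.
Proof. by apply: le_ereal_inf_tmp => _ [u _ <-]; exact: weighted_norm_ge0. Qed.

(** Lets an inequality between norms be checked on real bounds of the larger norm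
    only. *)
Lemma lee_mul_approx (x y : \bar R) (C : R) : 0 < C -> (0 <= x)%E -> (x < +oo)%E ->
    (forall c : R, 0 < c -> (x < c%:E)%E -> (y <= (C * c)%:E)%E) ->
  (y <= C%:E * x)%E.
Proof.
move=> C0; case: x => [x||]// x0 _ h; rewrite -EFinM.
apply/lee_addgt0Pr => e e0; rewrite -EFinD.
have -> : C * x + e = C * (x + e / C) by rewrite mulrDr mulrCA divff ?gt_eqF// mulr1.
have eC : 0 < e / C by rewrite divr_gt0.
by apply: h; rewrite ?lte_fin ?ltr_pwDr// ltrDl.
Qed.

(** A J-norm is an infimum over representations, so it suffices to turn each
    representation for one space into one for the other with a bound larger by a
    fixed factor. *)
Lemma J_space_transfer (X Y : compatible_couple Z) (q : \bar R) (v v' : R -> R)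
    (C : R) : (1 < q)%E -> (forall t : R, 0 < t -> 0 <= v t) ->
    (forall t : R, 0 < t -> 0 <= v' t) -> 0 < C ->
    (forall (u : R -> cap X) f c, 0 < c -> J_represents u f ->
      weighted_bound q v (fun t => J_functional (u t) t) c ->
      exists2 u' : R -> cap Y, J_represents u' f &
        weighted_bound q v' (fun t => J_functional (u' t) t) (C * c)) ->
  forall f, carrier (J_space X q v) f -> carrier (J_space Y q v') f /\
    (subnorm (J_space Y q v') f <= C%:E * subnorm (J_space X q v) f)%E.
Proof.
move=> q1 v0 v'0 C0 H f [_ Jf].
have key c : 0 < c -> (J_norm X q v f < c%:E)%E ->
    (exists u' : R -> cap Y, J_represents u' f) /\ (J_norm Y q v' f <= (C * c)%:E)%E.
  move=> c0 /(J_norm_leP q1 v0 c0)[u uf uc]; have [u' uf' uc'] := H u f c c0 uf uc.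
  split; first by exists u'.
  by apply: (J_norm_le q1 v'0 _ uf' uc'); apply: mulr_ge0; exact: ltW.
have main : (J_norm Y q v' f <= C%:E * J_norm X q v f)%E.
  apply: (lee_mul_approx C0 _ Jf); first exact: J_norm_ge0.
  by move=> c c0 /(key c c0)[].
split=> //; split.
  have xr : J_norm X q v f \is a fin_num by rewrite ge0_fin_numE ?J_norm_ge0.
  have x0 : 0 <= fine (J_norm X q v f) by rewrite fine_ge0 ?J_norm_ge0.
  have [||//] := key (fine (J_norm X q v f) + 1); first by rewrite ltr_pwDr.
  by rewrite -[X in (X < _)%E](fineK xr) lte_fin ltrDl.
apply: le_lt_trans main _.
have /fineK <- : J_norm X q v f \is a fin_num by rewrite ge0_fin_numE ?J_norm_ge0.
by rewrite -EFinM ltry.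
Qed.

End transfer.

(** * Folding a representation onto the unit interval *)

Section fold.
Context {R : realType} {Z : topologicalLmodType R} (C : compatible_couple Z).
Local Notation D0 := (`]0, +oo[%classic : set (Leb R)).
Local Notation E1 := (`]-oo, (1 : R)[%classic : set (Leb R)).

Lemma ler_norm_cap0 (f : cap C) : `|cap0 f| <= `|f|.
Proof. by rewrite norm_capE le_max lexx. Qed.

Lemma ler_norm_cap1 (f : cap C) : `|cap1 f| <= `|f|.
Proof. by rewrite norm_capE le_max lexx orbT. Qed.

Let memE1 (s : R) : ((s : Leb R) \in E1) = (s < 1).
Proof. by rewrite mem_setE. Qed.

Lemma integral_head_indicator :
  (\int[leb R]_(s in D0) (if (s : R) < 1 then s^-1 * s else 0)%:E = 1%:E)%E.
Proof.
have mD : measurable D0 := measurable_leb_itv _.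
transitivity (\int[leb R]_(s in D0) ((cst 1%E) \_ (`]0%R, 1%R[%classic : set (Leb R))) s)%E.
  apply: eq_integral => s /set_mem; rewrite /= in_itv /= andbT => s0.
  rewrite patchE mem_setE /= in_itv /= s0 /=.
  by case: ifP => // _; rewrite mulVf ?gt_eqF.
rewrite -integral_mkcondr (setIidr _); last first.
  by move=> s; rewrite /= !in_itv /= andbT => /andP[].
rewrite integral_cst ?mul1e; last exact: measurable_leb_itv.
by have := leb_itvE (`]0, 1[ : interval R); rewrite /= lte_fin ltr01 sube0 => ->.
Qed.

Lemma eq_bochner_integral (V : normedModType R) (u v : Leb R -> V) (l : V) :
  u = v -> is_bochner_integral (leb R) D0 u l -> is_bochner_integral (leb R) D0 v l.
Proof. by move=> ->. Qed.

(** The part of [u] beyond 1 has its integral [g] in X0 /\ X1.  Over (0, 1) the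
    function [s g] has the same integral [g] against [ds/s], so it can replace
    that part. *)
Lemma fold_representation (u : R -> cap C) (psi : R -> R) (N : R) (L : space0 C) :
    strongly_measurable (leb R) D0 u ->
    measurable_fun D0 (psi : Leb R -> R) ->
    (forall s : R, 0 < s -> s < 1 -> `|cap0 (u s)| <= psi s) ->
    (forall s : R, 1 <= s -> `|u s| <= psi s) ->
    (\int[leb R]_(s in D0) (s^-1 * psi s)%:E <= N%:E)%E ->
    is_bochner_integral (leb R) D0 (fun s : Leb R => (s^-1 : R) *: cap0 (u s)) L ->
  exists2 g : cap C, `|g| <= N &
    strongly_measurable (leb R) D0
      ((fun s : R => if s < 1 then u s + s *: g else 0) : Leb R -> cap C) /\
    is_bochner_integral (leb R) D0 (fun s : Leb R => (s^-1 : R) *: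
      cap0 (if (s : R) < 1 then u s + (s : R) *: g else 0)) L.
Proof.
move=> su mpsi psi0 psi1 psiN bL.
have mD : measurable D0 := measurable_leb_itv _.
have cmp := @completed_lebesgue_measure_is_complete R.
have mE1 : measurable E1 := measurable_leb_itv _.
have D0P (s : R) : D0 s -> 0 < s by rewrite /= in_itv /= andbT.
have mb : measurable_fun D0 (fun s : Leb R => (s^-1 * psi s)%:E).
  apply/measurable_EFinP; apply: measurable_funM; last exact: mpsi.
  exact: measurable_inv_pos.
have sus := strongly_measurable_scale_inv su.
have bnd (V : normedModType R) (w : Leb R -> V) :
    strongly_measurable (leb R) D0 w ->
    (forall s : R, 0 < s -> `|w s| <= s^-1 * psi s) ->
    (\int[leb R]_(s in D0) `|w s|%:E <= N%:E)%E.
  move=> sw wle.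
  apply: le_trans psiN; apply: (ge0_le_integral _ mD).
  - by move=> s _; rewrite lee_fin.
  - by apply/measurable_EFinP; exact: (strongly_measurable_norm cmp sw).
  - exact: mb.
  - by move=> s Ds; rewrite lee_fin; exact: (wle _ (D0P _ Ds)).
have scale_le (V : normedModType R) (s : R) (x : V) : 0 < s -> `|x| <= psi s ->
    `|s^-1 *: x| <= s^-1 * psi s.
  by move=> s0 h; rewrite normrZ gtr0_norm ?invr_gt0// ler_pM2l ?invr_gt0.
have psi_ge0 (s : R) : 0 < s -> 0 <= s^-1 * psi s.
  move=> s0; apply: mulr_ge0; first by rewrite invr_ge0 ltW.
  have [s1|s1] := ltP s 1; first exact: le_trans (psi0 s s0 s1).
  exact: le_trans (psi1 s s1).
(* [u1] is integrable in X0 /\ X1, [u0] only in X0. *)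
pose u1 (s : Leb R) := if (s : R) < 1 then 0 else (s^-1 : R) *: u s.
pose u0 (s : Leb R) := if (s : R) < 1 then (s^-1 : R) *: cap0 (u s) else 0.
have su1 : strongly_measurable (leb R) D0 u1.
  have := strongly_measurable_mem mD (measurableC mE1) sus.
  congr (strongly_measurable _ _ _); apply/funext => s.
  by rewrite /u1 in_setC memE1; case: (_ < _).
have su0' := strongly_measurable_scale_inv (strongly_measurable_comp (@cap0_continuous _ _ C) su).
have su0 : strongly_measurable (leb R) D0 u0.
  have := strongly_measurable_mem mD mE1 su0'.
  congr (strongly_measurable _ _ _); apply/funext => s.
  by rewrite /u0 memE1.
have i1 : (\int[leb R]_(s in D0) `|u1 s|%:E <= N%:E)%E.
  apply: (bnd _ _ su1) => s s0; rewrite /u1; case: ltP => s1.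
    by rewrite normr0; exact: psi_ge0.
  by apply: scale_le => //; exact: psi1.
have i0 : (\int[leb R]_(s in D0) `|u0 s|%:E <= N%:E)%E.
  apply: (bnd _ _ su0) => s s0; rewrite /u0; case: ltP => s1.
    by apply: scale_le => //; exact: psi0.
  by rewrite normr0; exact: psi_ge0.
have [g bg] := bochner_integral_exists mD cmp su1 (le_lt_trans i1 (ltry N)).
have [l bl] := bochner_integral_exists mD cmp su0 (le_lt_trans i0 (ltry N)).
have cle (x : cap C) : `|cap0 x| <= 1 * `|x| by rewrite mul1r ler_norm_cap0.
have bg0 := bochner_integral_linear mD cmp cle bg.
have Ls : l + cap0 g = L.
  apply: (bochner_integral_unique mD cmp _ bL).
  apply: (eq_bochner_integral _ (bochner_integralD mD cmp bl bg0)).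
  apply/funext => s /=; rewrite /u0 /u1; case: ifP => _.
    by rewrite linear0 addr0.
  by rewrite linearZ add0r.
have mid : measurable_fun D0 ((fun s => s) : Leb R -> R).
  by apply: measurable_fun_leb; [exact: measurable_itv|exact: measurable_id].
have mhead : measurable_fun D0
    ((fun s => if s < 1 then s^-1 * s else 0) : Leb R -> R).
  have -> : ((fun s => if s < 1 then s^-1 * s else 0) : Leb R -> R) =
      ((fun s => s^-1 * s) : Leb R -> R) \_ E1.
    by apply/funext => s; rewrite patchE memE1.
  apply/(measurable_restrict _ mE1 mD).
  apply: (measurable_funS mD); first by move=> s [].
  by apply: measurable_funM; [exact: measurable_inv_pos|exact: mid].
have hfin : (\int[leb R]_(s in D0) (if (s : R) < 1 then s^-1 * s else 0)%:E < +oo)%E.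
  by rewrite integral_head_indicator ltry.
have head0 (s : Leb R) : D0 s -> 0 <= (if (s : R) < 1 then s^-1 * s else 0).
  by move=> /D0P s0; case: ifP => // _; rewrite mulVf ?gt_eqF.
have bh := bochner_integralZ mD cmp (cap0 g) mhead head0 hfin.
exists g.
  rewrite -lee_fin; apply: le_trans i1.
  exact: (bochner_integral_norm_le mD cmp bg).
split.
  have sg := strongly_measurableZ mD mid
    (strongly_measurable_finite (leb R) (finite_valued_cst g mD)).
  have := strongly_measurable_mem mD mE1 (strongly_measurableD su sg).
  congr (strongly_measurable _ _ _); apply/funext => s.
  by rewrite memE1.
rewrite -Ls.
have h1 : (\int[leb R]_(x in D0) (if (x : R) < 1 then (x : R)^-1 * x else 0)) *: cap0 g = cap0 g.
  by rewrite /Rintegral integral_head_indicator scale1r.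
rewrite h1 in bh.
apply: (eq_bochner_integral _ (bochner_integralD mD cmp bl bh)).
apply/funext => s /=; rewrite /u0; case: ifP => _.
  by rewrite -scalerA -scalerDr.
by rewrite scale0r addr0; apply/esym; exact: scaler0.
Qed.

End fold.

Section fold_bound.
Context {R : realType}.
Local Notation D0 := (`]0, +oo[%classic : set (Leb R)).
Let mD : measurable D0 := measurable_leb_itv _.
Let D0P (t : R) : D0 t -> 0 < t.
Proof. by rewrite /= in_itv /= andbT. Qed.

Lemma measurable_head (phi : R -> R) : measurable_fun D0 (phi : Leb R -> R) ->
  measurable_fun D0 ((fun t => if t < 1 then phi t else 0) : Leb R -> R).
Proof.
move=> mphi; have mE1 : measurable (`]-oo, (1 : R)[%classic : set (Leb R)).
  exact: measurable_leb_itv.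
have -> : ((fun t => if t < 1 then phi t else 0) : Leb R -> R) =
    (phi : Leb R -> R) \_ (`]-oo, (1 : R)[%classic : set (Leb R)).
  by apply/funext => s; rewrite patchE mem_setE.
apply/(measurable_restrict _ mE1 mD).
by apply: (measurable_funS mD) => // s [].
Qed.

Lemma measurable_leb_id : measurable_fun D0 ((fun t => t) : Leb R -> R).
Proof.
by apply: measurable_fun_leb; [exact: measurable_itv|exact: measurable_id].
Qed.

(** By slow variation [v(t) t] is at most a multiple of [t^(1/2)] near 0. *)
Lemma weighted_bound_head (q : \bar R) (v : R -> R) : (1 < q)%E ->
    (forall t : R, 0 < t -> 0 < v t) -> slow v ->
    measurable_fun D0 (v : Leb R -> R) ->
  exists2 C : R, 0 < C & weighted_bound q v (fun t => if t < 1 then t else 0) C.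
Proof.
move=> q1 v0 sv mv.
have h2 : 0 < (2^-1 : R) by rewrite invr_gt0.
have [H H0 hv] := sv _ h2.
have v1 : 0 < v 1 by apply: v0.
pose c := H * v 1; have c0 : 0 < c by rewrite mulr_gt0.
have bnd (t : R) : 0 < t -> t < 1 -> v t * t <= c * t `^ 2^-1.
  move=> t0 t1; have [h _] := hv t 1 t0 (ltW t1).
  have tt : t = t `^ 2^-1 * t `^ 2^-1.
    rewrite -powRD; last by rewrite (gt_eqF t0) implybT.
    have -> : 2^-1 + 2^-1 = 1 :> R by field.
    by rewrite powRr1// ltW.
  have i0 : 0 <= 1 / t by apply: divr_ge0 => //; exact: ltW.
  have e1 : (1 / t) `^ 2^-1 * t `^ 2^-1 = 1.
    by rewrite -(powRM _ i0 (ltW t0)) mulrVK ?unitfE ?gt_eqF// powR1.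
  rewrite {2}tt mulrA; apply: ler_wpM2r; first exact: powR_ge0.
  apply: le_trans (ler_wpM2r (powR_ge0 _ _) h) _.
  have -> : H * (1 / t) `^ 2^-1 * v 1 * t `^ 2^-1 = c * ((1 / t) `^ 2^-1 * t `^ 2^-1).
    by rewrite /c; ring.
  by rewrite e1 mulr1.
have b0 (t : R) : 0 < t -> 0 <= (if t < 1 then t else 0).
  by move=> t0; case: ifP => // _; exact: ltW.
case: q q1 => [r||//] q1; rewrite /weighted_bound; last first.
  exists c => //; apply: aeW => t /D0P t0; case: ifP => [t1|_].
    apply: le_trans (bnd t t0 t1) _; rewrite ler_piMr ?(ltW c0)//.
    rewrite -[leRHS](powRr0 t); apply: ger_powR; last exact: ltW.
    by rewrite t0 ltW.
  by rewrite mulr0 ltW.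
have r1 : 1 < r by rewrite -lte_fin.
have r0 : 0 < r by apply: lt_trans r1.
have half01 : 0 <= (2^-1 : R) < 1 by rewrite (ltW h2) invf_lt1// ltr1n.
have [G G0 hG] := power_integral_head half01.
have cr0 : 0 < c `^ r by apply: powR_gt0.
exists (c * G `^ r^-1); first by rewrite mulr_gt0// powR_gt0.
have -> : (c * G `^ r^-1) `^ r = c `^ r * G.
  rewrite powRM ?powR_ge0 ?(ltW c0)// -powRrM mulVf ?gt_eqF// powRr1//.
  exact: ltW.
have mI : measurable (`]0%R, 1%R[%classic : set (Leb R)) := measurable_leb_itv _.
have ID : (`]0%R, 1%R[%classic : set (Leb R)) `<=` D0.
  by move=> t; rewrite /= !in_itv /= andbT => /andP[].
have mp : measurable_fun (`]0%R, 1%R[%classic : set (Leb R)) (fun t : Leb R => (t `^ (- 2^-1))%:E).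
  apply: (measurable_funS mD ID); apply/measurable_EFinP.
  apply: (@measurableT_comp _ _ _ _ _ _ (fun x : R => x `^ (- 2^-1))); last exact: measurable_leb_id.
  exact: measurable_powR.
pose h (t : Leb R) := ((c `^ r)%:E * ((t : R) `^ (- 2^-1))%:E)%E.
pose I := (\int[leb R]_(t in D0) (h \_ (`]0%R, 1%R[%classic : set (Leb R))) t)%E.
apply: (@le_trans _ _ I).
  apply: (ge0_le_integral _ mD).
  - by apply: bound_integrand_ge0.
  - apply: measurable_bound_integrand; first exact: mv.
    exact: (measurable_head measurable_leb_id).
  - apply/(measurable_restrict _ mI mD).
    apply: measurable_funeM; apply: (measurable_funS mI) mp.
    exact: subIsetr.
  - move=> t /D0P t0; rewrite patchE mem_setE /= in_itv /= t0 /=.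
    case: ifP => [t1|_]; last by rewrite mulr0 powR0 ?gt_eqF// mulr0.
    rewrite /h -EFinM lee_fin.
    have h3 : (v t * t) `^ r <= c `^ r * t `^ 2^-1.
      apply: (@le_trans _ _ ((c * t `^ 2^-1) `^ r)).
        apply: ge0_ler_powR; [exact: ltW| | |exact: bnd]; rewrite nnegrE.
          by apply: mulr_ge0; apply: ltW => //; exact: v0.
        by apply: mulr_ge0; [exact: ltW|exact: powR_ge0].
      rewrite powRM ?powR_ge0 ?(ltW c0)//; apply: ler_wpM2l; first exact: powR_ge0.
      rewrite -powRrM; apply: ger_powR; first by rewrite t0 ltW.
      by rewrite ler_peMr ?(ltW r1)// ltW.
    have h4 : t^-1 * t `^ 2^-1 = t `^ (- 2^-1).
      rewrite -powR_inv1 ?(ltW t0)// -powRD; last by rewrite (gt_eqF t0) implybT.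
      by congr (_ `^ _); field.
    apply: le_trans (ler_wpM2l _ h3) _; first by rewrite invr_ge0 ltW.
    by rewrite mulrCA h4.
rewrite /I -integral_mkcondr (setIidr ID) (ge0_integralZl _ mI mp); last 2 first.
- by move=> t _; rewrite lee_fin powR_ge0.
- by rewrite lee_fin ltW.
rewrite EFinM; apply: lee_wpmul2l; first by rewrite lee_fin ltW.
by have := hG 1 ltr01; rewrite powR1 mulr1.
Qed.

Lemma weighted_bound_fold (q : \bar R) (v v' : R -> R) : (1 < q)%E ->
    (forall t : R, 0 < t -> 0 < v t) -> (forall t : R, 0 < t -> 0 < v' t) ->
    slow v' ->
    measurable_fun D0 (v : Leb R -> R) -> measurable_fun D0 (v' : Leb R -> R) ->
    (forall t : R, 0 < t -> t < 1 -> v t = v' t) ->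
  exists2 C : R, 0 < C & forall (phi : R -> R) (c N : R), 0 <= c -> 0 <= N ->
    measurable_fun D0 (phi : Leb R -> R) -> (forall t : R, 0 < t -> 0 <= phi t) ->
    weighted_bound q v phi c ->
  weighted_bound q v' (fun t => if t < 1 then phi t + t * N else 0) (2 * (c + N * C)).
Proof.
move=> q1 v0 v'0 sv' mv mv' vv'.
have [C C0 hC] := weighted_bound_head q1 v'0 sv' mv'.
exists C => // phi c N c0 N0 mphi phi0 hphi.
have v'w (t : R) : 0 < t -> 0 <= v' t by move=> t0; exact/ltW/v'0.
have head0 (t : R) : 0 < t -> 0 <= (if t < 1 then t else 0).
  by move=> t0; case: ifP => // _; exact: ltW.
have mh := measurable_head measurable_leb_id.
have hN := weighted_boundZ q1 v'w mv' mh head0 N0 (ltW C0) hC.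
have h1 : weighted_bound q v' (fun t => if t < 1 then phi t else 0) c.
  apply: (weighted_bound_le q1 mv mphi mv' (measurable_head mphi) _ hphi) => t t0.
  case: ifP => t1.
    by rewrite (vv' t t0 t1) lexx andbT; apply: mulr_ge0; [exact: v'w|exact: phi0].
  by rewrite mulr0 lexx; apply: mulr_ge0; [exact/ltW/v0|exact: phi0].
have -> : (fun t => if t < 1 then phi t + t * N else 0) =
    (fun t => (if t < 1 then phi t else 0) + N * (if t < 1 then t else 0)).
  by apply/funext => t; case: ifP => _; rewrite ?mulr0 ?addr0// [N * _]mulrC.
apply: (weighted_boundD q1 v'w mv' (measurable_head mphi) _ _ _ c0 _ h1 hN).
- by apply: measurable_funM; [exact: measurable_cst|exact: mh].
- by move=> t t0; case: ifP => // _; exact: phi0.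
- by move=> t t0; apply: mulr_ge0 => //; exact: head0.
- by apply: mulr_ge0 => //; exact: ltW.
Qed.

(** The function [phi] stands for the J-functional of [u], in either couple; all
    that is used of it are the two bounds on (0, 1) and the bound on [[1, oo)],
    with [g] recording the gain in the latter.  The output bounds dominate the
    J-functional of [u'] in both couples. *)
Lemma fold_transfer (Z : topologicalLmodType R) (X : compatible_couple Z)
    (q : \bar R) (q' : R) (v v' g : R -> R) (M : R) :
    (1 < q)%E -> q'%:E = hoelder_conjugate q ->
    (forall t : R, 0 < t -> 0 < v t) -> (forall t : R, 0 < t -> 0 < v' t) ->
    slow v' ->
    measurable_fun D0 (v : Leb R -> R) -> measurable_fun D0 (v' : Leb R -> R) ->
    (forall t : R, 0 < t -> t < 1 -> v t = v' t) ->
    (forall t : R, 0 < t -> 0 <= g t) -> (forall t : R, 0 < t -> t < 1 -> g t = 1) ->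
    measurable_fun D0 (g : Leb R -> R) -> 0 <= M ->
    (\int[leb R]_(t in D0) (t^-1 * (g t * v t `^ (-1)) `^ q')%:E <= M%:E)%E ->
  exists2 C : R, 0 < C & forall (u : R -> cap X) (phi : R -> R) (c : R), 0 <= c ->
    strongly_measurable (leb R) D0 u ->
    measurable_fun D0 (phi : Leb R -> R) ->
    (forall s : R, 0 < s -> s < 1 -> `|cap0 (u s)| <= phi s /\ s * `|u s| <= phi s) ->
    (forall s : R, 1 <= s -> `|u s| <= g s * phi s) ->
    (forall s : R, 0 < s -> 0 <= phi s) ->
    weighted_bound q v phi c ->
    (\int[leb R]_(s in D0) `|(s^-1 : R) *: cap0 (u s)|%:E < +oo)%E /\
    forall L, is_bochner_integral (leb R) D0 (fun s : Leb R => (s^-1 : R) *: cap0 (u s)) L ->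
    exists u' : R -> cap X, exists phi' : R -> R,
      [/\ strongly_measurable (leb R) D0 u',
       is_bochner_integral (leb R) D0 (fun s : Leb R => (s^-1 : R) *: cap0 (u' s)) L,
       measurable_fun D0 (phi' : Leb R -> R),
       (forall s : R, 0 < s -> `|cap0 (u' s)| <= phi' s /\ s * `|u' s| <= phi' s) &
       weighted_bound q v' phi' (C * c)].
Proof.
move=> q1 qq' v0 v'0 sv' mv mv' vv' g0 g1 mg M0 hM.
have [C C0 hC] := weighted_bound_fold q1 v0 v'0 sv' mv mv' vv'.
have cmp := @completed_lebesgue_measure_is_complete R.
pose m := M `^ q'^-1.
have m0 : 0 <= m by exact: powR_ge0.
exists (2 * (1 + m * C)); first by rewrite mulr_gt0// ltr_pwDl// mulr_ge0// ltW.
move=> u phi c c0 su mphi lo hi phi0 hphi.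
have hN := weighted_bound_hoelder q1 qq' mD (@subset_refl _ D0) v0 g0 phi0 mv mg
  mphi M0 c0 hM hphi.
have mpsi : measurable_fun D0 ((fun s => g s * phi s) : Leb R -> R).
  exact: measurable_funM mg mphi.
have lo' (s : R) : 0 < s -> s < 1 -> `|cap0 (u s)| <= g s * phi s.
  by move=> s0 s1; rewrite g1// mul1r; have [] := lo s s0 s1.
have le0 (s : R) : 0 < s -> `|cap0 (u s)| <= g s * phi s.
  move=> s0; have [s1|s1] := ltP s 1; first exact: lo'.
  exact: le_trans (ler_norm_cap0 _) (hi s s1).
split.
  apply: (@le_lt_trans _ _ (m * c)%:E); last exact: ltry.
  apply: le_trans hN; apply: (ge0_le_integral _ mD).
  - by move=> s _; rewrite lee_fin.
  - apply/measurable_EFinP; apply: (strongly_measurable_norm cmp).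
    exact: (strongly_measurable_scale_inv (strongly_measurable_comp (@cap0_continuous _ _ X) su)).
  - apply/measurable_EFinP; apply: measurable_funM; last exact: mpsi.
    exact: measurable_inv_pos.
  - move=> s /D0P s0; rewrite lee_fin normrZ gtr0_norm ?invr_gt0//.
    by apply: ler_wpM2l (le0 s s0); rewrite invr_ge0 ltW.
move=> L bL.
have [G GN [su' bL']] := fold_representation su mpsi lo' hi hN bL.
have mc0 : 0 <= m * c by exact: mulr_ge0.
exists (fun s => if s < 1 then u s + s *: G else 0).
exists (fun s => if s < 1 then phi s + s * (m * c) else 0).
split; [exact: su'|exact: bL'| | |].
- apply: (@measurable_head (fun s => phi s + s * (m * c))).
  apply: measurable_funD; first exact: mphi.
  by apply: measurable_funM; [exact: measurable_leb_id|exact: measurable_cst].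
- move=> s s0; case: ifP => s1; last by rewrite linear0 !normr0 mulr0.
  have [l0 l1] := lo s s0 s1; split.
    rewrite linearD linearZ; apply: le_trans (ler_normD _ _) _.
    apply: lerD l0 _; rewrite normrZ gtr0_norm//; apply: ler_wpM2l (ltW s0) _ _ _.
    exact: le_trans (ler_norm_cap0 _) GN.
  apply: le_trans (ler_wpM2l (ltW s0) (ler_normD _ _)) _.
  rewrite mulrDr; apply: lerD l1 _; rewrite normrZ gtr0_norm//.
  apply: ler_wpM2l (ltW s0) _ _ _.
  apply: le_trans (_ : 1 * `|G| <= _); last by rewrite mul1r.
  by apply: ler_wpM2r => //; exact: ltW.
- have -> : 2 * (1 + m * C) * c = 2 * (c + m * c * C) by ring.
  exact: hC.
Qed.

End fold_bound.

Section cap_of_cap.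
Context {R : realType} {Z : topologicalLmodType R} (X : compatible_couple Z).
Local Notation D0 := (`]0, +oo[%classic : set (Leb R)).
Local Notation Y := (cap_couple X).
Lemma measurable_J_functional (C : compatible_couple Z) (u : R -> cap C) :
    strongly_measurable (leb R) D0 u ->
  measurable_fun D0 ((fun t => J_functional (u t) t) : Leb R -> R).
Proof.
move=> su; have cmp := @completed_lebesgue_measure_is_complete R.
apply: measurable_maxr.
  apply: (strongly_measurable_norm cmp).
  exact: (strongly_measurable_comp (@cap0_continuous _ _ C) su).
apply: measurable_funM; first exact: measurable_leb_id.
apply: (strongly_measurable_norm cmp).
exact: (strongly_measurable_comp (@cap1_continuous _ _ C) su).
Qed.

Lemma cap_of_cap_subproof (f : cap X) : ((cap0 f, f) : space0 Y * space1 Y) \in @cap_pred _ _ Y.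
Proof. by rewrite unfold_in /=. Qed.

(** The identification of X0 /\ X1 with X0 /\ (X0 /\ X1). *)
Definition cap_of_cap (f : cap X) : cap Y := Cap (cap_of_cap_subproof f).

Lemma cap_of_cap_continuous : continuous cap_of_cap.
Proof.
move=> f; apply/(@cvgrPdist_lt _ _ _ _ (nbhs_filter f)) => e e0.
apply/(@nbhs_ballP R (cap X)); exists e => //= g; rewrite -ball_normE /=.
apply: le_lt_trans; rewrite norm_capE ge_max.
by rewrite lexx andbT; exact: (ler_norm_cap0 (f - g)).
Qed.

Lemma cap0_cap1 (f : cap Y) : cap0 (cap1 f : cap X) = cap0 f.
Proof. by apply: (@emb0_inj _ _ X); have := emb_cap f => /esym. Qed.

End cap_of_cap.
Arguments cap_of_cap {R Z X} f.

(** * The K-functional *)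

Section J_into_K.
Context {R : realType} {Z : topologicalLmodType R} (C : compatible_couple Z).
Local Notation D0 := (`]0, +oo[%classic : set (Leb R)).
Let mD : measurable D0 := measurable_leb_itv _.
Let D0P (t : R) : D0 t -> 0 < t.
Proof. by rewrite /= in_itv /= andbT. Qed.

Lemma decomp_lbound (f : Z) (t : R) : 0 <= t ->
  lbound [set `|p.1| + t * `|p.2| | p in decomp C f] 0.
Proof. by move=> t0 _ [p _ <-]; rewrite addr_ge0// mulr_ge0. Qed.

Lemma K_functional_ge0 (f : Z) (t : R) : 0 <= t -> 0 <= K_functional C f t.
Proof.
move=> t0; rewrite /K_functional.
have [->|/set0P ne] := eqVneq [set `|p.1| + t * `|p.2| | p in decomp C f] set0.
  by rewrite inf0.
by apply: lb_le_inf => //; exact: decomp_lbound.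
Qed.

Lemma K_functional_le (f : Z) (p : space0 C * space1 C) (t : R) : 0 <= t ->
  decomp C f p -> K_functional C f t <= `|p.1| + t * `|p.2|.
Proof.
move=> t0 pf; apply: ge_inf; last by exists p.
by exists 0; exact: decomp_lbound.
Qed.

Lemma le_K_functional (f : Z) (t k : R) : f \in sum_pred C ->
    (forall p, decomp C f p -> k <= `|p.1| + t * `|p.2|) ->
  k <= K_functional C f t.
Proof.
move=> /sum_predP[p pf] h; apply: lb_le_inf; first by exists (`|p.1| + t * `|p.2|), p.
by move=> _ [r rf <-]; exact: h.
Qed.

(** Restricted to [0 <= s]: for negative arguments the infimum need not be that
    of a set bounded below. *)
Lemma K_functional_mono (f : Z) (s t : R) : f \in sum_pred C -> 0 <= s -> s <= t ->
  K_functional C f s <= K_functional C f t.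
Proof.
move=> fs s0 st; apply: le_K_functional => // p pf.
apply: le_trans (K_functional_le s0 pf) _.
by rewrite lerD2l ler_wpM2r.
Qed.

Lemma measurable_K_functional (f : Z) : f \in sum_pred C ->
  measurable_fun D0 (K_functional C f : Leb R -> R).
Proof.
move=> fs.
apply: (eq_measurable_fun
    ((fun t => if 0 < t then K_functional C f t else 0) : Leb R -> R)).
  by move=> t /set_mem /D0P ->.
apply: measurable_fun_leb => //; apply: nondecreasing_measurable => // x y xy.
case: ifPn => x0; last by case: ifPn => // y0; exact/K_functional_ge0/ltW.
by rewrite (lt_le_trans x0 xy); apply: K_functional_mono => //; exact: ltW.
Qed.

Lemma space1_in_sum (x : space1 C) : emb1 C x \in sum_pred C.
Proof. by apply/sum_predP; exists (0, x); rewrite /decomp /= linear0 add0r. Qed.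

Definition space1_to_sum (x : space1 C) : sum_space C := SumSpace (space1_in_sum x).

Lemma space1_to_sum_linear : linear space1_to_sum.
Proof. by move=> a x y; apply: val_inj; rewrite /= linearP. Qed.

HB.instance Definition _ :=
  GRing.isLinear.Build R (space1 C) (sum_space C) *:%R space1_to_sum
    space1_to_sum_linear.

Lemma ler_norm_space1_to_sum (x : space1 C) : `|space1_to_sum x| <= `|x|.
Proof.
have -> : `|x| = `|0 : space0 C| + `|x| by rewrite normr0 add0r.
apply: ge_inf; first by exists 0 => _ [p _ <-]; rewrite addr_ge0.
by exists (0, x) => //; rewrite /decomp /= linear0 add0r.
Qed.

(** The part of the integral over [s < t] converges in X0 and the rest in X1;
    together they form a decomposition of [f]. *)
Lemma K_functional_le_kernel (u : R -> cap C) (f : Z) (t : R) : 0 < t ->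
    J_represents u f ->
  ((K_functional C f t)%:E <= \int[leb R]_(s in D0)
    (Num.min 1 (t / s) * (s^-1 * J_functional (u s) s))%:E)%E.
Proof.
move=> t0 [su [F Ff bF]].
have cmp := @completed_lebesgue_measure_is_complete R.
set I := (X in (_ <= X)%E).
have [Ioo|Ifin] := leP +oo%E I; first by move: Ioo; rewrite leye_eq => /eqP ->; exact: leey.
pose P := `]-oo, t[%classic : set (Leb R).
have mP : measurable P := measurable_leb_itv _.
have memP (s : R) : ((s : Leb R) \in P) = (s < t) by rewrite mem_setE.
pose u0 (s : Leb R) : space0 C := if (s : R) < t then (s^-1 : R) *: cap0 (u s) else 0.
pose u1 (s : Leb R) : space1 C := if (s : R) < t then 0 else (s^-1 : R) *: cap1 (u s).
have su0 : strongly_measurable (leb R) D0 u0.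
  have := strongly_measurable_mem mD mP (strongly_measurable_scale_inv
    (strongly_measurable_comp (@cap0_continuous _ _ C) su)).
  congr (strongly_measurable _ _ _); apply/funext => s.
  by rewrite /u0 memP.
have su1 : strongly_measurable (leb R) D0 u1.
  have := strongly_measurable_mem mD (measurableC mP) (strongly_measurable_scale_inv
    (strongly_measurable_comp (@cap1_continuous _ _ C) su)).
  congr (strongly_measurable _ _ _); apply/funext => s.
  by rewrite /u1 in_setC memP; case: (_ < _).
have n0 := strongly_measurable_norm cmp su0.
have n1 := strongly_measurable_norm cmp su1.
pose h (s : R) := `|u0 s| + t * `|u1 s|.
have mtn1 : measurable_fun D0 ((fun s => t * `|u1 s|) : Leb R -> R).
  by apply: measurable_funM; [exact: measurable_cst|exact: n1].
have hle (s : R) : 0 < s -> h s <= Num.min 1 (t / s) * (s^-1 * J_functional (u s) s).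
  move=> s0; rewrite /h /u0 /u1; case: ltP => ts.
    have -> : Num.min 1 (t / s) = 1.
      by apply/min_idPl; rewrite ler_pdivlMr// mul1r ltW.
    rewrite normr0 mulr0 addr0 mul1r normrZ gtr0_norm ?invr_gt0//.
    by apply: ler_wpM2l; [rewrite invr_ge0 ltW|rewrite /J_functional le_max lexx].
  have -> : Num.min 1 (t / s) = t / s by apply/min_idPr; rewrite ler_pdivrMr// mul1r.
  rewrite normr0 add0r normrZ gtr0_norm ?invr_gt0// -mulrA.
  apply: ler_wpM2l (ltW t0) _ _ _; apply: ler_wpM2l; first by rewrite invr_ge0 ltW.
  rewrite ler_pdivlMl//.
  by rewrite /J_functional le_max lexx orbT.
have hI : (\int[leb R]_(s in D0) `|u0 s|%:E + t%:E * \int[leb R]_(s in D0) `|u1 s|%:E <= I)%E.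
  rewrite -(ge0_integralZl _ mD); last 3 first.
  - exact/measurable_EFinP.
  - by move=> s _; rewrite lee_fin.
  - by rewrite lee_fin ltW.
  rewrite -(ge0_integralD _ mD); last 4 first.
  - by move=> s _; rewrite lee_fin.
  - exact/measurable_EFinP.
  - by move=> s _; rewrite -EFinM lee_fin mulr_ge0// ltW.
  - by apply: measurable_funeM; exact/measurable_EFinP.
  apply: (ge0_le_integral _ mD).
  - by move=> s _; rewrite -EFinM -EFinD lee_fin addr_ge0// mulr_ge0// ltW.
  - apply: emeasurable_funD; first exact/measurable_EFinP.
    by apply: measurable_funeM; exact/measurable_EFinP.
  - apply/measurable_EFinP; apply: measurable_funM; first exact: measurable_kernel_l.
    apply: measurable_funM; first exact: measurable_inv_pos.
    exact: measurable_J_functional.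
  - by move=> s /D0P s0; rewrite -EFinM -EFinD lee_fin; exact: hle.
have i10 : (0 <= \int[leb R]_(s in D0) `|u1 s|%:E)%E.
  by apply: integral_ge0 => s _; rewrite lee_fin.
have i00 : (0 <= \int[leb R]_(s in D0) `|u0 s|%:E)%E.
  by apply: integral_ge0 => s _; rewrite lee_fin.
have fin0 : (\int[leb R]_(s in D0) `|u0 s|%:E < +oo)%E.
  apply: le_lt_trans Ifin; apply: le_trans hI; apply: leeDl.
  by apply: mule_ge0 => //; rewrite lee_fin ltW.
have fin1 : (\int[leb R]_(s in D0) `|u1 s|%:E < +oo)%E.
  have h1 : (t%:E * \int[leb R]_(s in D0) `|u1 s|%:E < +oo)%E.
    by apply: le_lt_trans Ifin; apply: le_trans hI; exact: leeDr.
  rewrite ltey; apply/eqP => E; move: h1; rewrite E gt0_muley ?lte_fin//.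
have [f0 b0] := bochner_integral_exists mD cmp su0 fin0.
have [f1 b1] := bochner_integral_exists mD cmp su1 fin1.
have l0 (x : space0 C) : `|space0_to_sum x| <= 1 * `|x| by rewrite mul1r ler_norm_space0_to_sum.
have l1 (x : space1 C) : `|space1_to_sum x| <= 1 * `|x| by rewrite mul1r ler_norm_space1_to_sum.
have B0 := bochner_integral_linear mD cmp l0 b0.
have B1 := bochner_integral_linear mD cmp l1 b1.
have FE : space0_to_sum f0 + space1_to_sum f1 = F.
  apply: (bochner_integral_unique mD cmp _ bF).
  apply: (eq_bochner_integral _ (bochner_integralD mD cmp B0 B1)).
  apply/funext => s; apply: val_inj => /=; rewrite /u0 /u1; case: ifP => _.
    by rewrite linear0 addr0 linearZ.
  by rewrite linear0 add0r linearZ /= -emb_cap.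
have pf : decomp C f (f0, f1) by rewrite /decomp /= -Ff -FE.
apply: le_trans hI; apply: (@le_trans _ _ (`|f0| + t * `|f1|)%:E).
  by rewrite lee_fin; exact: (K_functional_le (ltW t0) pf).
rewrite EFinD EFinM; apply: leeD; first exact: (bochner_integral_norm_le mD cmp b0).
apply: lee_wpmul2l; first by rewrite lee_fin ltW.
exact: (bochner_integral_norm_le mD cmp b1).
Qed.

End J_into_K.

(** * Decompositions for the couple (X0, X0 /\ X1) *)

Section cap_decomposition.
Context {R : realType} {Z : topologicalLmodType R} (X : compatible_couple Z).
Local Notation Y := (cap_couple X).

Lemma decomp_capP (L : space0 X) (p : space0 X * cap X) :
  @decomp R Z Y (emb0 X L) p <-> L = p.1 + cap0 p.2.
Proof.
rewrite /decomp /=; split=> [|->]; last by rewrite linearD.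
by rewrite -linearD => /(@emb0_inj _ _ X).
Qed.

Lemma sum_capP (f : Z) : f \in sum_pred Y -> exists L : space0 X, f = emb0 X L.
Proof.
by move=> /sum_predP[p /= ->]; exists (p.1 + cap0 (p.2 : cap X)); rewrite linearD.
Qed.

Lemma emb0_in_sum_cap (L : space0 X) : emb0 X L \in sum_pred Y.
Proof. exact: (@space0_in_sum R Z Y). Qed.

(** Every decomposition [L = p1 + p2] has [|L| <= |p1| + |p2|], since the norm of
    X0 /\ X1 dominates that of X0. *)
Lemma K_functional_cap_ge (L : space0 X) (t : R) : 0 < t ->
  Num.min 1 t * `|L| <= K_functional Y (emb0 X L) t.
Proof.
move=> t0; have m0 : 0 <= Num.min 1 t by rewrite le_min ler01 ltW.
apply: le_K_functional => [|[p1 p2] /decomp_capP /= ->]; first exact: emb0_in_sum_cap.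
apply: le_trans (ler_wpM2l m0 (ler_normD _ _)) _.
rewrite mulrDr; apply: lerD.
  by rewrite ler_piMl// ge_min lexx.
apply: ler_pM => //; first by rewrite ge_min lexx orbT.
exact: ler_norm_cap0.
Qed.

Lemma near_optimal_decomp (L : space0 X) (t : R) : 0 < t -> L != 0 ->
  exists p : space0 X * cap X, L = p.1 + cap0 p.2 /\
    `|p.1| + t * `|p.2| <= 2 * K_functional Y (emb0 X L) t.
Proof.
move=> t0 L0; set k := K_functional _ _ _.
have k0 : 0 < k.
  apply: lt_le_trans (K_functional_cap_ge L t0).
  by rewrite mulr_gt0 ?normr_gt0// lt_min ltr01.
have hi : has_inf [set `|p.1| + t * `|p.2| | p in @decomp R Z Y (emb0 X L)].
  split; last by exists 0; apply: decomp_lbound; exact: ltW.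
  have /sum_predP[p pf] := emb0_in_sum_cap L.
  by exists (`|p.1| + t * `|p.2|), p.
have [_ [p /decomp_capP pf <-] h] := inf_adherent k0 hi.
exists p; split=> //; apply: le_trans (ltW h) _.
by rewrite -/(K_functional Y (emb0 X L) t) -/k mulr_natl mulr2n.
Qed.

End cap_decomposition.

Lemma powR_exprn {R : realType} (x s : R) (n : nat) : 0 <= x ->
  (x ^+ n) `^ s = (x `^ s) ^+ n.
Proof.
move=> x0; rewrite -(powR_mulrn n x0) -(powR_mulrn n (powR_ge0 x s)).
by rewrite -!powRrM mulrC.
Qed.

(** * Step functions along a sequence decreasing to 0 *)

Section step.
Context {R : realType}.
Local Notation D0 := (`]0, +oo[%classic : set (Leb R)).
Variable sg : nat -> R.
Hypothesis sg_dec : forall n, sg n.+1 <= sg n.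
Hypothesis sg_small : forall t : R, 0 < t -> exists n, sg n <= t.

Let mD : measurable D0 := measurable_leb_itv _.
Let D0P (t : R) : D0 t -> 0 < t.
Proof. by rewrite /= in_itv /= andbT. Qed.

(** The function equal to [c n] on [[sg (n+1), sg n)] and to 0 from [sg 0] on.  The
    points of a sequence decreasing to 0 cut [(0, sg 0)] into these blocks. *)
Definition step (V : zmodType) (c : nat -> V) (t : R) : V :=
  if t < sg 0 then c (xget 0%N [set n | sg n.+1 <= t < sg n]) else 0.

Lemma step_points_le (m n : nat) : (m <= n)%N -> sg n <= sg m.
Proof.
move=> /subnK <-; elim: (n - m)%N => [//|k IH].
by rewrite addSn; exact: le_trans (sg_dec _) IH.
Qed.

Lemma step_block (V : zmodType) (c : nat -> V) (n : nat) (t : R) :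
  sg n.+1 <= t < sg n -> step c t = c n.
Proof.
move=> /andP[tn nt]; rewrite /step (lt_le_trans nt (step_points_le (leq0n n))).
congr c; have := @xgetPex _ 0%N [set n | sg n.+1 <= t < sg n] (ex_intro _ n _).
rewrite /= tn nt => /(_ isT); set m := xget _ _ => /andP[tm mt].
apply/eqP; rewrite eqn_leq; apply/andP; split; rewrite leqNgt; apply/negP => h.
  by move: (lt_le_trans mt (le_trans (step_points_le h) tn)); rewrite ltxx.
by move: (lt_le_trans nt (le_trans (step_points_le h) tm)); rewrite ltxx.
Qed.

Lemma step0 (V : zmodType) (c : nat -> V) (t : R) : sg 0 <= t -> step c t = 0.
Proof. by move=> h; rewrite /step ltNge h. Qed.

Lemma step_cases (t : R) : 0 < t ->
  sg 0 <= t \/ exists n, sg n.+1 <= t < sg n.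
Proof.
move=> t0; have ex : exists n, sg n <= t by exact: sg_small.
case: (ex_minnP ex) => -[|n] nt min; [by left|right]; exists n.
by rewrite nt /= ltNge; apply/negP => /min; rewrite ltnn.
Qed.

Lemma step_map (V V' : zmodType) (F : V -> V') (c : nat -> V) (t : R) :
  F 0 = 0 -> F (step c t) = step (F \o c) t.
Proof. by move=> F0; rewrite /step; case: ifP. Qed.

(** The step function with the blocks near 0 erased; it takes finitely many values
    and its integral is a finite sum. *)
Definition truncated_step (V : zmodType) (c : nat -> V) (N : nat) (t : R) : V :=
  if t < sg N then 0 else step c t.

Lemma truncated_stepS (V : zmodType) (c : nat -> V) (N : nat) :
  truncated_step c N.+1 = (fun t => truncated_step c N t +
    if sg N.+1 <= t < sg N then c N else 0).
Proof.
apply/funext => t; rewrite /truncated_step.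
have [tN|tN] := ltP t (sg N.+1).
  by rewrite (lt_le_trans tN (sg_dec N)) addr0.
have [Nt|Nt] := ltP t (sg N); last by rewrite addr0.
by rewrite (@step_block _ _ N) ?tN// add0r.
Qed.

Lemma finite_valued_block (V : zmodType) (v : V) (n : nat) :
  finite_valued D0 ((fun t => if sg n.+1 <= t < sg n then v else 0) : Leb R -> V).
Proof.
have -> : ((fun t => if sg n.+1 <= t < sg n then v else 0) : Leb R -> V) =
    (fun t => if t \in (`[sg n.+1, sg n[%classic : set (Leb R)) then v else 0).
  by apply/funext => t; rewrite mem_setE /= in_itv.
apply: (finite_valued_mem _ mD (measurable_leb_itv _)).
exact: (finite_valued_cst _ mD).
Qed.

Lemma finite_valued_truncated_step (V : zmodType) (c : nat -> V) (N : nat) :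
  finite_valued D0 (truncated_step c N : Leb R -> V).
Proof.
elim: N => [|N IH].
  have -> : truncated_step c 0 = fun=> 0.
    by apply/funext => t; rewrite /truncated_step /step; case: (_ < _).
  exact: (finite_valued_cst _ mD).
rewrite truncated_stepS.
exact: (finite_valued_comp (fun p => p.1 + p.2) (finite_valued_pair IH (finite_valued_block (c N) N))).
Qed.

Lemma strongly_measurable_step (V : normedModType R) (c : nat -> V) :
  strongly_measurable (leb R) D0 (step c : Leb R -> V).
Proof.
exists (truncated_step c); split=> [N|].
  apply/simple_measurableP; exact: finite_valued_truncated_step.
apply: aeW => t /D0P t0; have [n nt] := sg_small t0.
apply: (cvg_near_cst (step c t)); exists n => // m /= nm.
by rewrite /truncated_step ltNge (le_trans (step_points_le nm) nt).
Qed.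

Lemma integral_block (h : R -> R) (n : nat) : (forall n, 0 < sg n) ->
  (\int[leb R]_(t in D0) (if (sg n.+1 <= (t : R) < sg n)%R then h t else 0)%:E =
   \int[leb R]_(t in `[sg n.+1, sg n[) (h t)%:E)%E.
Proof.
move=> sg0; pose E := (`[sg n.+1, sg n[%classic : set (Leb R)).
transitivity (\int[leb R]_(t in D0) (((fun t => (h t)%:E) : Leb R -> \bar R) \_ E) t)%E.
  apply: eq_integral => t _; rewrite patchE mem_setE /= in_itv /=.
  by case: ifP.
rewrite -integral_mkcondr setIidr// => t; rewrite /E /= !in_itv /= andbT => /andP[nt _].
exact: lt_le_trans nt.
Qed.

Lemma measurable_block (h : R -> R) (n : nat) :
    measurable_fun D0 (h : Leb R -> R) ->
  measurable_fun D0 ((fun t => if sg n.+1 <= t < sg n then h t else 0) : Leb R -> R).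
Proof.
move=> mh; have mE : measurable (`[sg n.+1, sg n[%classic : set (Leb R)).
  exact: measurable_leb_itv.
have -> : ((fun t => if sg n.+1 <= t < sg n then h t else 0) : Leb R -> R) =
    (h : Leb R -> R) \_ (`[sg n.+1, sg n[%classic : set (Leb R)).
  by apply/funext => t; rewrite patchE mem_setE /= in_itv.
apply/(measurable_restrict _ mE mD).
by apply: (measurable_funS mD) => // s [].
Qed.

Lemma bochner_truncated_step (V : normedModType R) (m : nat -> R) (h : R -> R)
    (c : nat -> V) :
    measurable_fun D0 (h : Leb R -> R) -> (forall t : R, 0 < t -> 0 <= h t) ->
    (forall n, 0 < sg n) ->
    (forall n, (\int[leb R]_(t in `[sg n.+1, sg n[) (h t)%:E = (m n)%:E)%E) ->
  forall N, is_bochner_integral (leb R) D0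
    ((fun t => h t *: truncated_step c N t) : Leb R -> V) (\sum_(n < N) m n *: c n).
Proof.
move=> mh h0 sg0 hm.
have cmp := @completed_lebesgue_measure_is_complete R.
elim=> [|N IH].
  have z0 (x : Leb R) : D0 x -> 0 <= (0 : R) by [].
  have zf : (\int[leb R]_(x in D0) (0%R)%:E < +oo)%E by rewrite integral0 ltry.
  have := bochner_integralZ mD cmp (0 : V) (measurable_cst (0 : R)) z0 zf.
  rewrite scaler0 big_ord0; apply: eq_bochner_integral.
  by apply/funext => t; rewrite /truncated_step /step scaler0; case: (_ < _); rewrite scaler0.
pose hN (t : R) := if sg N.+1 <= t < sg N then h t else 0.
have mhN : measurable_fun D0 (hN : Leb R -> R) := measurable_block _ mh.
have hN0 (t : Leb R) : D0 t -> 0 <= hN t.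
  by move=> /D0P t0; rewrite /hN; case: ifP => // _; exact: h0.
have E : (\int[leb R]_(t in D0) (hN t)%:E = (m N)%:E)%E by rewrite integral_block.
have fin : (\int[leb R]_(t in D0) (hN t)%:E < +oo)%E by rewrite E ltry.
have := bochner_integralZ mD cmp (c N) mhN hN0 fin.
rewrite /Rintegral E /= => bN.
rewrite big_ord_recr /=.
apply: (eq_bochner_integral _ (bochner_integralD mD cmp IH bN)).
apply/funext => t; rewrite /= truncated_stepS scalerDr; congr (_ + _).
by rewrite /hN; case: ifP => _; rewrite ?scale0r ?scaler0.
Qed.

End step.

(** * The dual weight *)

Section dual_weights.
Context {R : realType}.
Local Notation D0 := (`]0, +oo[%classic : set (Leb R)).
Variables (q : \bar R) (q' : R) (A B W : R -> R).
Hypotheses (q1 : (1 < q)%E) (qq' : q'%:E = hoelder_conjugate q).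
Hypothesis A0 : forall t : R, 0 < t -> 0 < A t.
Hypothesis mA : measurable_fun D0 (A : Leb R -> R).
Hypothesis sA : slow A.
Hypothesis WE : forall x : R, 0 < x ->
  (\int[leb R]_(t in `]0%R, x[) (t^-1 * A t `^ (- q'))%:E = (W x)%:E)%E.
Hypothesis Woo : forall c : R, exists2 x : R, 0 < x & c < W x.
Hypothesis BE : forall x : R, 0 < x ->
  B x = A x `^ (- (q' * fine q^-1%E)) * (W x)^-1.

Let mD : measurable D0 := measurable_leb_itv _.
Let D0P (t : R) : D0 t -> 0 < t.
Proof. by rewrite /= in_itv /= andbT. Qed.
Let w t := A t `^ (- q').
Let w0 (t : R) : 0 < t -> 0 < w t.
Proof. by move=> t0; rewrite powR_gt0 ?A0. Qed.
Let mw : measurable_fun D0 (w : Leb R -> R).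
Proof. exact: (measurableT_comp (measurable_powR _) mA). Qed.
Let sw : slow w.
Proof. exact: slow_powR. Qed.
Let W0 := primitive_gt0 mw w0 sw WE.
Let A0w (t : R) : 0 < t -> 0 <= A t. Proof. by move=> t0; exact/ltW/A0. Qed.

Lemma dual_weight_gt0 (t : R) : 0 < t -> 0 < B t.
Proof. by move=> t0; rewrite BE// divr_gt0 ?powR_gt0 ?A0 ?W0. Qed.

Lemma measurable_dual_weight : measurable_fun D0 (B : Leb R -> R).
Proof.
apply: (eq_measurable_fun (fun x : Leb R =>
  A x `^ (- (q' * fine q^-1%E)) * W x `^ (-1) : R)).
  by move=> x /set_mem/D0P x0; rewrite BE// powR_inv1// ltW// W0.
apply: measurable_funM; first exact: (measurableT_comp (measurable_powR _) mA).
exact: (measurableT_comp (measurable_powR _) (measurable_primitive mw w0 W0 WE)).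
Qed.

Let kmin (t s : R) : 0 < t -> 0 < s -> 0 <= Num.min 1 (t / s).
Proof. by move=> t0 s0; rewrite le_min ler01 divr_ge0// ltW. Qed.

(** Schur's test.  Hoelder's inequality against the kernel, with the auxiliary
    factor [W^(1/(2q'))], bounds [K(t)^r] by an integral of [(A h)^r W^(r/(2q'))]
    times a power of [W(t)] supplied by [kernel_head].  Integrating against
    [B^r] and exchanging the integrals leaves [kernel_tail], whose power of [W]
    cancels the auxiliary one.  For [q = +oo] the bound [h <= c w] and
    [kernel_head] with [d = 0] suffice. *)
Lemma hardy_kernel : exists2 C : R, 0 < C & forall (h K : R -> R) (c : R),
    measurable_fun D0 (h : Leb R -> R) -> (forall t : R, 0 < t -> 0 <= h t) ->
    measurable_fun D0 (K : Leb R -> R) -> (forall t : R, 0 < t -> 0 <= K t) ->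
    (forall t : R, 0 < t -> ((K t)%:E <=
       \int[leb R]_(s in D0) (Num.min 1 (t / s) * (s^-1 * h s))%:E)%E) ->
    0 <= c -> weighted_bound q A h c -> weighted_bound q B K (C * c).
Proof.
have [[qy q'1]|[r qr [r1 q'1 rr']]] := conjugate_cases q1 qq'.
  have zero01 : 0 <= (0 : R) < 1 by rewrite lexx ltr01.
  have [C C0 hC] := kernel_head mw w0 sw WE Woo zero01.
  exists C; first exact: C0.
  move=> h K c mh h0 mK K0 hK c0.
  rewrite qy /weighted_bound => bA; apply: aeW => t /D0P t0.
  rewrite BE// qy invey /= mulr0 oppr0 powRr0 mul1r ler_pdivrMl ?W0//.
  have mk := measurable_kernel_l t.
  have mwd := measurable_density mw.
  rewrite -lee_fin; apply: (le_trans (hK t t0)).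
  apply: (@le_trans _ _ (\int[leb R]_(s in D0)
      (c%:E * (Num.min 1 (t / s) * (s^-1 * w s * W s `^ (- 0)))%:E))%E).
    apply: (ae_ge0_le_integral mD).
    - move=> s /D0P s0; rewrite lee_fin mulr_ge0 ?kmin ?mulr_ge0 ?invr_ge0 ?h0//.
      exact: ltW.
    - apply/measurable_EFinP; apply: (measurable_funM mk).
      by apply: measurable_funM mh; exact: measurable_inv_pos.
    - move=> s /D0P s0; rewrite -EFinM lee_fin mulr_ge0// mulr_ge0 ?kmin//.
      by rewrite !mulr_ge0 ?powR_ge0 ?invr_ge0 ?(ltW s0).
    - apply: measurable_funeM; apply/measurable_EFinP; apply: (measurable_funM mk).
      exact: (measurable_density_primitive mw w0 W0 WE).
    - apply: filterS bA => s bA Ds; have s0 := D0P Ds.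
      rewrite -EFinM lee_fin oppr0 powRr0 mulr1 [leRHS]mulrCA.
      rewrite ler_wpM2l ?kmin// [leRHS]mulrCA ler_wpM2l ?invr_ge0 ?(ltW s0)//.
      rewrite /w q'1 powR_inv1 ?(ltW (A0 s0))// ler_pdivlMr ?A0// mulrC.
      exact: bA.
  rewrite (ge0_integralZl _ mD); last 3 first.
  - apply/measurable_EFinP; apply: (measurable_funM mk).
    exact: (measurable_density_primitive mw w0 W0 WE).
  - move=> s /D0P s0; rewrite lee_fin mulr_ge0 ?kmin//.
    by rewrite !mulr_ge0 ?powR_ge0 ?invr_ge0 ?(ltW s0).
  - by rewrite lee_fin.
  apply: (@le_trans _ _ (c%:E * (C * W t `^ (1 - 0))%:E)%E).
    by apply: lee_wpmul2l; [rewrite lee_fin|exact: hC].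
  rewrite subr0 powRr1 ?(ltW (W0 t0))// -EFinM lee_fin.
  by rewrite le_eqVlt; apply/orP; left; apply/eqP; ring.
have r0 : 0 < r := lt_trans ltr01 r1.
have q'0 : 0 < q' := lt_trans ltr01 q'1.
have half01 : 0 <= (2^-1 : R) < 1 by rewrite invr_ge0 ler0n invf_lt1// ltr1n.
pose m := r / q'; have mE : m = r - 1.
  rewrite /m; have : q'^-1 = 1 - r^-1 by rewrite -rr' addrAC subrr add0r.
  by move=> ->; rewrite mulrBr mulr1 mulfV// gt_eqF.
have m0 : 0 < m by rewrite divr_gt0.
(* With [m = r/q' = r - 1], this is the exponent for which the powers of [W]
   on the two sides of Tonelli's theorem match: [p = r - m/2] and [p - 1 = m/2]. *)
pose p := (r + 1) / 2.
have p1 : 1 < p by rewrite /p ltr_pdivlMr//; lra.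
have [C1 C10 hC1] := kernel_head mw w0 sw WE Woo half01.
have [C2 C20 hC2] := kernel_tail mw w0 sw WE Woo p1.
pose C := (C1 `^ m * C2) `^ r^-1.
have CE (c : R) : 0 <= c -> (C * c) `^ r = C1 `^ m * (C2 * c `^ r).
  move=> c0; rewrite /C powRM ?powR_ge0// -powRrM mulVf ?gt_eqF//.
  by rewrite powRr1 ?mulrA// mulr_ge0 ?powR_ge0// ltW.
exists C; first by rewrite powR_gt0// mulr_gt0// powR_gt0.
move=> h K c mh h0 mK K0 hK c0.
rewrite qr /weighted_bound.
pose al t := t^-1 * w t * W t `^ (- p).
pose be s := s^-1 * (A s * h s) `^ r * W s `^ (m / 2).
have mal : measurable_fun D0 (al : Leb R -> R) := measurable_density_primitive mw w0 W0 WE (- p).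
have mW := measurable_primitive mw w0 W0 WE.
have mWp u : measurable_fun D0 ((fun s => W s `^ u) : Leb R -> R).
  exact: (measurableT_comp (measurable_powR _) mW).
have mAh : measurable_fun D0 ((fun s => (A s * h s) `^ r) : Leb R -> R).
  by apply: (measurableT_comp (measurable_powR _)); exact: measurable_funM mA mh.
have mbe : measurable_fun D0 (be : Leb R -> R).
  by apply: measurable_funM (mWp _); apply: measurable_funM mAh; exact: measurable_inv_pos.
have al0 (t : R) : 0 < t -> 0 <= al t.
  by move=> t0; rewrite !mulr_ge0 ?powR_ge0 ?invr_ge0 ?(ltW t0).
have be0 (t : R) : 0 < t -> 0 <= be t.
  by move=> t0; rewrite !mulr_ge0 ?powR_ge0 ?invr_ge0 ?(ltW t0).
pose X t := (\int[leb R]_(s in D0) (Num.min 1 (t / s) * be s)%:E)%E.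
have X0 (t : R) : 0 < t -> (0 <= X t)%E.
  by move=> t0; apply: integral_ge0 => s /D0P s0; rewrite lee_fin mulr_ge0 ?kmin ?be0.
have pt (t : R) : 0 < t -> ((t^-1 * (B t * K t) `^ r)%:E <=
    (C1 `^ m)%:E * ((al t)%:E * X t))%E.
  move=> t0.
  pose om s := Num.min 1 (t / s) * s^-1.
  pose F s := A s * h s * W s `^ (2^-1 / q').
  pose G s := (A s)^-1 * W s `^ (- (2^-1 / q')).
  have mom : measurable_fun D0 (om : Leb R -> R).
    by apply: measurable_funM; [exact: measurable_kernel_l|exact: measurable_inv_pos].
  have mF : measurable_fun D0 (F : Leb R -> R).
    by apply: measurable_funM (mWp _); exact: measurable_funM mA mh.
  have mG : measurable_fun D0 (G : Leb R -> R).
    apply: measurable_funM (mWp _).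
    apply: (eq_measurable_fun (fun x : Leb R => A x `^ (-1) : R)).
      by move=> x /set_mem/D0P x0; rewrite (powR_inv1 (ltW (A0 x0))).
    exact: (measurableT_comp (measurable_powR _) mA).
  have := weighted_hoelder (leb R) mD r0 q'0 rr' mom mF mG.
  have : forall x : R, D0 x -> [/\ 0 <= om x, 0 <= F x & 0 <= G x].
    move=> x /D0P x0; have Ax0 := ltW (A0 x0); split.
    - by apply: mulr_ge0; [exact: kmin|rewrite invr_ge0 ltW].
    - by apply: mulr_ge0 (powR_ge0 _ _); exact: mulr_ge0 Ax0 (h0 x x0).
    - by apply: mulr_ge0 (powR_ge0 _ _); rewrite invr_ge0.
  move=> /[swap] /[apply] hold.
  have e1 : (\int[leb R]_(x in D0) (om x * (F x * G x))%:E =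
      \int[leb R]_(s in D0) (Num.min 1 (t / s) * (s^-1 * h s))%:E)%E.
    apply: eq_integral => s /set_mem/D0P s0; congr (_%:E).
    rewrite /om /F /G -[LHS]mulrA; congr (_ * (_ * _)); rewrite powRN.
    have := powR_gt0 (2^-1 / q') (W0 s0); have := A0 s0.
    by move: (A s) (h s) (_ `^ _) => x z y x0 y0; field; rewrite !gt_eqF.
  have e2 : (\int[leb R]_(x in D0) (om x * F x `^ r)%:E = X t)%E.
    apply: eq_integral => s /set_mem/D0P s0; congr (_%:E).
    have Ah0 := mulr_ge0 (ltW (A0 s0)) (h0 s s0).
    rewrite /om /F /be (powRM _ Ah0 (powR_ge0 _ _)) -powRrM.
    have -> : 2^-1 / q' * r = m / 2 by rewrite /m; field; rewrite gt_eqF.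
    by rewrite -!mulrA.
  have e3 : (\int[leb R]_(x in D0) (om x * G x `^ q')%:E =
      \int[leb R]_(s in D0) (Num.min 1 (t / s) * (s^-1 * w s * W s `^ (- 2^-1)))%:E)%E.
    apply: eq_integral => s /set_mem/D0P s0; congr (_%:E).
    have As0 := ltW (A0 s0); have Ai0 : 0 <= (A s)^-1 by rewrite invr_ge0.
    rewrite /om /G (powRM _ Ai0 (powR_ge0 _ _)) -(powR_inv1 As0) -!powRrM mulN1r.
    have -> : - (2^-1 / q') * q' = - 2^-1 by field; rewrite gt_eqF.
    by rewrite -!mulrA.
  have {e1 e2 e3}hold := le_holder_eq e1 e2 e3 hold.
  have {}hold : ((K t)%:E <= X t `^ r^-1 * ((C1 * W t `^ (1 - 2^-1))%:E) `^ q'^-1)%E.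
    apply: (le_trans (hK t t0)); apply: (le_trans hold).
    apply: lee_wpmul2l; first exact: poweR_ge0.
    apply: le_poweR; [by rewrite invr_ge0 ltW| |exact: hC1].
    apply: integral_ge0 => s /D0P s0; rewrite lee_fin.
    apply: mulr_ge0; first exact: kmin.
    by rewrite !mulr_ge0 ?powR_ge0 ?invr_ge0 ?(ltW s0).
  have {hold} : ((K t `^ r)%:E <= X t * (C1 `^ m * W t `^ (m / 2))%:E)%E.
    by apply: (le_holder_pow (K0 t t0) C10 (W0 t0) (X0 t t0) r0); exact: hold.
  have aE : t^-1 * B t `^ r * W t `^ (m / 2) = al t.
    rewrite /al BE// qr inver gt_eqF//= powRM ?powR_ge0 ?invr_ge0 ?(ltW (W0 t0))//.
    rewrite -powRrM (_ : - (q' / r) * r = - q'); last by field; rewrite gt_eqF.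
    rewrite -(powR_inv1 (ltW (W0 t0))) -powRrM -/(w t) -!mulrA.
    congr (_ * (_ * _)); rewrite -powRD; last by rewrite (gt_eqF (W0 t0)) implybT.
    by congr (_ `^ _); rewrite mulrA -/m mE /p; field.
  have Br0 : 0 <= t^-1 * B t `^ r by rewrite mulr_ge0 ?powR_ge0 ?invr_ge0 ?ltW.
  move: (X t) => x hK2.
  rewrite (powRM _ (ltW (dual_weight_gt0 t0)) (K0 t t0)) mulrA EFinM.
  apply: (@le_trans _ _ ((t^-1 * B t `^ r)%:E * (x * (C1 `^ m * W t `^ (m / 2))%:E))%E).
    by apply: lee_wpmul2l hK2; rewrite lee_fin.
  rewrite -aE (muleC x) !muleA -!EFinM.
  by rewrite [X in (X%:E * _ <= _)%E](_ : _ = C1 `^ m * (t^-1 * B t `^ r * W t `^ (m / 2)))//; ring.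
move=> bA; have [mI [mI2 TE]] := tonelli_kernel mal mbe al0 be0.
have mIX : measurable_fun D0 (fun t : Leb R => ((al t)%:E * X t)%E) := mI.
apply: (@le_trans _ _ (\int[leb R]_(t in D0) ((C1 `^ m)%:E * ((al t)%:E * X t)))%E).
  apply: (ge0_le_integral _ mD).
  - by move=> t /D0P t0; rewrite lee_fin mulr_ge0 ?powR_ge0 ?invr_ge0 ?ltW.
  - apply/measurable_EFinP; apply: measurable_funM; first exact: measurable_inv_pos.
    apply: (measurableT_comp (measurable_powR _)).
    by apply: measurable_funM mK; exact: measurable_dual_weight.
  - exact: (measurable_funeM _ mIX).
  - by move=> t /D0P; exact: pt.
rewrite (ge0_integralZl _ mD mIX); last 2 first.
- by move=> t /D0P t0; apply: mule_ge0; [rewrite lee_fin al0|exact: X0].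
- by rewrite lee_fin powR_ge0.
rewrite /X TE.
have step : (\int[leb R]_(s in D0) ((be s)%:E *
    \int[leb R]_(t in D0) (Num.min 1 (t / s) * al t)%:E) <= C2%:E * (c `^ r)%:E)%E.
  apply: (@le_trans _ _ (\int[leb R]_(s in D0) (C2%:E * (s^-1 * (A s * h s) `^ r)%:E))%E).
    apply: (ge0_le_integral _ mD).
    - move=> s /D0P s0; apply: mule_ge0; first by rewrite lee_fin be0.
      apply: integral_ge0 => t /D0P t0; rewrite lee_fin.
      by apply: mulr_ge0; [exact: kmin|exact: al0].
    - exact: mI2.
    - apply: measurable_funeM; apply/measurable_EFinP.
      by apply: measurable_funM mAh; exact: measurable_inv_pos.
    - move=> s /D0P s0.
      apply: (@le_trans _ _ ((be s)%:E * (C2 * W s `^ (1 - p))%:E)%E).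
        by apply: lee_wpmul2l; [rewrite lee_fin be0|exact: hC2].
      rewrite -!EFinM lee_fin /be le_eqVlt; apply/orP; left; apply/eqP.
      have -> : 1 - p = - (m / 2) by rewrite mE /p; field.
      rewrite powRN; have := powR_gt0 (m / 2) (W0 s0).
      by move: (W s `^ _) => y y0; field; rewrite !gt_eqF.
  rewrite (ge0_integralZl _ mD); last 3 first.
  - apply/measurable_EFinP; apply: measurable_funM mAh; exact: measurable_inv_pos.
  - by move=> s /D0P s0; rewrite lee_fin mulr_ge0 ?powR_ge0 ?invr_ge0 ?ltW.
  - by rewrite lee_fin ltW.
  by apply: lee_wpmul2l bA; rewrite lee_fin ltW.
apply: (@le_trans _ _ ((C1 `^ m)%:E * (C2%:E * (c `^ r)%:E))%E).
  by apply: lee_wpmul2l step; rewrite lee_fin powR_ge0.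
by rewrite -!EFinM lee_fin (CE c c0).
Qed.

(** * Passing between the couples (X0, X1) and (X0, X0 /\ X1) *)

Section cap_couple_transfer.
Context {Z : topologicalLmodType R} (X : compatible_couple Z).
Local Notation Y := (cap_couple X).
Variable a : R -> R.
Hypothesis a0 : forall t : R, 0 < t -> 0 < a t.
Hypothesis ma : measurable_fun D0 (a : Leb R -> R).
Hypothesis sa : slow a.
Hypothesis aA : forall t : R, 0 < t -> t < 1 -> a t = A t.

Let a0w (t : R) : 0 < t -> 0 <= a t. Proof. by move=> t0; exact/ltW/a0. Qed.
Let Aa (t : R) : 0 < t -> t < 1 -> A t = a t. Proof. by move=> t0 t1; rewrite aA. Qed.

Lemma J_space_to_cap_couple (M : R) : 0 <= M ->
    (\int[leb R]_(t in D0) (t^-1 * a t `^ (- q'))%:E <= M%:E)%E ->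
  exists2 C : R, 0 < C & forall f, carrier (J_space X q a) f ->
    carrier (J_space Y q A) f /\
    (subnorm (J_space Y q A) f <= C%:E * subnorm (J_space X q a) f)%E.
Proof.
move=> M0 hM.
have hM' : (\int[leb R]_(t in D0) (t^-1 * (1 * a t `^ (-1)) `^ q')%:E <= M%:E)%E.
  apply: le_trans hM; rewrite le_eqVlt; apply/orP; left; apply/eqP.
  by apply: eq_integral => t _; rewrite mul1r -powRrM mulN1r.
have [C C0 H] := fold_transfer X (g := fun=> 1) q1 qq' a0 A0 sA ma mA aA
  (fun _ _ => ler01) (fun _ _ _ => erefl) (measurable_cst _) M0 hM'.
exists C => //; apply: (J_space_transfer q1 a0w A0w C0).
move=> u f c c0 uf uc; have [su _] := uf.
have mJ := measurable_J_functional su.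
have lo (s : R) : 0 < s -> s < 1 ->
    `|cap0 (u s)| <= J_functional (u s) s /\ s * `|u s| <= J_functional (u s) s.
  move=> s0 s1; split; first by rewrite /J_functional le_max lexx.
  rewrite norm_capE maxr_pMr ?(ltW s0)// ge_max /J_functional !le_max lexx orbT andbT.
  by rewrite ler_piMl ?(ltW s1).
have hi (s : R) : 1 <= s -> `|u s| <= 1 * J_functional (u s) s.
  move=> s1; rewrite mul1r norm_capE ge_max /J_functional !le_max lexx /=.
  by rewrite [X in _ || X]ler_peMl// orbT.
have [fin HL] := H u _ c (ltW c0) su mJ lo hi (fun s _ => J_functional_ge0 _ _) uc.
have [L Lf bL] := J_represents_bochner fin uf.
have [u' [phi' [su' bL' mphi' hphi' bphi']]] := HL L bL.
have sv : strongly_measurable (leb R) D0 (cap_of_cap \o u').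
  exact: strongly_measurable_comp (@cap_of_cap_continuous _ _ X) su'.
exists (cap_of_cap \o u').
  by rewrite -Lf; exact: (@bochner_J_represents _ _ Y (cap_of_cap \o u') L sv bL').
apply: (weighted_bound_le q1 mA mphi' mA (measurable_J_functional sv) _ bphi').
move=> t t0; have [h1 h2] := hphi' t t0; apply/andP; split.
  by apply: mulr_ge0; [exact: A0w|exact: J_functional_ge0].
by apply: ler_wpM2l (A0w t0) _ _ _; rewrite /J_functional ge_max h1.
Qed.

Lemma J_space_of_cap_couple : exists2 C : R, 0 < C &
  forall f, carrier (J_space Y q A) f -> carrier (J_space X q a) f /\
    (subnorm (J_space X q a) f <= C%:E * subnorm (J_space Y q A) f)%E.
Proof.
have q'1 : 1 <= q'.
  by case: (conjugate_cases q1 qq') => [[_ ->//]|[r _ [_ /ltW]]].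
have z01 : 0 <= (0 : R) < 1 by rewrite lexx ltr01.
have [H H0 hH] := kernel_head mw w0 sw WE Woo z01.
(* For the second couple [J(u, s) >= s |u|], whence the gain [1/s] beyond 1. *)
pose g (t : R) := Num.min 1 (1 / t).
have g0 (t : R) : 0 < t -> 0 <= g t.
  by move=> t0; rewrite le_min ler01 divr_ge0// ltW.
have g1 (t : R) : 0 < t -> t < 1 -> g t = 1.
  by move=> t0 t1; apply/min_idPl; rewrite ler_pdivlMr// mul1r ltW.
have mg : measurable_fun D0 (g : Leb R -> R) := measurable_kernel_l 1.
pose M := H * W 1 `^ (1 - 0).
have M0 : 0 <= M by apply: mulr_ge0; [exact: ltW|exact: powR_ge0].
have hM : (\int[leb R]_(t in D0) (t^-1 * (g t * A t `^ (-1)) `^ q')%:E <= M%:E)%E.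
  apply: le_trans (hH 1 ltr01); apply: (ge0_le_integral _ mD).
  - by move=> t /D0P t0; rewrite lee_fin mulr_ge0 ?powR_ge0// invr_ge0 ltW.
  - apply: (@measurable_bound_integrand R g (fun t => A t `^ (-1)) q'); first exact: mg.
    by apply: (@measurableT_comp _ _ _ _ _ _ (fun x : R => x `^ (-1)) _ (A : Leb R -> R)); [exact: measurable_powR|exact: mA].
  - apply/measurable_EFinP; apply: measurable_funM; first exact: mg.
    exact: (measurable_density_primitive mw w0 W0 WE).
  - move=> t /D0P t0; rewrite lee_fin oppr0 powRr0 mulr1.
    rewrite powRM ?g0 ?powR_ge0// -powRrM mulN1r -/(w t) mulrCA.
    apply: ler_wpM2r; first by rewrite mulr_ge0 ?invr_ge0 ?(ltW t0) ?(ltW (w0 t0)).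
    have gt0 : 0 < g t by rewrite lt_min ltr01 divr_gt0.
    rewrite -[leRHS]powRr1 ?(ltW gt0)//; apply: ger_powR => //.
    by rewrite gt0 ge_min lexx.
have [C C0 HC] := fold_transfer X q1 qq' A0 a0 sa mA ma Aa g0 g1 mg M0 hM.
exists C => //; apply: (J_space_transfer q1 A0w a0w C0).
move=> u f c c0 uf uc; have [su _] := uf.
have mJ := measurable_J_functional su.
have sv : strongly_measurable (leb R) D0 ((@cap1 _ _ Y) \o u : Leb R -> cap X).
  exact: strongly_measurable_comp (@cap1_continuous _ _ Y) su.
have J1 (s : R) : s * `|cap1 (u s)| <= J_functional (u s) s.
  by rewrite /J_functional le_max lexx orbT.
have lo (s : R) : 0 < s -> s < 1 -> `|cap0 (cap1 (u s) : cap X)| <= J_functional (u s) s /\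
    s * `|cap1 (u s)| <= J_functional (u s) s.
  move=> s0 s1; split; last exact: J1.
  by rewrite cap0_cap1 /J_functional le_max lexx.
have hi (s : R) : 1 <= s -> `|cap1 (u s)| <= g s * J_functional (u s) s.
  move=> s1; have s0 : 0 < s by apply: lt_le_trans s1.
  have -> : g s = 1 / s by apply/min_idPr; rewrite ler_pdivrMr// mul1r.
  by rewrite mul1r ler_pdivlMl.
have [fin HL] := HC ((@cap1 _ _ Y) \o u) _ c (ltW c0) sv mJ lo hi (fun s _ => J_functional_ge0 _ _) uc.
have E : (fun s : Leb R => (s^-1 : R) *: cap0 (u s)) =
   (fun s : Leb R => (s^-1 : R) *: cap0 (((@cap1 _ _ Y) \o u) s : cap X)).
  by apply/funext => s; rewrite /= cap0_cap1.
have finE : (\int[leb R]_(s in D0) `|(s^-1 : R) *: cap0 (u s)|%:E =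
    \int[leb R]_(s in D0) `|(s^-1 : R) *: cap0 (((@cap1 _ _ Y) \o u) s : cap X)|%:E)%E.
  by apply: eq_integral => s _; rewrite /= cap0_cap1.
rewrite -finE in fin; rewrite -E in HL.
have [L Lf bL] := J_represents_bochner fin uf.
have [u' [phi' [su' bL' mphi' hphi' bphi']]] := HL L bL.
exists u'; first by rewrite -Lf; exact: (bochner_J_represents su' bL').
apply: (weighted_bound_le q1 ma mphi' ma (measurable_J_functional su') _ bphi').
move=> t t0; have [h1 h2] := hphi' t t0; apply/andP; split.
  by apply: mulr_ge0; [exact: a0w|exact: J_functional_ge0].
apply: ler_wpM2l (a0w t0) _ _ _; rewrite /J_functional ge_max h1 /=.
apply: le_trans h2; apply: ler_wpM2l (ltW t0) _ _ _.
exact: ler_norm_cap1.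
Qed.

End cap_couple_transfer.

(** * From the J-space to the K-space *)

Section J_space_into_K_space.
Context {Z : topologicalLmodType R} (C : compatible_couple Z).

Lemma J_space_into_K_space : exists2 M : R, 0 < M &
  forall f, carrier (J_space C q A) f -> carrier (K_space C q B) f /\
    (subnorm (K_space C q B) f <= M%:E * subnorm (J_space C q A) f)%E.
Proof.
have [M M0 H] := hardy_kernel.
exists M => // f [[u0 uf0] Jf].
have fs : f \in sum_pred C by case: uf0 => _ [F <- _]; exact: sum_valP.
have B0 (t : R) : 0 < t -> 0 <= B t.
  by move=> t0; exact/ltW/dual_weight_gt0.
have K0 (t : R) : 0 < t -> 0 <= K_functional C f t.
  by move=> t0; apply: K_functional_ge0; exact: ltW.
have key c : 0 < c -> (J_norm C q A f < c%:E)%E -> (K_norm C q B f <= (M * c)%:E)%E.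
  move=> c0 /(J_norm_leP q1 A0w c0)[u uf uc]; have [su _] := uf.
  apply/weighted_norm_leP => //.
  - by apply: mulr_ge0; exact: ltW.
  - by move=> t t0; apply: mulr_ge0; [exact: B0|exact: K0].
  apply: (H _ _ c (measurable_J_functional su) _ (measurable_K_functional fs) K0 _ (ltW c0) uc).
  - by move=> t _; exact: J_functional_ge0.
  - by move=> t t0; exact: K_functional_le_kernel.
have main : (K_norm C q B f <= M%:E * J_norm C q A f)%E.
  apply: (lee_mul_approx M0 _ Jf); first exact: J_norm_ge0.
  exact: key.
split=> //; split=> //; apply: le_lt_trans main _.
have /fineK <- : J_norm C q A f \is a fin_num by rewrite ge0_fin_numE ?J_norm_ge0.
by rewrite -EFinM ltry.
Qed.

End J_space_into_K_space.

(** * Blocks of dyadic mass *)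

Let B0 := dual_weight_gt0.
Let mB := measurable_dual_weight.

Lemma conjugate_ge1 : 1 <= q'.
Proof. by case: (conjugate_cases q1 qq') => [[_ ->//]|[r _ [_ /ltW]]]. Qed.

(** Because [q'/q = q' - 1]. *)
Lemma dual_weightE (t : R) : 0 < t -> B t = A t `^ (1 - q') * (W t)^-1.
Proof.
move=> t0; rewrite BE//; congr (_ `^ _ * _).
have [[-> ->]|[r -> [r1 q'1 rr']]] := conjugate_cases q1 qq'.
  by rewrite invey /= mulr0 subrr oppr0.
have r0 : r != 0 by rewrite gt_eqF// (lt_trans _ r1).
have q'0 : q' != 0 by rewrite gt_eqF// (lt_trans _ q'1).
rewrite inver (negbTE r0) /=.
have -> : r^-1 = 1 - q'^-1 by rewrite -rr' addrK.
by field.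
Qed.

Let lift_integral (x y : R) : 0 < x -> x <= y ->
  (\int[leb R]_(t in `[x, y[) (t^-1 * w t)%:E = (W y - W x)%:E)%E.
Proof.
move=> x0 xy; have := primitive_split mw w0 WE x0 xy.
have : (0 <= \int[leb R]_(t in `[x, y[) (t^-1 * w t)%:E)%E.
  apply: integral_ge0 => t /=; rewrite in_itv /= => /andP[xt _].
  have t0 := lt_le_trans x0 xt.
  by rewrite lee_fin; apply: mulr_ge0; [rewrite invr_ge0 ltW|exact/ltW/w0].
case: integral => [s||]// _; rewrite -EFinD => -[->].
by congr (_%:E); rewrite addrC addKr.
Qed.

Let block_sub (x y : R) : 0 < x -> (`[x, y[%classic : set (Leb R)) `<=` D0.
Proof.
by move=> x0 t; rewrite /= !in_itv /= andbT => /andP[xt _]; exact: lt_le_trans xt.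
Qed.

Let mwt : measurable_fun D0 (fun t : Leb R => (t^-1 * w t)%:E).
Proof. exact/measurable_EFinP/(measurable_density mw). Qed.

(** Hoelder's inequality for [w phi] over the block [[x, y)], on which [w(t)/t] has
    mass [W x] and [phi >= phi x].  It covers all exponents, including [+oo], and
    shows how fast the K-functional decays at 0. *)
Lemma weighted_bound_block_value (phi : R -> R) (c x y : R) :
    measurable_fun D0 (phi : Leb R -> R) -> (forall t : R, 0 < t -> 0 <= phi t) ->
    (forall s t : R, 0 < s -> s <= t -> phi s <= phi t) ->
    0 <= c -> 0 < x -> x <= y -> W y = 2 * W x ->
    weighted_bound q B phi c ->
  phi x <= 2 * c * W x `^ q'^-1.
Proof.
move=> mphi phi0 phi_mono c0 x0 xy Wxy.
have W2 : 2 * W x - W x = W x by ring.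
have q'1 := conjugate_ge1; have q'0 : 0 < q' by apply: lt_le_trans q'1.
have y0 : 0 < y := lt_le_trans x0 xy.
have Wx0 := W0 x0.
have mE : measurable (`[x, y[%classic : set (Leb R)) := measurable_leb_itv _.
have ED := @block_sub x y x0.
pose M := W x * (2 * W x) `^ q'.
have M0 : 0 <= M by apply: mulr_ge0; [exact: ltW|exact: powR_ge0].
have hM : (\int[leb R]_(t in `[x, y[) (t^-1 * (w t * B t `^ (-1)) `^ q')%:E <= M%:E)%E.
  apply: (@le_trans _ _ (\int[leb R]_(t in `[x, y[)
     (((2 * W x) `^ q')%:E * (t^-1 * w t)%:E))%E).
    apply: (ge0_le_integral _ mE).
    - move=> t /ED/D0P t0; rewrite lee_fin.
      by apply: mulr_ge0; [rewrite invr_ge0 ltW|exact: powR_ge0].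
    - apply: (measurable_funS mD ED).
      apply: (@measurable_bound_integrand R w (fun t => B t `^ (-1)) q' mw).
      exact: (measurableT_comp (measurable_powR _) mB).
    - by apply: measurable_funeM; exact: (measurable_funS mD ED).
    - move=> t Et; have t0 := D0P (ED t Et).
      have ty : W t <= 2 * W x.
        rewrite -Wxy; apply: (primitive_mono mw w0 WE t0).
        by move: Et; rewrite /= in_itv /= => /andP[_ /ltW].
      rewrite -EFinM lee_fin [leRHS]mulrCA; apply: ler_wpM2l; first by rewrite invr_ge0 ltW.
      have -> : w t * B t `^ (-1) = A t `^ (-1) * W t.
        have At := A0 t0; have Wt := W0 t0.
        rewrite dual_weightE// powR_inv1; last first.
          by apply: mulr_ge0; [exact: powR_ge0|rewrite invr_ge0 ltW].
        rewrite invfM invrK mulrA -powRN; congr (_ * _).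
        rewrite /w -powRD; last by rewrite (gt_eqF At) implybT.
        by congr (_ `^ _); ring.
      rewrite powRM ?powR_ge0 ?(ltW (W0 t0))// -powRrM mulN1r -/(w t) mulrC.
      apply: ler_wpM2r; first exact/ltW/w0.
      apply: ge0_ler_powR => //; first exact: ltW.
        by rewrite nnegrE ltW// W0.
      by rewrite nnegrE mulr_ge0// ltW.
  rewrite (ge0_integralZl _ mE (measurable_funS mD ED mwt)); last 2 first.
  - move=> t /ED/D0P t0; rewrite lee_fin.
    by apply: mulr_ge0; [rewrite invr_ge0 ltW|exact/ltW/w0].
  - by rewrite lee_fin powR_ge0.
  rewrite lift_integral// -EFinM lee_fin Wxy /M.
  by rewrite W2 [leLHS]mulrC; exact: lexx.
have w0w (t : R) : 0 < t -> 0 <= w t by move=> t0; exact/ltW/w0.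
move=> hphi; have h := weighted_bound_hoelder q1 qq' mE ED B0 w0w phi0 mB mw mphi M0 c0 hM hphi.
have h2 : ((phi x * W x)%:E <= (M `^ q'^-1 * c)%:E)%E.
  apply: le_trans h.
  apply: (@le_trans _ _ (\int[leb R]_(t in `[x, y[) ((phi x)%:E * (t^-1 * w t)%:E))%E).
    rewrite (ge0_integralZl _ mE (measurable_funS mD ED mwt)); last 2 first.
    - move=> t /ED/D0P t0; rewrite lee_fin.
      by apply: mulr_ge0; [rewrite invr_ge0 ltW|exact/ltW/w0].
    - by rewrite lee_fin phi0.
    rewrite lift_integral// -EFinM lee_fin Wxy.
    by rewrite W2; exact: lexx.
  apply: (ge0_le_integral _ mE).
  - move=> t /ED/D0P t0; rewrite -EFinM lee_fin.
    apply: mulr_ge0; first exact: phi0.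
    by apply: mulr_ge0; [rewrite invr_ge0 ltW|exact/ltW/w0].
  - by apply: measurable_funeM; exact: (measurable_funS mD ED mwt).
  - apply: (measurable_funS mD ED); apply/measurable_EFinP.
    apply: measurable_funM; first exact: measurable_inv_pos.
    exact: measurable_funM.
  - move=> t Et; have t0 := D0P (ED t Et).
    rewrite -EFinM lee_fin mulrCA; apply: ler_wpM2l; first by rewrite invr_ge0 ltW.
    rewrite mulrC; apply: ler_wpM2l; first exact: w0w.
    by apply: phi_mono => //; move: Et; rewrite /= in_itv /= => /andP[].
move: h2; rewrite lee_fin /M powRM ?(ltW Wx0) ?powR_ge0// -powRrM mulfV ?gt_eqF// powRr1; last first.
  by rewrite mulr_ge0// ltW.
rewrite -ler_pdivlMr// => /le_trans; apply.
by rewrite ler_pdivrMr// le_eqVlt; apply/orP; left; apply/eqP; ring.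
Qed.

Lemma conjugate_exponent (r : R) : q = r%:E -> 1 < r /\ (1 - q') * r = - q'.
Proof.
move=> qr; have [[]|[r' ]] := conjugate_cases q1 qq'; first by rewrite qr.
rewrite qr => -[<-] [r1 q'1 rr']; split=> //.
have r0 : r != 0 by rewrite gt_eqF// (lt_trans _ r1).
have q'0 : q' != 0 by rewrite gt_eqF// (lt_trans _ q'1).
have e : q' * r * (r^-1 + q'^-1) = q' * r by rewrite rr' mulr1.
have e2 : q' * r * (r^-1 + q'^-1) = q' + r by field; rewrite q'0.
by rewrite mulrBl mul1r -e e2; ring.
Qed.

(** Over the block, [(B phi)^r >= w (phi x / (2 W x))^r], since
    [(A^(1-q'))^r = w]. *)
Lemma weighted_bound_block (r : R) (phi : R -> R) (x y : R) : q = r%:E ->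
    measurable_fun D0 (phi : Leb R -> R) -> (forall t : R, 0 < t -> 0 <= phi t) ->
    (forall s t : R, 0 < s -> s <= t -> phi s <= phi t) ->
    0 < x -> x <= y -> W y = 2 * W x ->
  (((phi x / (2 * W x)) `^ r * W x)%:E <=
    \int[leb R]_(t in `[x, y[) (t^-1 * (B t * phi t) `^ r)%:E)%E.
Proof.
move=> qr mphi phi0 phi_mono x0 xy Wxy.
have [r1 er] := conjugate_exponent qr.
have r0 : 0 < r by apply: lt_trans r1.
have W2 : 2 * W x - W x = W x by ring.
have Wx0 := W0 x0.
have mE : measurable (`[x, y[%classic : set (Leb R)) := measurable_leb_itv _.
have ED := @block_sub x y x0.
set k := phi x / (2 * W x).
have k0 : 0 <= k by apply: divr_ge0; [exact: phi0|rewrite mulr_ge0// ltW].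
apply: (@le_trans _ _ (\int[leb R]_(t in `[x, y[) ((k `^ r)%:E * (t^-1 * w t)%:E))%E).
  rewrite (ge0_integralZl _ mE (measurable_funS mD ED mwt)); last 2 first.
  - move=> t /ED/D0P t0; rewrite lee_fin.
    by apply: mulr_ge0; [rewrite invr_ge0 ltW|exact/ltW/w0].
  - by rewrite lee_fin powR_ge0.
  by rewrite lift_integral// -EFinM lee_fin Wxy W2; exact: lexx.
apply: (ge0_le_integral _ mE).
- move=> t /ED/D0P t0; rewrite -EFinM lee_fin; apply: mulr_ge0; first exact: powR_ge0.
  by apply: mulr_ge0; [rewrite invr_ge0 ltW|exact/ltW/w0].
- by apply: measurable_funeM; exact: (measurable_funS mD ED mwt).
- by apply: (measurable_funS mD ED); exact: measurable_bound_integrand.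
- move=> t Et; have t0 := D0P (ED t Et).
  move: Et; rewrite /= in_itv /= => /andP[xt ty].
  have Wt0 := W0 t0.
  rewrite -EFinM lee_fin mulrCA; apply: ler_wpM2l; first by rewrite invr_ge0 ltW.
  have -> : k `^ r * w t = (A t `^ (1 - q') * k) `^ r.
    by rewrite (powRM _ (powR_ge0 _ _) k0) -powRrM er mulrC.
  apply: ge0_ler_powR; first exact: ltW.
  - by rewrite nnegrE; apply: mulr_ge0; [exact: powR_ge0|].
  - by rewrite nnegrE; apply: mulr_ge0; [exact/ltW/B0|exact: phi0].
  rewrite dual_weightE// -mulrA; apply: ler_wpM2l; first exact: powR_ge0.
  rewrite mulrC /k; apply: ler_pM.
  - exact: phi0.
  - by rewrite invr_ge0 mulr_ge0// ltW.
  - exact: phi_mono.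
  - rewrite lef_pV2 ?posrE ?mulr_gt0//.
    by rewrite -Wxy; apply: (primitive_mono mw w0 WE t0); exact: ltW.
Qed.

Section steps.
Variables (y : nat -> R).
Hypothesis y0 : forall n, 0 < y n.
Hypothesis Wy : forall n, W (y n) = 2 * 2^-1 ^+ n.

Lemma points_dec (n : nat) : y n.+1 <= y n.
Proof.
rewrite leNgt; apply/negP => h.
have := primitive_mono mw w0 WE (y0 n) (ltW h).
rewrite !Wy exprS mulrA; apply/negP; rewrite -ltNge.
by rewrite ltr_pM2r ?exprn_gt0// mulfV// ltr1n.
Qed.

Lemma points_small (t : R) : 0 < t -> exists n, y n.+2 <= t.
Proof.
move=> t0; have [n hn] : exists n, 2^-1 ^+ n < W t.
  have [/= n _ hn] : \forall n \near \oo, 2^-1 ^+ n < W t.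
    have := @cvg_expr R 2^-1; rewrite gtr0_norm// invf_lt1// ltr1n => /(_ isT) h.
    by apply: (cvgr_lt _ h); exact: W0.
  by exists n; apply: hn => /=.
exists n; rewrite leNgt; apply/negP => h.
have := primitive_mono mw w0 WE t0 (ltW h).
apply/negP; rewrite -ltNge; apply: le_lt_trans hn.
by rewrite Wy !exprS !mulrA mulfV// mul1r ler_piMl ?exprn_ge0// invf_le1// ler1n.
Qed.

Let points_W (n : nat) : W (y n) = 2 * W (y n.+1).
Proof. by rewrite !Wy exprS; congr (2 * _); rewrite mulrA mulfV// mul1r. Qed.

(** The normalisation [W (y n) = 2 * 2^(-n)] is chosen for this mass. *)
Lemma points_mass (n : nat) :
  (\int[leb R]_(t in `[y n.+1, y n[) (t^-1 * w t)%:E = (2^-1 ^+ n)%:E)%E.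
Proof.
rewrite (lift_integral (y0 _) (points_dec n)) points_W; congr (_%:E).
by rewrite Wy exprS mulrA mulfV//; ring.
Qed.

Lemma step_ge0 (e : nat -> R) (t : R) :
  (forall n, 0 <= e n) -> 0 <= step (fun n => y n.+2) e t.
Proof. by move=> e0; rewrite /step; case: ifP. Qed.

Lemma measurable_step (e : nat -> R) : (forall n, 0 <= e n) ->
  measurable_fun D0 (step (fun n => y n.+2) e : Leb R -> R).
Proof.
move=> e0; have := strongly_measurable_norm (@completed_lebesgue_measure_is_complete R)
  (strongly_measurable_step (fun n => points_dec n.+2) points_small (e : nat -> R^o)).
by apply: eq_measurable_fun => t _; rewrite ger0_norm//; exact: step_ge0.
Qed.

Section step_bound.
Variables (phi : R -> R) (E c : R).
Hypothesis mphi : measurable_fun D0 (phi : Leb R -> R).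
Hypothesis phi0 : forall t : R, 0 < t -> 0 <= phi t.
Hypothesis phi_mono : forall s t : R, 0 < s -> s <= t -> phi s <= phi t.
Hypotheses (E0 : 0 < E) (c0 : 0 <= c).

Let k n := phi (y n.+1) / (2 * W (y n.+1)).
Let k0 n : 0 <= k n.
Proof.
by apply: divr_ge0; [exact: phi0|apply: mulr_ge0 => //; exact/ltW/W0].
Qed.
Let e n := E * k n.
Let e0 n : 0 <= e n.
Proof. by apply: mulr_ge0; [exact: ltW|]. Qed.
Let Phi t := w t * step (fun n => y n.+2) e t.

Lemma measurable_step_weight : measurable_fun D0 (Phi : Leb R -> R).
Proof. by apply: measurable_funM; [exact: mw|exact: measurable_step]. Qed.

Lemma step_weight_ge0 (t : R) : 0 < t -> 0 <= Phi t.
Proof. by move=> t0; apply: mulr_ge0; [exact/ltW/w0|exact: step_ge0]. Qed.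

Let sub_block n : (`[y n.+1, y n[%classic : set (Leb R)) `<=` D0.
Proof. exact: block_sub. Qed.

Let step_block_integral (r : R) (n : nat) : q = r%:E ->
  (\int[leb R]_(t in `[y n.+3, y n.+2[) (t^-1 * (A t * Phi t) `^ r)%:E <=
   (E `^ r)%:E * \int[leb R]_(t in `[y n.+1, y n[) (t^-1 * (B t * phi t) `^ r)%:E)%E.
Proof.
move=> qr; have [r1 er] := conjugate_exponent qr.
have mE : measurable (`[y n.+3, y n.+2[%classic : set (Leb R)) := measurable_leb_itv _.
apply: (@le_trans _ _ ((E `^ r)%:E * (k n `^ r * W (y n.+1))%:E)%E); last first.
  apply: lee_wpmul2l; first by rewrite lee_fin powR_ge0.
  exact: (weighted_bound_block qr mphi phi0 phi_mono (y0 _) (points_dec n) (points_W n)).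
have -> : (\int[leb R]_(t in `[y n.+3, y n.+2[) (t^-1 * (A t * Phi t) `^ r)%:E =
    \int[leb R]_(t in `[y n.+3, y n.+2[) ((e n `^ r)%:E * (t^-1 * w t)%:E))%E.
  apply: eq_integral => t /set_mem Et; have t0 := D0P (sub_block Et).
  have -> : Phi t = w t * e n.
    by rewrite /Phi (@step_block _ (fun n => y n.+2) (fun n => points_dec n.+2) _ _ n).
  rewrite -EFinM [in RHS]mulrCA; congr (_ * _)%:E.
  have Aw : A t * w t = A t `^ (1 - q').
    rewrite /w powRD; last by rewrite (gt_eqF (A0 t0)) implybT.
    by rewrite powRr1// ltW// A0.
  by rewrite [A t * _]mulrA Aw (powRM _ (powR_ge0 _ _) (e0 n)) -powRrM er mulrC.
rewrite (ge0_integralZl _ mE (measurable_funS mD (@sub_block n.+2) mwt)); last 2 first.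
- move=> t /sub_block/D0P t0; rewrite lee_fin.
  by apply: mulr_ge0; [rewrite invr_ge0 ltW|exact/ltW/w0].
- by rewrite lee_fin powR_ge0.
rewrite points_mass -!EFinM lee_fin /e (powRM _ (ltW E0) (k0 n)) -mulrA.
apply: ler_wpM2l; first exact: powR_ge0.
apply: ler_wpM2l; first exact: powR_ge0.
rewrite Wy !exprS mulrA.
have : 0 <= (2^-1 : R) ^+ n by rewrite exprn_ge0.
by move: (_ ^+ n) => z z0; lra.
Qed.

(** Both sides are sums over blocks.  On [[y (n+3), y (n+2))] the integrand of the
    left is [w(t)/t] times a constant, which is compared with the integral of
    [(B phi)^r] over [[y (n+1), y n)]; the second family of blocks is disjoint, so the
    sum of these integrals is at most the whole integral. *)
Lemma weighted_bound_step : weighted_bound q B phi c -> weighted_bound q A Phi (E * c).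
Proof.
have bound := @step_block_integral.
have [[qy q'1]|[r qr [r1 q'1 rr']]] := conjugate_cases q1 qq'.
  move=> h; rewrite /weighted_bound qy; apply: aeW => t /D0P t0.
  have -> : A t * Phi t = step (fun n => y n.+2) e t.
    rewrite /Phi mulrA /w q'1 powR_inv1 ?(ltW (A0 t0))// mulfV ?mul1r//.
    by rewrite gt_eqF// A0.
  have [h0|[n hn]] := step_cases (sg := fun n => y n.+2) points_small t0.
    by rewrite step0//; apply: mulr_ge0 => //; exact: ltW.
  rewrite (step_block (fun n => points_dec n.+2) _ hn); apply: ler_wpM2l; first exact: ltW.
  have := weighted_bound_block_value mphi phi0 phi_mono c0 (y0 _) (points_dec n) (points_W n) h.
  rewrite q'1 invr1 powRr1; last exact/ltW/W0.
  rewrite /k ler_pdivrMr; last by rewrite mulr_gt0// W0.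
  by rewrite mulrA [c * 2]mulrC.
rewrite /weighted_bound qr => h.
(* The set of index 0 is the part of the half-line where the step function
   vanishes. *)
pose F (n : nat) := if n is k.+1 then `[y k.+3, y k.+2[%classic else `[y 2, +oo[%classic : set (Leb R).
pose f (t : Leb R) := (t^-1 * (A t * Phi t) `^ r)%:E.
have mf : measurable_fun D0 f := measurable_bound_integrand r mA measurable_step_weight.
have f0 t : D0 t -> (0 <= f t)%E by move=> Dt; exact: bound_integrand_ge0.
have mF n : measurable (F n) by case: n => [|n]; exact: measurable_leb_itv.
have FD n : F n `<=` D0.
  case: n => [|n]; last exact: sub_block.
  by move=> t; rewrite /F /= !in_itv /= !andbT; exact: lt_le_trans.
have cover : D0 `<=` \bigcup_n F n.
  move=> t /D0P t0.
  have [h0|[n hn]] := step_cases (sg := fun n => y n.+2) points_small t0.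
    by exists 0%N => //; rewrite /F /= in_itv /= h0.
  by exists n.+1 => //; rewrite /F /= in_itv /=.
apply: le_trans (le_integral_cover (leb R) mD mD mF FD cover mf f0) _.
pose g (t : Leb R) := (t^-1 * (B t * phi t) `^ r)%:E.
have mg : measurable_fun D0 g := measurable_bound_integrand r mB mphi.
have g0 t : D0 t -> (0 <= g t)%E by move=> Dt; exact: bound_integrand_ge0.
have partial N : (\sum_(0 <= n < N.+1) \int[leb R]_(t in F n) f t <=
    (E `^ r)%:E * \int[leb R]_(t in `[y N, y 0[) g t)%E.
  elim: N => [|N IH].
    rewrite big_nat1 integral0_eq.
      by rewrite set_itvco0 integral_set0 mule0.
    move=> t; rewrite /F /= in_itv /= andbT => ht.
    rewrite /f /Phi step0// !mulr0 powR0 ?mulr0//.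
    by rewrite gt_eqF// (lt_trans _ r1).
  rewrite big_nat_recr//=.
  have split : `[y N.+1, y 0[%classic = `[y N.+1, y N[%classic `|` `[y N, y 0[%classic :> set (Leb R).
    rewrite -itv_bndbnd_setU// bnd_simp; first exact: points_dec.
    exact: (@step_points_le R y points_dec 0 N).
  rewrite split (ge0_integral_setU _ (measurable_leb_itv _) (measurable_leb_itv _)); last 3 first.
  - rewrite -split; apply: (measurable_funS mD) mg; exact: block_sub.
  - by rewrite -split => t /(block_sub (y0 _)) Dt; exact: g0.
  - apply/disj_setPS => t [] /=; rewrite !in_itv /= => /andP[_ tN] /andP[Nt _].
    by move: (lt_le_trans tN Nt); rewrite ltxx.
  rewrite ge0_muleDr; last 2 first.
  - by apply: integral_ge0 => t /sub_block Dt; exact: g0.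
  - by apply: integral_ge0 => t /(block_sub (y0 _)) Dt; exact: g0.
  rewrite addeC; apply: leeD IH; exact: bound.
apply: lime_le.
  apply: is_cvg_nneseries => n _ _; apply: integral_ge0 => t /FD; exact: f0.
exists 1%N => // -[//|N] _ /=.
apply: le_trans (partial N) _.
rewrite (powRM _ (ltW E0) c0) EFinM; apply: lee_wpmul2l; first by rewrite lee_fin powR_ge0.
apply: le_trans h; apply: (ge0_subset_integral _ (measurable_leb_itv _) mD mg g0).
exact: block_sub.
Qed.

End step_bound.
End steps.

(** * From the K-space to the J-space *)

Section construction.
Context {Z : topologicalLmodType R} (X : compatible_couple Z).
Local Notation Y := (cap_couple X).
Let cmp := @completed_lebesgue_measure_is_complete R.

Variables (y : nat -> R) (C1 : R).
Hypothesis y0 : forall n, 0 < y n.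
Hypothesis Wy : forall n, W (y n) = 2 * 2^-1 ^+ n.
Hypothesis C10 : 0 < C1.

Variables (L : space0 X) (c : R) (p : nat -> space0 X * cap X).
Let K := K_functional Y (emb0 X L).
Hypothesis c0 : 0 < c.
Hypothesis hK : weighted_bound q B K c.
Hypothesis p0 : p 0%N = (L, 0).
Hypothesis pL : forall n, L = (p n).1 + cap0 (p n).2.
Hypothesis pK : forall n, `|(p n).1| + y n.+1 * `|(p n).2| <= C1 * K (y n.+1).

Let K0 (t : R) : 0 < t -> 0 <= K t.
Proof. by move=> t0; apply: K_functional_ge0; exact: ltW. Qed.
Let mK : measurable_fun D0 (K : Leb R -> R).
Proof. exact: (measurable_K_functional (emb0_in_sum_cap L)). Qed.
Let K_mono (s t : R) : 0 < s -> s <= t -> K s <= K t.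
Proof.
by move=> s0; apply: K_functional_mono; [exact: (emb0_in_sum_cap L)|exact: ltW].
Qed.

Let sg n := y n.+2.
Let y_dec := points_dec y0 Wy.
Let sg_dec n : sg n.+1 <= sg n := y_dec n.+2.
Let sg_small (t : R) : 0 < t -> exists n, sg n <= t := points_small Wy (t := t).

Let g n : cap X := (p n.+1).2 - (p n).2.
(* The block [[y (n+3), y (n+2))] has mass [2^(-(n+2))]. *)
Let a n : cap Y := 2 ^+ n.+2 *: cap_of_cap (g n).
Let u (t : R) : cap Y := w t *: step sg a t.
(* [16 C1 (K / (2 W)) = 2^(n+2) (2 C1 K)] when [W = 2^(-n)]; see [e_val]. *)
Let E := 16 * C1.
Let E0 : 0 < E. Proof. by rewrite mulr_gt0. Qed.
Let e n := E * (K (y n.+1) / (2 * W (y n.+1))).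
Let Phi t := w t * step sg e t.

Let cap0_g n : cap0 (g n) = (p n).1 - (p n.+1).1.
Proof.
have pE m : cap0 (p m).2 = L - (p m).1 by rewrite {1}(pL m) addrC addKr.
by rewrite [LHS]linearB /= !pE opprB addrC addrA subrK.
Qed.

Let y_le n : y n.+1 <= y n := y_dec n.

Let K_le n : K (y n.+2) <= K (y n.+1).
Proof. exact: K_mono. Qed.

Let norm_p1 n : `|(p n).1| <= C1 * K (y n.+1).
Proof.
by apply: le_trans (pK n); rewrite lerDl; apply: mulr_ge0 => //; exact: ltW.
Qed.

Let norm_p2 n : `|(p n).2| <= C1 * K (y n.+1) / y n.+1.
Proof.
rewrite ler_pdivlMr// mulrC; apply: le_trans (pK n).
by rewrite lerDr.
Qed.

Let norm_cap0_g n : `|cap0 (g n)| <= 2 * C1 * K (y n.+1).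
Proof.
rewrite cap0_g; apply: le_trans (ler_normB _ _) _.
apply: le_trans (lerD (norm_p1 n) (norm_p1 n.+1)) _.
have := ler_wpM2l (ltW C10) (K_le n).
by move: (C1 * K (y n.+2)) => z; lra.
Qed.

Let norm_g n (t : R) : 0 < t -> t <= y n.+2 -> t * `|g n| <= 2 * C1 * K (y n.+1).
Proof.
move=> t0 ty.
apply: (@le_trans _ _ (t * (C1 * K (y n.+2) / y n.+2 + C1 * K (y n.+1) / y n.+1))).
  apply: ler_wpM2l (ltW t0) _ _ _; apply: le_trans (ler_normB _ _) _.
  by apply: lerD; exact: norm_p2.
have le1 (z b : R) : 0 <= z -> t <= b -> t * (z / b) <= z.
  move=> z0 tb; have b0 := lt_le_trans t0 tb.
  by rewrite mulrA ler_pdivrMr// mulrC; apply: ler_wpM2l.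
have CK n' : 0 <= C1 * K (y n'.+1) by apply: mulr_ge0; [exact: ltW|exact: K0].
rewrite mulrDr; apply: le_trans (lerD (le1 _ _ (CK _) ty) (le1 _ _ (CK _) (le_trans ty (y_le _)))) _.
have := ler_wpM2l (ltW C10) (K_le n).
by move: (C1 * K (y n.+2)) => z; lra.
Qed.

Let e_val n : e n = 2 ^+ n.+2 * (2 * C1 * K (y n.+1)).
Proof.
rewrite /e /E Wy.
have -> : 2 * (2 * 2^-1 ^+ n.+1) = 2 * 2^-1 ^+ n :> R by rewrite exprS; field.
rewrite invfM -exprVn invrK !exprS.
by field.
Qed.

Let J_le (t : R) : 0 < t -> J_functional (u t) t <= Phi t.
Proof.
move=> t0; have wt := ltW (w0 t0).
have JZ (r : R) (v : cap Y) : 0 <= r -> J_functional (r *: v) t = r * J_functional v t.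
  move=> r0; rewrite /J_functional [cap0 _]linearZ [cap1 _]linearZ !normrZ ger0_norm//.
  by rewrite [RHS]maxr_pMr// [t * _]mulrCA.
rewrite /u /Phi JZ//; apply: ler_wpM2l => //.
have [h0|[n hn]] := step_cases sg_small t0.
  by rewrite !step0// /J_functional [cap0 _]linear0 [cap1 _]linear0 !normr0 mulr0 maxxx.
rewrite !(step_block sg_dec _ hn) /a JZ ?exprn_ge0// e_val.
apply: ler_wpM2l; first by rewrite exprn_ge0.
rewrite ge_max norm_cap0_g /=; apply: norm_g => //.
by move: hn => /andP[_ /ltW].
Qed.

Let su : strongly_measurable (leb R) D0 (u : Leb R -> cap Y).
Proof.
exact: (strongly_measurableZ mD mw (strongly_measurable_step sg_dec sg_small a)).
Qed.

Let mPhi : measurable_fun D0 (Phi : Leb R -> R).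
Proof. exact: (measurable_step_weight y0 Wy K0 E0). Qed.
Let Phi0 (t : R) : 0 < t -> 0 <= Phi t.
Proof. exact: (step_weight_ge0 y0 K0 E0). Qed.
Let hPhi : weighted_bound q A Phi (E * c).
Proof. exact: (weighted_bound_step y0 Wy mK K0 K_mono E0 (ltW c0) hK). Qed.

Lemma construction_bound : weighted_bound q A (fun t => J_functional (u t) t) (E * c).
Proof.
apply: (weighted_bound_le q1 mA mPhi mA (measurable_J_functional su) _ hPhi).
move=> t t0; apply/andP; split.
  by apply: mulr_ge0; [exact/ltW/A0|exact: J_functional_ge0].
by apply: ler_wpM2l; [exact/ltW/A0|exact: J_le].
Qed.

Let cap0_le (s : R) : 0 < s -> `|cap0 (u s)| <= Phi s.
Proof.
by move=> s0; apply: le_trans (J_le s0); rewrite /J_functional le_max lexx.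
Qed.

Let tail (m : nat) (s : Leb R) : space0 Y :=
  if (s : R) < y m then (s^-1 : R) *: cap0 (u s) else 0.

Let su0 : strongly_measurable (leb R) D0 (fun s : Leb R => (s^-1 : R) *: cap0 (u s)).
Proof.
exact: (strongly_measurable_scale_inv
  (strongly_measurable_comp (@cap0_continuous _ _ Y) su)).
Qed.

Let stail m : strongly_measurable (leb R) D0 (tail m).
Proof.
have := strongly_measurable_mem mD (measurable_leb_itv `]-oo, y m[) su0.
congr (strongly_measurable _ _ _); apply/funext => s.
by rewrite /tail mem_setE.
Qed.

Let tail_le m :
  (\int[leb R]_(s in D0) `|tail m s|%:E <= (W (y m) `^ q'^-1 * (E * c))%:E)%E.
Proof.
have Ec0 : 0 <= E * c by apply: mulr_ge0; exact: ltW.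
have mI : measurable (`]0, y m[%classic : set (Leb R)) := measurable_leb_itv _.
have ID : (`]0, y m[%classic : set (Leb R)) `<=` D0.
  by move=> s; rewrite /= !in_itv /= andbT => /andP[].
have hM : (\int[leb R]_(t in `]0%R, y m[) (t^-1 * (1 * A t `^ (-1)) `^ q')%:E <=
    (W (y m))%:E)%E.
  rewrite -(WE (y0 m)) le_eqVlt; apply/orP; left; apply/eqP.
  by apply: eq_integral => t _; rewrite mul1r -powRrM mulN1r.
have h := weighted_bound_hoelder q1 qq' mI ID A0 (fun _ _ => ler01) Phi0 mA
  (measurable_cst _) mPhi (ltW (W0 (y0 m))) Ec0 hM hPhi.
apply: le_trans h.
have mg : measurable_fun D0 (fun s : Leb R => (s^-1 * (1 * Phi s))%:E).
  apply/measurable_EFinP; apply: measurable_funM; first exact: measurable_inv_pos.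
  by apply: measurable_funM; [exact: measurable_cst|exact: mPhi].
rewrite -[in leRHS](setIidr ID) integral_mkcondr.
apply: (ge0_le_integral _ mD).
- by move=> s _; rewrite lee_fin.
- by apply/measurable_EFinP; exact: (strongly_measurable_norm cmp (stail m)).
- apply/(measurable_restrict _ mI mD).
  by apply: (measurable_funS mD _ mg); exact: subIsetl.
- move=> s /D0P s0; rewrite patchE mem_setE /= in_itv /= s0 /= /tail.
  case: ifP => _; last by rewrite normr0.
  rewrite lee_fin mul1r normrZ gtr0_norm ?invr_gt0//.
  by apply: ler_wpM2l; [rewrite invr_ge0 ltW|exact: cap0_le].
Qed.

Let telescope N : \sum_(n < N) 2^-1 ^+ n.+2 *: cap0 (a n) = L - (p N).1 :> space0 Y.
Proof.
elim: N => [|N IH]; first by rewrite big_ord0 p0 subrr.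
rewrite big_ord_recr /= IH /a [cap0 _]linearZ scalerA -exprMn mulVf// expr1n scale1r.
by rewrite [X in _ + X]cap0_g addrA subrK.
Qed.

Let value_dist (L' : space0 Y) (N : nat) :
  is_bochner_integral (leb R) D0 (fun s : Leb R => (s^-1 : R) *: cap0 (u s)) L' ->
  `|L' - L| <= C1 * K (y N.+1) + W (y N.+2) `^ q'^-1 * (E * c).
Proof.
move=> bL'.
have mdens := measurable_density mw.
have dens0 (t : R) : 0 < t -> 0 <= t^-1 * w t.
  by move=> t0; apply: mulr_ge0; [rewrite invr_ge0 ltW|exact/ltW/w0].
have bN := bochner_truncated_step sg_dec (fun n => cap0 (a n)) mdens dens0
  (fun n => y0 n.+2) (fun n => points_mass y0 Wy n.+2) N.
rewrite telescope in bN.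
have [l bl] := bochner_integral_exists mD cmp (stail N.+2) (le_lt_trans (tail_le _) (ltry _)).
have EL : L' = L - (p N).1 + l.
  apply: (bochner_integral_unique mD cmp bL').
  apply: (eq_bochner_integral _ (bochner_integralD mD cmp bN bl)).
  apply/funext => s; rewrite /= /truncated_step /tail -/(sg N).
  have us : cap0 (u s) = w s *: step sg (fun n => cap0 (a n)) s.
    rewrite /u [LHS]linearZ; congr (_ *: _).
    by apply: (@step_map _ _ _ _ (@cap0 _ _ Y)); exact: linear0.
  case: ifP => _; first by rewrite scaler0 add0r.
  by rewrite addr0 us scalerA.
have -> : L' - L = - (p N).1 + l by rewrite EL addrAC [L - _]addrC addrK.
apply: le_trans (ler_normD _ _) _; apply: lerD; first by rewrite normrN; exact: norm_p1.
rewrite -lee_fin; apply: le_trans (tail_le _).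
exact: (bochner_integral_norm_le mD cmp bl).
Qed.

Lemma construction_represents : @J_represents R Z Y u (emb0 X L).
Proof.
have q'1 := conjugate_ge1.
have q'0 : 0 < q'^-1 by rewrite invr_gt0 (lt_le_trans ltr01).
pose rho : R := 2^-1 `^ q'^-1.
have rho1 : 0 <= rho < 1.
  rewrite powR_ge0 /=; have <- : (1 : R) `^ q'^-1 = 1 by rewrite powR1.
  by apply: gt0_ltr_powR => //; rewrite ?nnegrE ?invr_ge0// invf_lt1// ltr1n.
pose D := (C1 * (2 * c) + E * c).
have W1 n : W (y n.+1) = 2^-1 ^+ n by rewrite Wy exprS mulrA mulfV// mul1r.
have rhoE n : (2^-1 ^+ n) `^ q'^-1 = rho ^+ n.
  by apply: powR_exprn; rewrite invr_ge0.
have fin : (\int[leb R]_(s in D0) `|(s^-1 : R) *: cap0 (u s)|%:E < +oo)%E.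
  apply: le_lt_trans (le_trans _ (tail_le 2)) (ltry _).
  rewrite le_eqVlt; apply/orP; left; apply/eqP; apply: eq_integral => s _.
  rewrite /tail; case: ltP => // h.
  by rewrite /u step0// scaler0 [cap0 _]linear0 scaler0.
have [L' bL'] := bochner_integral_exists mD cmp su0 fin.
suff LL : L' = L.
  by rewrite -LL; exact: (@bochner_J_represents _ _ Y u L' su bL').
have c0' := ltW c0.
have dist N : `|L' - L| <= D * rho ^+ N.
  apply: le_trans (value_dist N bL') _.
  have KW : K (y N.+1) <= 2 * c * rho ^+ N.
    rewrite -rhoE -W1.
    apply: (weighted_bound_block_value mK K0 K_mono c0' (y0 _) (y_dec N)); last exact: hK.
    by rewrite !Wy exprS; congr (2 * _); rewrite mulrA mulfV// mul1r.
  have WW : W (y N.+2) `^ q'^-1 <= rho ^+ N.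
    rewrite W1 rhoE exprS; case/andP: rho1 => r0 r1.
    by rewrite ler_piMl ?exprn_ge0// ltW.
  rewrite /D mulrDl; apply: lerD.
    by rewrite -mulrA; apply: ler_wpM2l; [exact: ltW|].
  by rewrite mulrC; apply: ler_wpM2l => //; apply: mulr_ge0 => //; exact: ltW.
apply/eqP; rewrite -subr_eq0 -normr_le0 leNgt; apply/negP => pos.
have D0' : 0 < D by rewrite /D addr_gt0// ?mulr_gt0.
have [n _ hn] : \forall n \near \oo, rho ^+ n < `|L' - L| / D.
  have := @cvg_expr R rho; case/andP: rho1 => r0 r1.
  rewrite ger0_norm// => /(_ r1) h.
  by apply: (cvgr_lt _ h); rewrite divr_gt0.
have := hn n (leqnn n); rewrite /= ltr_pdivlMr// mulrC ltNge.
by rewrite dist.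
Qed.

End construction.

Section K_space_into_J_space.
Context {Z : topologicalLmodType R} (X : compatible_couple Z).
Local Notation Y := (cap_couple X).

Let zero_represents : @J_represents R Z Y (fun=> 0) (emb0 X 0).
Proof.
have cmp := @completed_lebesgue_measure_is_complete R.
have sz : strongly_measurable (leb R) D0 (fun=> (0 : cap Y)).
  exact: (strongly_measurable_finite (leb R) (finite_valued_cst _ mD)).
apply: (@bochner_J_represents _ _ Y _ 0 sz).
have z0 (x : Leb R) : D0 x -> 0 <= (0 : R) by [].
have zf : (\int[leb R]_(x in D0) (0%R)%:E < +oo)%E by rewrite integral0 ltry.
have := bochner_integralZ mD cmp (0 : space0 Y) (measurable_cst (0 : R)) z0 zf.
rewrite scaler0; apply: eq_bochner_integral.
by apply/funext => t; rewrite scaler0 [cap0 _]linear0 scaler0.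
Qed.

Lemma K_space_into_J_space : exists2 M : R, 0 < M &
  forall f, carrier (K_space Y q B) f -> carrier (J_space Y q A) f /\
    (subnorm (J_space Y q A) f <= M%:E * subnorm (K_space Y q B) f)%E.
Proof.
have /choice[y yP] (n : nat) : exists x : R, 0 < x /\ W x = 2 * 2^-1 ^+ n.
  have [|x x0 xE] := primitive_surj mw w0 sw WE Woo (c := 2 * 2^-1 ^+ n).
    by rewrite mulr_gt0// exprn_gt0.
  by exists x.
have y0 n : 0 < y n by have [] := yP n.
have Wy n : W (y n) = 2 * 2^-1 ^+ n by have [] := yP n.
pose m := Num.min 1 (y 1%N).
have m0 : 0 < m by rewrite lt_min ltr01 y0.
(* The second term pays for the decomposition [f = f + 0] at the point
   [y 1], where [K(f, y 1) >= m |f|]. *)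
pose C1 := Num.max 2 m^-1.
have C10 : 0 < C1 by rewrite lt_max ltr0n.
pose E := 16 * C1.
have E0 : 0 < E by rewrite mulr_gt0.
have B0w (t : R) : 0 < t -> 0 <= B t by move=> t0; exact/ltW/B0.
exists E => // f [fs Kf]; have [L fL] := sum_capP fs.
have K0 (t : R) : 0 < t -> 0 <= K_functional Y f t.
  by move=> t0; apply: K_functional_ge0; exact: ltW.
have key c : 0 < c -> (K_norm Y q B f < c%:E)%E ->
    exists2 u : R -> cap Y, J_represents u f &
    weighted_bound q A (fun t => J_functional (u t) t) (E * c).
  move=> c0 /ltW Kc.
  have /weighted_norm_leP hK : (weighted_norm q B (K_functional Y f) <= c%:E)%E := Kc.
  have {}hK : weighted_bound q B (K_functional Y f) c.
    apply: hK => //; first exact: ltW.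
    by move=> t t0; apply: mulr_ge0; [exact: B0w|exact: K0].
  (* The choice of nearly optimal decompositions needs [K(f, t) > 0]; for [f = 0]
     the zero function is a representation. *)
  have [L0|L0] := eqVneq L 0.
    exists (fun=> 0); first by rewrite fL L0; exact: zero_represents.
    apply: (@weighted_bound_widen _ _ _ _ c) => //; first exact: ltW.
      rewrite ler_peMl ?(ltW c0)// /E.
      have : 2 <= C1 by rewrite le_max lexx.
      by lra.
    have sz : strongly_measurable (leb R) D0 ((fun=> 0) : Leb R -> cap Y).
      exact: (strongly_measurable_finite (leb R) (finite_valued_cst _ mD)).
    apply: (weighted_bound_le q1 mB (measurable_K_functional fs) mA (measurable_J_functional sz) _ hK).
    move=> t t0; have -> : J_functional (0 : cap Y) t = 0.
      by rewrite /J_functional [cap0 _]linear0 [cap1 _]linear0 !normr0 mulr0 maxxx.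
    by rewrite mulr0 lexx; apply: mulr_ge0; [exact: B0w|exact: K0].
  rewrite fL in hK *.
  have /choice[p0 p0P] (n : nat) := near_optimal_decomp (y0 n.+1) L0.
  pose p (n : nat) := if n is _.+1 then p0 n else (L, 0).
  have pL n : L = (p n).1 + cap0 (p n).2.
    by case: n => [|n] /=; [rewrite linear0 addr0|have [] := p0P n.+1].
  have pK n : `|(p n).1| + y n.+1 * `|(p n).2| <=
      C1 * K_functional Y (emb0 X L) (y n.+1).
    case: n => [|n] /=.
      rewrite normr0 mulr0 addr0.
      apply: (@le_trans _ _ (m^-1 * (m * `|L|))).
        by rewrite mulrA mulVf ?gt_eqF// mul1r.
      apply: ler_pM; [by rewrite invr_ge0 ltW|by rewrite mulr_ge0// ltW| |].
        by rewrite /C1 le_max lexx orbT.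
      exact: K_functional_cap_ge.
    have [_ h] := p0P n.+1; apply: le_trans h _.
    apply: ler_wpM2r; first by apply: K_functional_ge0; exact: ltW.
    by rewrite /C1 le_max lexx.
  have h1 := construction_bound y0 Wy C10 c0 hK pL pK.
  have h2 := construction_represents y0 Wy C10 c0 hK erefl pL pK.
  by eexists; [exact: h2|exact: h1].
have norm_le c : 0 < c -> (K_norm Y q B f < c%:E)%E ->
    (J_norm Y q A f <= (E * c)%:E)%E.
  move=> c0 /(key c c0)[u uf uc].
  by apply: (J_norm_le q1 A0w _ uf uc); apply: mulr_ge0; exact: ltW.
have K00 : (0 <= K_norm Y q B f)%E by exact: weighted_norm_ge0.
have main : (J_norm Y q A f <= E%:E * K_norm Y q B f)%E.
  exact: (lee_mul_approx E0 K00 Kf norm_le).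
have kf : K_norm Y q B f \is a fin_num by rewrite ge0_fin_numE.
split=> //; split; last first.
  by apply: le_lt_trans main _; rewrite -(fineK kf) -EFinM ltry.
have k0 : 0 < fine (K_norm Y q B f) + 1 by rewrite ltr_wpDl// fine_ge0.
have [|u uf _] := key _ k0; last by exists u.
by rewrite -[X in (X < _)%E](fineK kf) lte_fin ltrDl.
Qed.

End K_space_into_J_space.

End dual_weights.

(** * The two equalities *)

Section primitive_of_weight.
Context {R : realType}.
Local Notation D0 := (`]0, +oo[%classic : set (Leb R)).
Let mD : measurable D0 := measurable_leb_itv _.
Let D0P (t : R) : D0 t -> 0 < t.
Proof. by rewrite /= in_itv /= andbT. Qed.

(** By slow variation the density is bounded on compact subintervals. *)
Lemma density_integrable_away (w : R -> R) (x y : R) :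
    measurable_fun D0 (w : Leb R -> R) -> (forall t : R, 0 < t -> 0 < w t) ->
    slow w -> 0 < x -> x <= y ->
  (\int[leb R]_(t in `[x, y[) (t^-1 * w t)%:E < +oo)%E.
Proof.
move=> mw w0 sw x0 xy; have [H H0 hH] := sw 1 ltr01.
have y0 := lt_le_trans x0 xy.
pose b := x^-1 * (H * (y / x) * w x).
have b0 : 0 <= b.
  by apply: mulr_ge0; [rewrite invr_ge0 ltW|rewrite !mulr_ge0 ?invr_ge0 ?ltW// w0].
apply: le_lt_trans (integral_density_le mw w0 x0 xy (L := b) _ b0) (ltry _).
move=> t /andP[xt ty]; have t0 := lt_le_trans x0 xt.
apply: ler_pM; [by rewrite invr_ge0 ltW|exact/ltW/w0| |].
  by rewrite lef_pV2 ?posrE.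
have [_ h] := hH x t x0 xt; apply: le_trans h _.
apply: ler_wpM2r; first exact/ltW/w0.
apply: ler_wpM2l; first exact: ltW.
rewrite powRr1; last by rewrite divr_ge0// ltW.
by rewrite ler_pM2r ?invr_gt0// ltW.
Qed.

Lemma primitive_finite (w : R -> R) :
    measurable_fun D0 (w : Leb R -> R) -> (forall t : R, 0 < t -> 0 < w t) ->
    slow w -> (\int[leb R]_(t in `]0%R, 1%R[) (t^-1 * w t)%:E < +oo)%E ->
  forall x : R, 0 < x -> (\int[leb R]_(t in `]0%R, x[) (t^-1 * w t)%:E =
    (\int[leb R]_(t in `]0%R, x[) (t^-1 * w t))%:E)%E.
Proof.
move=> mw w0 sw fin1 x x0.
have g0 (t : R) : 0 < t -> (0 <= (t^-1 * w t)%:E)%E.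
  by move=> t0; rewrite lee_fin mulr_ge0 ?invr_ge0 ?ltW ?w0.
rewrite /Rintegral fineK//; rewrite ge0_fin_numE; last first.
  by apply: integral_ge0 => t /=; rewrite in_itv /= => /andP[t0 _]; exact: g0.
pose z := Num.max 1 x.
have z1 : 1 <= z by rewrite le_max lexx.
have zx : x <= z by rewrite le_max lexx orbT.
have subD (i : R) : (`]0, i[%classic : set (Leb R)) `<=` D0.
  by move=> t; rewrite /= !in_itv /= andbT => /andP[].
have sub1 : (`[1, z[%classic : set (Leb R)) `<=` D0.
  by move=> t; rewrite /= !in_itv /= andbT => /andP[h _]; exact: lt_le_trans h.
have md (E : set (Leb R)) : E `<=` D0 ->
    measurable_fun E (fun t : Leb R => (t^-1 * w t)%:E).
  exact: (measurable_density_sub mw).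
apply: (@le_lt_trans _ _ (\int[leb R]_(t in `]0%R, z[) (t^-1 * w t)%:E)%E).
  apply: (ge0_subset_integral _ (measurable_leb_itv _) (measurable_leb_itv _) (md _ (@subD z))).
    by move=> t /subD/D0P; exact: g0.
  by move=> t; rewrite /= !in_itv /= => /andP[-> h]; exact: lt_le_trans zx.
have -> : `]0, z[%classic = `]0%R, 1%R[%classic `|` `[1, z[%classic :> set (Leb R).
  by rewrite -itv_bndbnd_setU// bnd_simp.
rewrite (ge0_integral_setU _ (measurable_leb_itv _) (measurable_leb_itv _)); last 3 first.
- by apply: md => t [/subD|/sub1].
- by move=> t [/subD/D0P|/sub1/D0P]; exact: g0.
- apply/disj_setPS => t [] /=; rewrite !in_itv /= => /andP[_ tN] /andP[Nt _].
  by move: (lt_le_trans tN Nt); rewrite ltxx.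
by apply: (lte_add_pinfty fin1); exact: (density_integrable_away mw w0 sw ltr01 z1).
Qed.

(** If [W] were bounded by [c], the integrals over the blocks
    [[2 2^k, 2 2^(k+1))] would have partial sums at most [c]. *)
Lemma primitive_unbounded (w W : R -> R) :
    measurable_fun D0 (w : Leb R -> R) -> (forall t : R, 0 < t -> 0 < w t) ->
    (forall x : R, 0 < x -> (\int[leb R]_(t in `]0%R, x[) (t^-1 * w t)%:E = (W x)%:E)%E) ->
    (\int[leb R]_(t in `[2%R, +oo[) (t^-1 * w t)%:E = +oo)%E ->
  forall c : R, exists2 x : R, 0 < x & c < W x.
Proof.
move=> mw w0 WE inf2 c; apply: contrapT => nex.
have Wc (x : R) : 0 < x -> W x <= c.
  by move=> x0; rewrite leNgt; apply/negP => h; apply: nex; exists x.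
pose s (k : nat) : R := 2 * 2 ^+ k.
have s0 k : 0 < s k by rewrite mulr_gt0// exprn_gt0.
have sS k : s k <= s k.+1.
  by rewrite /s exprS ler_pM2l// ler_peMl ?exprn_ge0// ler1n.
pose F (k : nat) := `[s k, s k.+1[%classic : set (Leb R).
have FD k : F k `<=` D0.
  by move=> t; rewrite /F /= !in_itv /= andbT => /andP[h _]; exact: lt_le_trans h.
have mF k : measurable (F k) by exact: measurable_leb_itv.
have cover : (`[2, +oo[%classic : set (Leb R)) `<=` \bigcup_k F k.
  move=> t; rewrite /= in_itv /= andbT => t2.
  have [k /andP[k1 k2]] := dyadic_up (ltr0n R 2) t2.
  by exists k => //; rewrite /F /= in_itv /= k1 /s exprS mulrCA k2.
pose d (t : Leb R) := (t^-1 * w t)%:E.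
have md : measurable_fun D0 d := measurable_density_sub mw (@subset_refl _ D0).
have d0 t : D0 t -> (0 <= d t)%E.
  by move=> /D0P t0; rewrite lee_fin mulr_ge0 ?invr_ge0 ?ltW ?w0.
have h := le_integral_cover (leb R) mD (measurable_leb_itv _) mF FD cover md d0.
have partial N : (\sum_(0 <= k < N) \int[leb R]_(t in F k) d t + (W (s 0%N))%:E =
    (W (s N))%:E)%E.
  elim: N => [|N IH]; first by rewrite big_geq// add0e.
  rewrite big_nat_recr//= addeAC IH.
  by rewrite (primitive_split mw w0 WE (s0 N) (sS N)).
have : (\int[leb R]_(t in `[2%R, +oo[) d t <= c%:E)%E.
  apply: le_trans h _; apply: lime_le.
    apply: is_cvg_nneseries => n _ _; apply: integral_ge0 => t /FD; exact: d0.
  apply: nearW => N; apply: (@le_trans _ _ (W (s N))%:E); last first.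
    by rewrite lee_fin; exact: Wc.
  rewrite -partial leeDl// -(WE _ (s0 0%N)); apply: integral_ge0 => t.
  by rewrite /= in_itv /= => /andP[t0 _]; apply: d0; rewrite /= in_itv /= t0.
by rewrite inf2.
Qed.

End primitive_of_weight.

Theorem theorem1p15 (R : realType) (Z : topologicalLmodType R)
    (X : compatible_couple Z) (q : \bar R) (q' : R)
    (a alpha A B : R -> R) :
  (1 < q)%E ->
  q'%:E = hoelder_conjugate q ->
  slowly_varying a ->
  (\int[leb R]_(t in `]0%R, +oo[) (t^-1 * a t `^ (- q'))%:E < +oo)%E ->
  slowly_varying alpha ->
  (forall x : R, 0 < x ->
    (\int[leb R]_(t in `]0%R, x[) (t^-1 * alpha t `^ (- q'))%:E < +oo)%E) ->
  (\int[leb R]_(t in `]0%R, +oo[) (t^-1 * alpha t `^ (- q'))%:E = +oo)%E ->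
  slowly_varying A ->
  (forall x : R, 0 < x <= 1 -> A x = a x) ->
  approx_on `]1, +oo[ A alpha ->
  (forall x : R, 0 < x ->
    B x = A x `^ (- (q' * fine q^-1%E)) *
          (\int[leb R]_(t in `]0, x[) (t^-1 * A t `^ (- q')))^-1) ->
  same_space (J_space X q a) (J_space (cap_couple X) q A) /\
  same_space (J_space (cap_couple X) q A) (K_space (cap_couple X) q B).
Proof.
move=> q1 qq' sva ia svalpha ialpha ialpha_oo svA Aa [k [k' [k0 k'0 hA]]] BE.
have mD : measurable (`]0, +oo[%classic : set (Leb R)) := measurable_leb_itv _.
have [a0 ma _] := sva; have [A0 mA _] := svA; have [alpha0 malpha _] := svalpha.
have sa := slowly_varying_slow sva; have sA := slowly_varying_slow svA.
have q'1 := conjugate_ge1 q1 qq'.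
have q'0 : 0 < q' := lt_le_trans ltr01 q'1.
have aA (t : R) : 0 < t -> t < 1 -> a t = A t.
  by move=> t0 t1; rewrite Aa// t0 ltW.
pose w t := A t `^ (- q').
have w0 (t : R) : 0 < t -> 0 < w t by move=> t0; exact/powR_gt0/A0.
have mpow (f : R -> R) : measurable_fun (`]0, +oo[ : set (Leb R)) (f : Leb R -> R) ->
    measurable_fun (`]0, +oo[ : set (Leb R)) ((fun t => f t `^ (- q')) : Leb R -> R).
  by move=> mf; exact: (measurableT_comp (measurable_powR _) mf).
have mw := mpow _ mA.
have sw : slow w := slow_powR _ A0 sA.
have D0P (t : R) : (`]0, +oo[%classic : set R) t -> 0 < t.
  by rewrite /= in_itv /= andbT.
have dens0 (f : R -> R) : (forall t : R, 0 < t -> 0 < f t) ->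
    forall t : R, 0 < t -> (0 <= (t^-1 * f t `^ (- q'))%:E)%E.
  by move=> f0 t t0; rewrite lee_fin mulr_ge0 ?invr_ge0 ?ltW ?powR_gt0 ?f0.
have md (f : R -> R) : measurable_fun (`]0, +oo[ : set (Leb R)) (f : Leb R -> R) ->
    measurable_fun (`]0, +oo[ : set (Leb R)) (fun t : Leb R => (t^-1 * f t `^ (- q'))%:E).
  by move=> mf; exact: (measurable_density_sub (mpow _ mf) (@subset_refl _ _)).
have sub01 : (`]0%R, 1%R[%classic : set (Leb R)) `<=` `]0, +oo[%classic.
  by move=> t; rewrite /= !in_itv /= andbT => /andP[].
have fin1 : (\int[leb R]_(t in `]0%R, 1%R[) (t^-1 * w t)%:E < +oo)%E.
  apply: le_lt_trans ia.
  apply: (@le_trans _ _ (\int[leb R]_(t in `]0%R, 1%R[) (t^-1 * a t `^ (- q'))%:E)%E).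
    rewrite le_eqVlt; apply/orP; left; apply/eqP; apply: eq_integral => t /set_mem.
    by rewrite /= in_itv /= => /andP[t0 t1]; rewrite /w aA.
  apply: (ge0_subset_integral _ (measurable_leb_itv _) mD (md _ ma) _ sub01).
  by move=> t /D0P; exact: dens0.
pose W x := (\int[leb R]_(t in `]0%R, x[) (t^-1 * w t))%R.
have WE (x : R) : 0 < x -> (\int[leb R]_(t in `]0%R, x[) (t^-1 * w t)%:E = (W x)%:E)%E.
  exact: (primitive_finite mw w0 sw fin1).
have tail_alpha : (\int[leb R]_(t in `[2%R, +oo[) (t^-1 * alpha t `^ (- q'))%:E = +oo)%E.
  have sub2 : (`]0%R, 2%R[%classic : set (Leb R)) `<=` `]0, +oo[%classic.
    by move=> t; rewrite /= !in_itv /= andbT => /andP[].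
  have E2 : `]0%R, +oo[%classic = `]0%R, 2%R[%classic `|` `[2%R, +oo[%classic :> set (Leb R).
    by rewrite -itv_bndbnd_setU// bnd_simp.
  move: ialpha_oo; rewrite E2 (ge0_integral_setU _ (measurable_leb_itv _) (measurable_leb_itv _)); last 3 first.
  - by rewrite -E2; exact: (md _ malpha).
  - by rewrite -E2 => t /D0P; exact: dens0.
  - apply/disj_setPS => t [] /=; rewrite !in_itv /= => /andP[_ tN] /andP[Nt _].
    by move: (lt_le_trans tN Nt); rewrite ltxx.
  move=> S; apply/eqP; rewrite -leye_eq leNgt; apply/negP => I2.
  by have := lte_add_pinfty (ialpha 2 (ltr0Sn _ 1)) I2; rewrite S ltxx.
have tail_A : (\int[leb R]_(t in `[2%R, +oo[) (t^-1 * w t)%:E = +oo)%E.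
  have sub2 : (`[2%R, +oo[%classic : set (Leb R)) `<=` `]0, +oo[%classic.
    by move=> t; rewrite /= !in_itv /= !andbT; exact: lt_le_trans.
  have m2 := measurable_leb_itv `[(2 : R), +oo[.
  have k'q0 : 0 < k' `^ q' by exact: powR_gt0.
  have h : (+oo <= (k' `^ q')%:E * \int[leb R]_(t in `[2%R, +oo[) (t^-1 * w t)%:E)%E.
    rewrite -tail_alpha -(ge0_integralZl _ m2 (measurable_funS mD sub2 (md _ mA))); last 2 first.
    - by move=> t /sub2/D0P; exact: dens0.
    - by rewrite lee_fin ltW.
    apply: (ge0_le_integral _ m2).
    - by move=> t /sub2/D0P; exact: dens0.
    - exact: (measurable_funS mD sub2 (md _ malpha)).
    - by apply: measurable_funeM; exact: (measurable_funS mD sub2 (md _ mA)).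
    - move=> t t2; have t0 := D0P _ (sub2 _ t2).
      have t1 : (`]1, +oo[%classic : set R) t.
        move: t2; rewrite /= !in_itv /= !andbT; apply: lt_le_trans.
        by rewrite ltr1n.
      have [hAt _] := hA t t1; have At := A0 _ t0; have alt := alpha0 _ t0.
      rewrite -EFinM lee_fin mulrCA; apply: ler_wpM2l; first by rewrite invr_ge0 ltW.
      have kw := ltW k'0; have alw := ltW alt.
      rewrite /w !powRN ler_pdivlMr ?powR_gt0// mulrC ler_pdivrMr ?powR_gt0//.
      rewrite -(powRM _ kw alw); apply: ge0_ler_powR hAt; first exact: ltW.
        by rewrite nnegrE ltW.
      by rewrite nnegrE mulr_ge0.
  apply/eqP; rewrite -leye_eq leNgt; apply/negP => I.
  move: h; rewrite leNgt => /negP; apply.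
  have I0 : (0 <= \int[leb R]_(t in `[2%R, +oo[) (t^-1 * w t)%:E)%E.
    by apply: integral_ge0 => t /sub2/D0P; exact: dens0.
  have /fineK <- : (\int[leb R]_(t in `[2%R, +oo[) (t^-1 * w t)%:E)%E \is a fin_num.
    by rewrite ge0_fin_numE; [exact: I|exact: I0].
  by rewrite -EFinM ltry.
have Woo := primitive_unbounded mw w0 WE tail_A.
have [C C0 hC] := J_space_of_cap_couple q1 qq' A0 mA sA WE Woo X a0 ma sa aA.
have ia0 : (0 <= \int[leb R]_(t in `]0%R, +oo[) (t^-1 * a t `^ (- q'))%:E)%E.
  by apply: integral_ge0 => t /D0P; exact: dens0.
have iaf : (\int[leb R]_(t in `]0%R, +oo[) (t^-1 * a t `^ (- q'))%:E)%E \is a fin_num.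
  by rewrite ge0_fin_numE; [exact: ia|exact: ia0].
have ia_le : (\int[leb R]_(t in `]0%R, +oo[) (t^-1 * a t `^ (- q'))%:E <=
  (fine (\int[leb R]_(t in `]0%R, +oo[) (t^-1 * a t `^ (- q'))%:E))%:E)%E.
  by rewrite fineK.
have [D D0 hD] := J_space_to_cap_couple q1 qq' A0 mA sA X a0 ma aA (fine_ge0 ia0) ia_le.
have [M M0 hM] := J_space_into_K_space q1 qq' A0 mA sA WE Woo BE (cap_couple X).
have [N N0 hN] := K_space_into_J_space q1 qq' A0 mA sA WE Woo BE X.
split; first exact: (same_spaceI C0 D0 hD hC).
exact: (same_spaceI N0 M0 hM hN).
Qed.
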